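(* Let $d\ge3$. If $G\subset\mathbb{R}^d$ is a convex body in $\mathbb{R}^d$ that is X-rayed by a finite set of directions $\mathcal{E}\subset\mathbb{S}^{d-1}$, then for any $r\in\mathbb{N}$ and $0<p\le\infty$, $$w_r(G;\mathcal{E})_p\le C_{p,r,G}<\infty,$$ where the subscripts indicate the parameters $p$, $r$, $G$ on which the constant depends. In particular, this implies that for every convex body $G\subset\mathbb{R}^d$, $$\mathcal{N}_d(G)\le X_d(G).$$
   Context: Convex geometry. A convex body in $\mathbb{R}^d$ is a compact convex subset with nonempty interior. A boundary point $x$ of a convex body $G$ is illuminated in the direction $e\in\mathbb{S}^{d-1}$ if the ray $\{x+te:t\ge0\}$ intersects the interior of $G$. A set $\mathcal{E}\subset\mathbb{S}^{d-1}$ illuminates $G$ if every boundary point of $G$ is illuminated in some direction from $\mathcal{E}$. $G$ is X-rayed by $\mathcal{E}\subset\mathbb{S}^{d-1}$ if $G$ is illuminated by $\mathcal{E}\cup(-\mathcal{E})$. The X-ray number $X_d(G)$ is the smallest $n\in\mathbb{N}$ for which $G$ can be X-rayed by a set of $n$ directions. $\mathcal{N}_d(G)$ is the smallest $n\in\mathbb{N}$ for which there exists a set $\mathcal{E}\subset\mathbb{S}^{d-1}$ of $n$ directions such that $\operatorname{span}(\mathcal{E})=\mathbb{R}^d$ and $w_r(G;\mathcal{E})_p<\infty$ for all $r\in\mathbb{N}$ and $p>0$. Notation. $\|\cdot\|$ is the Euclidean norm, $\mathbb{S}^{d-1}=\{x\in\mathbb{R}^d:\|x\|=1\}$, $\mathbb{N}=\{1,2,\dots\}$.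 For $0<p<\infty$, $L^p(\Omega)$ is the usual Lebesgue space; $L^\infty(\Omega):=C(\overline{\Omega})$ with the uniform norm. For a nonempty bounded measurable set $\Omega\subset\mathbb{R}^d$, $h\in\mathbb{R}^d\setminus\{0\}$ and $r\in\mathbb{N}$ put $\Omega_{r,h}:=\{x\in\Omega: x,x+h,\dots,x+rh\in\Omega\}$ and $\triangle_h^r f(x):=\sum_{j=0}^r(-1)^{r+j}\binom{r}{j}f(x+jh)$ for $x\in\Omega_{r,h}$. For $\xi\in\mathbb{S}^{d-1}$, $t>0$, $0<p\le\infty$ let $\omega_\xi^r(f,t)_{L^p(\Omega)}:=\sup_{|u|\le t}\|\triangle_{u\xi}^rf\|_{L^p(\Omega_{r,u\xi})}$ (the norm over an empty set is $0$). For a nonempty $\mathcal{E}\subset\mathbb{S}^{d-1}$ let $\omega^r_{\mathcal{E}}(f;\Omega)_p:=\sup_{\xi\in\mathcal{E}}\omega^r_\xi(f,\operatorname{diam}(\Omega))_{L^p(\Omega)}$, where $\operatorname{diam}(\Omega)=\sup_{x,y\in\Omega}\|x-y\|$. $\Pi^d_{r-1}(\mathcal{E})$ is the set of all real continuous functions $Q$ on $\mathbb{R}^d$ such that for every fixed $x\in\mathbb{R}^d$ and $\xi\in\mathcal{E}$ the function $t\mapsto Q(x+t\xi)$ is an algebraic polynomial of degree $<r$ in $t\in\mathbb{R}$. Set $E_r(f;\mathcal{E})_{L^p(\Omega)}:=\inf\{\|f-Q\|_{L^p(\Omega)}:Q\in\Pi^d_{r-1}(\mathcal{E})\}$. The directional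 Whitney constant is $w_r(\Omega;\mathcal{E})_p:=\sup\{E_r(f;\mathcal{E})_{L^p(\Omega)}: f\in L^p(\Omega),\ \omega^r_{\mathcal{E}}(f;\Omega)_p\le 1\}\in[0,\infty]$.
   Formalization: The constant is allowed to depend on the given set of directions E as well as on p, r, G; a bound uniform over all finite E that X-ray G is false (unit ball, r=1, p=∞, nearly dependent directions). *)

(* Defs.v *)
From HB Require Import structures.
From mathcomp Require Import all_boot all_order all_algebra.
From mathcomp Require Import all_classical all_reals all_analysis.
Set Implicit Arguments.
Unset Strict Implicit.
Unset Printing Implicit Defensive.
Import Order.TTheory GRing.Theory Num.Theory.
Import numFieldNormedType.Exports.
Local Open Scope classical_set_scope.
Local Open Scope ring_scope.

(* Points of R^d are row vectors 'rV[R]_d.  The library's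
   norm `|_| on 'rV[R]_d is the max norm, so the Euclidean norm is defined
   separately; both induce the library's topology on 'rV[R]_d. *)

Definition rV_display : measure_display. Proof. exact: default_measure_display. Qed.

Section borel_rV.
Context (R : realType) (d : nat).

(* the Borel sigma-algebra, generated by the coordinate functions *)
Definition rV_measurable : set_system 'rV[R]_d :=
  <<s [set A | exists (i : 'I_d) (B : set (measurableTypeR R)),
         measurable B /\ A = [set v : 'rV[R]_d | B (v ord0 i)]] >>.

Let rV_measurable0 : rV_measurable set0.
Proof. exact: sigma_algebra0. Qed.

Let rV_measurableC A : rV_measurable A -> rV_measurable (~` A).
Proof. exact: sigma_algebraC. Qed.

Let rV_measurable_bigcup (F : (set 'rV[R]_d)^nat) :
  (forall i, rV_measurable (F i)) -> rV_measurable (\bigcup_i (F i)).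
Proof. exact: sigma_algebra_bigcup. Qed.

HB.instance Definition _ := @isMeasurable.Build rV_display 'rV[R]_d
  rV_measurable rV_measurable0 rV_measurableC rV_measurable_bigcup.

Lemma measurable_rV_coord (i : 'I_d) :
  measurable_fun [set: 'rV[R]_d]
    ((fun v => v ord0 i) : 'rV[R]_d -> measurableTypeR R).
Proof.
move=> _ B mB; rewrite setTI; apply: sub_sigma_algebra.
by exists i, B.
Qed.

Lemma measurable_fun_rVP dT (T : measurableType dT) (f : T -> 'rV[R]_d) :
  measurable_fun [set: T] f <->
  forall i, measurable_fun [set: T] ((fun x => f x ord0 i) : T -> measurableTypeR R).
Proof.
split=> [mf i|mf].
  exact: (measurableT_comp (measurable_rV_coord i) mf).
apply: measurability => //.
move=> _ [_ [i [B [mB ->]]] <-]; rewrite setTI.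
by rewrite -[X in measurable X]setTI; exact: mf.
Qed.

End borel_rV.

Section rV_cons.
Context (R : realType) (d : nat).

Definition rV_cons (p : measurableTypeR R * 'rV[R]_d) : 'rV[R]_d.+1 :=
  \row_i (if unlift ord0 i is Some j then p.2 ord0 j else p.1).

Definition rV_uncons (v : 'rV[R]_d.+1) : measurableTypeR R * 'rV[R]_d :=
  (v ord0 ord0, \row_j v ord0 (lift ord0 j)).

Lemma rV_consK : cancel rV_cons rV_uncons.
Proof.
move=> [x v]; rewrite /rV_uncons mxE unlift_none; congr pair.
by apply/rowP => j; rewrite !mxE liftK.
Qed.

Lemma rV_unconsK : cancel rV_uncons rV_cons.
Proof.
move=> v; apply/rowP => i; rewrite mxE.
by case: unliftP => [j ->|->] //=; rewrite mxE.
Qed.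

Lemma measurable_rV_cons : measurable_fun setT rV_cons.
Proof.
apply/measurable_fun_rVP => i.
have [j ->|->] := unliftP ord0 i.
  apply: (eq_measurable_fun (fun p : measurableTypeR R * 'rV[R]_d =>
      p.2 ord0 j : measurableTypeR R)).
    by move=> p _; rewrite mxE liftK.
  exact: (measurableT_comp (measurable_rV_coord j) measurable_snd).
apply: (eq_measurable_fun fst); last exact: measurable_fst.
by move=> p _; rewrite mxE unlift_none.
Qed.

Lemma measurable_rV_uncons : measurable_fun setT rV_uncons.
Proof.
apply: measurable_fun_pair; first exact: measurable_rV_coord.
apply/measurable_fun_rVP => i.
apply: (eq_measurable_fun (fun v : 'rV[R]_d.+1 =>
    v ord0 (lift ord0 i) : measurableTypeR R)).
  by move=> v _; rewrite mxE.
exact: measurable_rV_coord.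
Qed.

End rV_cons.

Section lebesgue_rV.
Context (R : realType).
Local Open Scope ereal_scope.

Section step.
Context (d : nat) (mu : {sigma_finite_measure set 'rV[R]_d -> \bar R}).

Definition lebesgue_rV_step : set 'rV[R]_d.+1 -> \bar R :=
  pushforward (@lebesgue_measure R \x mu) (@rV_cons R d).

Let pushforward_step : {measure set 'rV[R]_d.+1 -> \bar R} :=
  measure_function_pushforward__canonical__measure_function_Measure
    (@lebesgue_measure R \x mu) (@measurable_rV_cons R d).

Let step0 : lebesgue_rV_step set0 = 0.
Proof. exact: (measure0 pushforward_step). Qed.

Let step_ge0 A : 0 <= lebesgue_rV_step A.
Proof. exact: (measure_ge0 pushforward_step). Qed.

Let step_sigma : semi_sigma_additive lebesgue_rV_step.
Proof. exact: (@measure_semi_sigma_additive _ _ _ pushforward_step). Qed.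

HB.instance Definition _ := isMeasure.Build _ _ _ lebesgue_rV_step
  step0 step_ge0 step_sigma.

Let step_sigma_finite : sigma_finite setT lebesgue_rV_step.
Proof.
have /sigma_finiteP[F [FT ndF Foo]] := sigma_finiteT (@lebesgue_measure R).
have /sigma_finiteP[G [GT ndG Goo]] := sigma_finiteT mu.
exists (fun k => @rV_uncons R d @^-1` (F k `*` G k)).
  rewrite -preimage_bigcup; apply/esym; rewrite -subTset => v _ /=.
  have : (\bigcup_i F i) (rV_uncons v).1 by rewrite -FT.
  have : (\bigcup_i G i) (rV_uncons v).2 by rewrite -GT.
  move=> [m _ Gm] [n _ Fn]; exists (maxn n m) => //; split.
    by move: Fn; exact/subsetPset/ndF/leq_maxl.
  by move: Gm; exact/subsetPset/ndG/leq_maxr.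
move=> k; have [mFk Fkoo] := Foo k; have [mGk Gkoo] := Goo k; split.
  rewrite -[X in measurable X]setTI; apply: measurable_rV_uncons => //.
  exact: measurableX.
rewrite /lebesgue_rV_step /pushforward -comp_preimage.
rewrite (_ : _ \o _ = id); last by apply/funext => x /=; rewrite rV_consK.
rewrite preimage_id -[ltLHS]/((@lebesgue_measure R \x mu) (F k `*` G k)).
by rewrite product_measure1E// lte_mul_pinfty// ge0_fin_numE.
Qed.

HB.instance Definition _ := @Measure_isSigmaFinite.Build _ _ _
  lebesgue_rV_step step_sigma_finite.

End step.

(* d-dimensional Lebesgue measure, as a d-fold product of lebesgue_measure *)
Fixpoint lebesgue_rV (d : nat) : {sigma_finite_measure set 'rV[R]_d -> \bar R} :=
  match d with
  | 0 => \d_(0%R : 'rV[R]_0)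
  | d'.+1 => lebesgue_rV_step (lebesgue_rV d')
  end.

End lebesgue_rV.

Section euclidean.
Context (R : realType) (d : nat).
Implicit Types (x e h : 'rV[R]_d) (A G E : set 'rV[R]_d).

Definition enorm x : R := Num.sqrt (\sum_(i < d) x ord0 i ^+ 2).

Definition sphere : set 'rV[R]_d := [set x | enorm x = 1].

Definition diam A : R := sup [set enorm (x - y) | x in A & y in A].

Definition spans_rV E : Prop :=
  forall v : 'rV[R]_d, exists X : seq 'rV[R]_d,
    (forall e, e \in X -> E e) /\ v \in <<X>>%VS.

Definition convex_body G : Prop :=
  [/\ compact G, convex_set (G : set (convex_lmodType 'rV[R]_d)) & interior G !=set0].

Definition boundary A : set 'rV[R]_d := closure A `\` interior A.

Definition illuminated_in G x e : Prop :=
  exists2 t : R, 0 <= t & interior G (x + t *: e).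

Definition illuminates E G : Prop :=
  forall x, boundary G x -> exists2 e, E e & illuminated_in G x e.

Definition Xrayed G E : Prop := illuminates (E `|` [set - e | e in E]) G.

Definition is_smallest_pos (P : nat -> Prop) (n : nat) : Prop :=
  [/\ (0 < n)%N, P n & forall m, (0 < m)%N -> P m -> (n <= m)%N].

Definition is_Xray_number G : nat -> Prop :=
  is_smallest_pos (fun n => exists E,
    [/\ E `<=` sphere, (E #= `I_n)%card & Xrayed G E]).

End euclidean.

Arguments sphere {R d}.

Section whitney.
Context (R : realType) (d : nat).
Implicit Types (x h xi : 'rV[R]_d) (Omega E : set 'rV[R]_d).
Implicit Types (f Q : 'rV[R]_d -> R) (r : nat) (p : \bar R).
Local Open Scope ereal_scope.

(* Elements of L^p(Omega) are represented by total functions of which only the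
   values on Omega (on closure Omega if p = +oo) matter.  For p = +oo, L^p is
   C(closure Omega) with the uniform norm, not the space of essentially bounded
   functions; adjoining 0 only serves to make the norm over set0 equal to 0.
   Only 0 < p is meaningful. *)
Definition Lp_norm p Omega f : \bar R :=
  match p with
  | s%:E => (\int[@lebesgue_rV R d]_(x in Omega) (`|f x| `^ s)%:E) `^ s^-1
  | _ => ereal_sup (0 |` [set `|f x|%:E | x in closure Omega])
  end.

Definition in_Lp p Omega f : Prop :=
  match p with
  | s%:E => measurable_fun Omega (f : 'rV[R]_d -> measurableTypeR R) /\
            Lp_norm p Omega f < +oo
  | _ => {within closure Omega, continuous f}
  end.

Definition difference_domain Omega r h : set 'rV[R]_d :=
  [set x | forall j, (j <= r)%N -> Omega (x + j%:R *: h)%R].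

Definition difference r h f x : R :=
  (\sum_(j < r.+1) (-1) ^+ (r + j) * 'C(r, j)%:R * f (x + j%:R *: h))%R.

(* u = 0 contributes nothing: the difference vanishes for 0 < r *)
Definition dir_modulus r xi f (t : R) p Omega : \bar R :=
  ereal_sup [set Lp_norm p (difference_domain Omega r (u *: xi)%R)
                   (difference r (u *: xi)%R f)
            | u in [set u : R | (`|u| <= t)%R]].

Definition set_modulus r E f Omega p : \bar R :=
  ereal_sup [set dir_modulus r xi f (diam Omega) p Omega | xi in E].

(* Pi^d_(r-1)(E); recall that the degree is size - 1 *)
Definition dir_poly r E : set ('rV[R]_d -> R) :=
  [set Q | continuous Q /\
    forall x xi, E xi -> exists P : {poly R},
      (size P <= r)%N /\ forall t : R, Q (x + t *: xi)%R = P.[t]].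

Definition best_approx r f E p Omega : \bar R :=
  ereal_inf [set Lp_norm p Omega (f \- Q)%R | Q in dir_poly r E].

Definition whitney_constant r Omega E p : \bar R :=
  ereal_sup [set best_approx r f E p Omega
            | f in [set f | in_Lp p Omega f /\ set_modulus r E f Omega p <= 1]].

(* p > 0 ranges over (0, +oo], +oo included *)
Definition is_direction_number G : nat -> Prop :=
  is_smallest_pos (fun n => exists E : set 'rV[R]_d,
    [/\ E `<=` sphere, (E #= `I_n)%card, spans_rV E
      & forall r p, (0 < r)%N -> 0 < p -> whitney_constant r G E p < +oo]).

End whitney.

(* Main.v *)
Require Import Defs.
From HB Require Import structures.
From mathcomp Require Import all_boot all_order all_algebra.
From mathcomp Require Import all_classical all_reals all_analysis.
From mathcomp Require Import measurable_realfun.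
From mathcomp Require Import ring lra zify finmap.
Set Implicit Arguments.
Unset Strict Implicit.
Unset Printing Implicit Defensive.
Import Order.TTheory GRing.Theory Num.Theory.
Import numFieldNormedType.Exports.
Local Open Scope classical_set_scope.
Local Open Scope ring_scope.

(* For f with all r-th differences along E bounded, there are three steps.

   Propagation: on the line through x in a direction xi of E, f (x) is
   determined by the r-th difference and the values at x + j u xi, 0 < j <= r.
   Hence a bound for f on a small ball at an interior point propagates to the
   whole interior (E spans R^d) and, along an illuminating direction, to a
   neighbourhood in G of each boundary point; by compactness the norm on G is
   at most C (1 + N) with N the norm on a fixed small ball A0.

   Contraction: let b be a basis of (multiples of) vectors of E.  Compare f on
   A0 with its tensor-product Lagrange interpolant at z + j b, 0 <= j_i < r,
   through the points of the lattice z + k b / m.  Controlled differences make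
   f at lattice points equal to the interpolant up to O_m(1), while the
   translation by at most 1/m costs only O(1/m) times the norm of f, because the
   discrete interpolation is Lipschitz.  For p < oo a good base point z is
   selected by averaging.  The interpolant P ranges over a space of finite
   dimension and its E-differences are again bounded, so linear algebra replaces
   P by some Q in Pi(E).  For large m this gives the bound N / 2 + C for f - Q
   on A0.

   Iterating with f - Q in place of f, the norm of f - Q on A0 falls below an
   absolute constant, and propagation transports this bound to G. *)

(** * Finite differences and tensor-product interpolation *)

(** Propagation alone bounds [f] on [G] in terms of [N], which depends on [f], whereas the theorem
    needs a bound free of [f]. The order of the constants provides it. In the contraction, the
    factor of [N] depends on [m] only through [m^-deg p], while the additive constants may depend on
    [m] in any way. So [m] is fixed last, large enough to beat the propagation constant and the loss
    of the projection; after that only the number of iterations depends on [f].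

    For p < 1 there is no triangle inequality. Estimates are therefore made for the p-th power of
    the quasi-norm, which is additive over pieces of the domain, and sums are treated with weights.
    These weights must keep the number of m-dependent terms out of the factor of [N]. *)

Section finite_differences.
Variable R : realFieldType.
Implicit Types (P : {poly R}) (h x : R) (F : nat -> R).

(** One-variable model of [difference]: [F k] will be the value of [f] at the k-th point of an
    arithmetic progression on a line, see [fdiff_difference]. *)
Definition fdiff r F (k : nat) : R :=
  \sum_(j < r.+1) (-1) ^+ (r + j) * 'C(r, j)%:R * F (k + j)%N.

Lemma fdiff0 F k : fdiff 0 F k = F k.
Proof. by rewrite /fdiff big_ord1 addn0 bin0 expr0 !mul1r addn0. Qed.

Lemma fdiffS r F k : fdiff r.+1 F k = fdiff r (fun i => F i.+1 - F i) k.
Proof.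
rewrite /fdiff.
transitivity (\sum_(j < r.+1) (-1) ^+ (r + j) * 'C(r, j)%:R * F (k + j).+1
   - \sum_(j < r.+1) (-1) ^+ (r + j) * 'C(r, j)%:R * F (k + j)%N); last first.
  by rewrite -sumrB; apply: eq_bigr => j _; rewrite -mulrBr.
rewrite big_ord_recl bin0 mulr1 addn0 addn0 /=.
under eq_bigr => j _ do
  rewrite /bump /= add1n binS addnS addnS natrD mulrDr mulrDl addSn !exprS
    !mulN1r opprK.
rewrite big_split /= addrCA addrC [RHS]addrC addrAC; congr (_ + _).
rewrite addrC big_ord_recr /= bin_small// mulr0 mul0r addr0.
rewrite [in RHS]big_ord_recl /= bin0 mulr1 addn0 addn0 opprD exprS mulN1r mulNr.
rewrite addrC; congr (_ + _); rewrite -[RHS]sumrN; apply: eq_bigr => j _.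
by rewrite /bump /= add1n !addnS !exprS !mulN1r !mulNr opprK.
Qed.

Definition polydiff h P := P \Po ('X + h%:P) - P.

Lemma horner_polydiff h P x : (polydiff h P).[x] = P.[x + h] - P.[x].
Proof. by rewrite /polydiff hornerD hornerN horner_comp !hornerE. Qed.

(** Taylor's formula with increment [h]. The term [i = 0], [h] times the derivative, decides the
    degree. *)
Lemma polydiffE h P :
  polydiff h P = \sum_(i < (size P).-1) h ^+ i.+1 *: P^`N(i.+1).
Proof.
have [->|P0] := eqVneq P 0.
  by rewrite /polydiff size_poly0 big_ord0 comp_poly0 subr0.
rewrite /polydiff {1}/comp_poly nderiv_taylor; last exact: mulrC.
rewrite size_map_polyC [in LHS](polySpred P0) big_ord_recl /= expr0 mulr1.
rewrite nderivn0 -/(comp_poly 'X P) comp_polyXr addrC addrA addNr add0r.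
apply: eq_bigr => i _; rewrite /bump /= add1n nderivn_map.
by rewrite -/(comp_poly 'X _) comp_polyXr -[in LHS]rmorphXn /= mulrC mul_polyC.
Qed.

Lemma size_nderivn n P : size P^`N(n) = (size P - n)%N.
Proof.
have [sn|ns] := leqP (size P) n.
  by rewrite nderivn_poly0// size_poly0; apply/esym/eqP; rewrite subn_eq0.
apply: size_poly_eq; rewrite -mulr_natr mulf_neq0 //; last first.
  by rewrite pnatr_eq0 -lt0n bin_gt0 leq_addr.
have -> : (n + (size P - n).-1 = (size P).-1)%N by lia.
by rewrite -lead_coefE lead_coef_eq0 -size_poly_gt0; exact: leq_ltn_trans ns.
Qed.

(** The derivative term has size exactly [(size P).-1] and the other Taylor terms are smaller. An
    equality, not just a bound, is what the converse [fdiff_horner_eq0_size] uses. *)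
Lemma size_polydiff h P : h != 0 -> size (polydiff h P) = (size P).-1.
Proof.
move=> h0; rewrite polydiffE.
case E: (size P) => [|[|n]] /=; rewrite ?big_ord0 ?size_poly0//.
have s1 : size (h ^+ 1 *: P^`N(1)) = n.+1.
  by rewrite size_scale ?expf_neq0// size_nderivn E subn1.
rewrite big_ord_recl /= size_polyDl s1// ltnS.
apply: (leq_trans (size_sum _ _ _)); apply/bigmax_leqP => i _.
rewrite (leq_trans (size_scale_leq _ _))// size_nderivn E /bump/=; lia.
Qed.

Lemma fdiff_polydiff r h P t k :
  fdiff r (fun i => P.[t + i%:R * h]) k = (iter r (polydiff h) P).[t + k%:R * h].
Proof.
elim: r P k => [|r IHr] P k; first by rewrite fdiff0.
rewrite fdiffS iterSr -IHr; rewrite /fdiff; apply: eq_bigr => j _.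
by rewrite horner_polydiff -natr1 mulrDl mul1r addrA.
Qed.

Lemma size_iter_polydiff r h P :
  h != 0 -> size (iter r (polydiff h) P) = (size P - r)%N.
Proof.
by move=> h0; elim: r => [|r IHr]; rewrite ?subn0// iterS size_polydiff// IHr subnS.
Qed.

Lemma fdiff_horner_eq0 r h P t k : (0 < r)%N -> (size P <= r)%N ->
  fdiff r (fun i => P.[t + i%:R * h]) k = 0.
Proof.
move=> r0 sP; rewrite fdiff_polydiff.
have [->|h0] := eqVneq h 0.
  case: r r0 {sP} => // r _.
  have -> : iter r.+1 (polydiff 0) P = 0; last by rewrite horner0.
  by rewrite iterS /polydiff addr0 comp_polyXr subrr.
suff -> : iter r (polydiff h) P = 0 by rewrite horner0.
by apply/eqP; rewrite -size_poly_eq0 size_iter_polydiff// subn_eq0.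
Qed.

(** The r-th difference is a polynomial of size [size P - r] that vanishes at more integers than its
    degree, hence is zero. This yields the degree bound of [dir_poly]. *)
Lemma fdiff_horner_eq0_size r h P : h != 0 ->
  (forall t, fdiff r (fun i => P.[t + i%:R * h]) 0 = 0) -> (size P <= r)%N.
Proof.
move=> h0 H; rewrite -subn_eq0 -(size_iter_polydiff _ _ h0) size_poly_eq0.
apply/eqP; set Q := iter _ _ _; apply/eqP; apply/negPn/negP => Q0.
pose s := [seq (i%:R : R) | i <- iota 0 (size Q)].
suff : (size s < size Q)%N by rewrite size_map size_iota ltnn.
apply: max_poly_roots => //.
  apply/allP => x _; rewrite /root; have := H x.
  by rewrite fdiff_polydiff mul0r addr0 => ->.
by rewrite map_inj_uniq ?iota_uniq// => i j /eqP; rewrite eqr_nat => /eqP.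
Qed.

Lemma horner_bounded P (M : R) : exists2 C : R, 0 <= C &
  forall x, `|x| <= M -> `|P.[x]| <= C.
Proof.
elim/poly_ind: P => [|P c [C C0 HC]].
  by exists 0 => // x _; rewrite horner0 normr0.
exists (C * `|M| + `|c|); first by rewrite addr_ge0 ?mulr_ge0.
move=> x xM; rewrite hornerMXaddC (le_trans (ler_normD _ _))// lerD2r normrM.
by rewrite ler_pM// ?HC// (le_trans xM)// ler_norm.
Qed.

Lemma horner_lipschitz P (M : R) : exists2 C : R, 0 <= C &
  forall x y, `|x| <= M -> `|y| <= M -> `|P.[x] - P.[y]| <= C * `|x - y|.
Proof.
elim/poly_ind: P => [|P c [C C0 HC]].
  by exists 0 => // x y _ _; rewrite !horner0 subrr normr0 mul0r.
have [B B0 HB] := horner_bounded P M.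
exists (C * `|M| + B); first by rewrite addr_ge0 ?mulr_ge0.
move=> x y xM yM; rewrite !hornerMXaddC.
have -> : P.[x] * x + c - (P.[y] * y + c) = (P.[x] - P.[y]) * x + P.[y] * (x - y).
  by ring.
rewrite (le_trans (ler_normD _ _))// !normrM mulrDl lerD ?ler_wpM2r ?HB//.
rewrite [leRHS]mulrAC ler_pM ?HC//.
by rewrite (le_trans xM)// ler_norm.
Qed.

(** Lagrange basis polynomial for the nodes 0, ..., r - 1. *)
Definition ell r (j : 'I_r) : {poly R} := tnth (lagrange r (fun i => i%:R)) j.

Lemma ell_node r (i j : 'I_r) : (ell i).[j%:R] = (i == j)%:R.
Proof.
by rewrite /ell lagrange_sample// => [|x y /eqP];
  rewrite ?(leq_ltn_trans _ (ltn_ord i))// eqr_nat => /eqP.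
Qed.

Lemma size_ell r (j : 'I_r) : size (ell j) = r.
Proof.
by rewrite /ell size_lagrange_// => [|x y /eqP];
  rewrite ?(leq_ltn_trans _ (ltn_ord j))// eqr_nat => /eqP.
Qed.

Lemma ell_interp r P x : (0 < r)%N -> (size P <= r)%N ->
  P.[x] = \sum_(j < r) (ell j).[x] * P.[j%:R].
Proof.
move=> r0 sP; have inj : injective (fun i => i%:R : R).
  by move=> a b /eqP; rewrite eqr_nat => /eqP.
rewrite {1}(lagrange_gen r0 inj sP).
by rewrite horner_sum; apply: eq_bigr => j _; rewrite hornerM hornerC mulrC.
Qed.

(** The top term of an r-th difference has coefficient 1, so a sequence is determined by its r-th
    differences and its first r values, here zero. Unrolling the recurrence up to [K] costs a
    constant. *)
Lemma fdiff_zero_bound r K : (0 < r)%N -> exists2 C : R, 0 <= C &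
  forall F, (forall i, (i < r)%N -> F i = 0) ->
  forall k, (k <= K)%N -> `|F k| <= C * \sum_(i < K) `|fdiff r F i|.
Proof.
move=> r0; elim: K => [|K [C C0 HC]].
  exists 0 => // F F0 k; rewrite leqn0 => /eqP ->.
  by rewrite F0// normr0 mul0r.
pose D : R := \sum_(j < r) 'C(r, j)%:R.
have D0 : 0 <= D by apply: sumr_ge0.
exists (C + (1 + D * C)); first by rewrite !addr_ge0 ?mulr_ge0.
move=> F F0 k kK; set S := \sum_(i < K.+1) _.
have S0 : 0 <= S by apply: sumr_ge0.
have SK : \sum_(i < K) `|fdiff r F i| <= S by rewrite /S big_ord_recr/= lerDl.
have HK i : (i <= K)%N -> `|F i| <= C * S.
  by move=> iK; rewrite (le_trans (HC _ F0 _ iK))// ler_wpM2l.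
have [kr|rk] := ltnP k r.
  by rewrite F0// normr0 mulr_ge0// !addr_ge0 ?mulr_ge0.
move: kK; rewrite leq_eqVlt => /orP[/eqP kK|]; last first.
  rewrite ltnS => /HK /le_trans; apply; rewrite ler_wpM2r//.
  by rewrite lerDl addr_ge0 ?mulr_ge0.
have -> : F k = fdiff r F (k - r)
    - \sum_(j < r) (-1) ^+ (r + j) * 'C(r, j)%:R * F (k - r + j)%N.
  rewrite /fdiff big_ord_recr /= binn addnn -signr_odd odd_double expr0 !mul1r.
  by rewrite subnK// addrC addrK.
rewrite (le_trans (ler_normB _ _))// mulrDl.
have kr : (k - r < K.+1)%N by lia.
have leS : `|fdiff r F (k - r)| <= S.
  by rewrite /S (bigD1 (Ordinal kr))//= lerDl sumr_ge0.
rewrite (le_trans _ (_ : S + D * C * S <= _))//; last first.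
  by rewrite mulrDl mul1r lerDr mulr_ge0.
rewrite lerD// (le_trans (ler_norm_sum _ _ _))// -mulrA mulr_suml.
apply: ler_sum => j _; rewrite -mulrA normrMsign normrM (ger0_norm (ler0n _ _)).
by rewrite ler_wpM2l ?ler0n// HK//; have := ltn_ord j; lia.
Qed.

(** Interpolation from the coarse nodes 0, m, ..., (r - 1) m is exact for polynomials of degree < r.
    Subtracting the polynomial through the first r fine values leaves a sequence with the same
    differences, covered by [fdiff_zero_bound]. *)
Lemma ell_discrete r m K : (0 < r)%N -> (0 < m)%N -> exists2 C : R, 0 <= C &
  forall F k, (k <= K)%N ->
  `|F k - \sum_(j < r) (ell j).[k%:R / m%:R] * F (j * m)%N|
     <= C * \sum_(i < K + r * m) `|fdiff r F i|.
Proof.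
move=> r0 m0; pose N := (K + r * m)%N.
have [C C0 HC] := fdiff_zero_bound N r0.
pose B : R := \sum_(k < K.+1) \sum_(j < r) `|(ell j).[k%:R / m%:R]|.
have B0 : 0 <= B by apply: sumr_ge0 => k _; apply: sumr_ge0.
exists (C + B * C); first by rewrite addr_ge0 ?mulr_ge0.
move=> F k kK.
pose Q := \sum_(j < r) F j *: ell j.
have sQ : (size Q <= r)%N.
  apply: (leq_trans (size_sum _ _ _)); apply/bigmax_leqP => j _.
  by rewrite (leq_trans (size_scale_leq _ _))// size_ell.
pose H i := F i - Q.[i%:R].
have H0 i : (i < r)%N -> H i = 0.
  move=> ir; rewrite /H /Q horner_sum (bigD1 (Ordinal ir))//= big1 ?addr0.
    by rewrite hornerZ -[i%:R]/((Ordinal ir)%:R) ell_node eqxx mulr1 subrr.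
  move=> j /negbTE ji.
  by rewrite hornerZ -[i%:R]/((Ordinal ir)%:R) ell_node ji mulr0.
have dH i : fdiff r H i = fdiff r F i.
  have E : fdiff r (fun i => Q.[0 + i%:R * 1]) i = 0 by apply: fdiff_horner_eq0.
  rewrite -[RHS]subr0 -E /fdiff -sumrB; apply: eq_bigr => j _.
  by rewrite /H -mulrBr add0r mulr1.
(* Exactness of the coarse interpolation on [Q], read off the rescaled polynomial Q(m X). *)
have Qi : Q.[k%:R] = \sum_(j < r) (ell j).[k%:R / m%:R] * Q.[(j * m)%:R].
  have := @ell_interp r (Q \Po (m%:R *: 'X)) (k%:R / m%:R) r0.
  rewrite horner_comp hornerZ hornerX mulrC divfK ?pnatr_eq0 -?lt0n// => ->.
    by apply: eq_bigr => j _; rewrite horner_comp hornerZ hornerX -natrM mulnC.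
  rewrite size_comp_poly2// size_scale ?size_polyX//.
  by rewrite pnatr_eq0 -lt0n.
have -> : F k - \sum_(j < r) (ell j).[k%:R / m%:R] * F (j * m)%N =
          H k - \sum_(j < r) (ell j).[k%:R / m%:R] * H (j * m)%N.
  under [in RHS]eq_bigr do rewrite mulrBr.
  by rewrite sumrB -Qi /H; ring.
set S := \sum_(i < N) _.
have HS i : (i <= N)%N -> `|H i| <= C * S.
  move=> iN; rewrite (le_trans (HC _ H0 _ iN))//.
  by under eq_bigr do rewrite dH.
rewrite (le_trans (ler_normB _ _))// mulrDl lerD ?HS ?(leq_trans kK) ?leq_addr//.
rewrite (le_trans (ler_norm_sum _ _ _))// -mulrA.
have kK1 : (k < K.+1)%N by [].
apply: (@le_trans _ _ ((\sum_(j < r) `|(ell j).[k%:R / m%:R]|) * (C * S))).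
  rewrite mulr_suml; apply: ler_sum => j _; rewrite normrM ler_wpM2l// HS//.
  by rewrite (leq_trans _ (leq_addl _ _))// leq_mul2r ltnW ?orbT.
rewrite ler_wpM2r ?mulr_ge0 ?sumr_ge0//.
rewrite /B (bigD1 (Ordinal kK1))//= lerDl; apply: sumr_ge0 => i _.
exact: sumr_ge0.
Qed.

End finite_differences.

(** * Tensor-product Lagrange interpolation in d variables *)

Section tensor.
Variables (R : realFieldType) (d r : nat).
Hypothesis r0 : (0 < r)%N.
Implicit Types (s x z : 'rV[R]_d) (j : {ffun 'I_d -> 'I_r}).

Definition upd s (i : 'I_d) (a : R) : 'rV[R]_d :=
  \row_l (if l == i then a else s ord0 l).

Definition node j : 'rV[R]_d := \row_i (j i)%:R.

(** The polynomial of degree < r in each variable with value [v j] at [node j]. *)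
Definition tens (v : {ffun 'I_d -> 'I_r} -> R) s : R :=
  \sum_j v j * \prod_i (ell R (j i)).[s ord0 i].

Lemma upd_id s i : upd s i (s ord0 i) = s.
Proof. by apply/rowP => l; rewrite mxE; case: eqP => // ->. Qed.

(* T is either a bounded interval or a fine lattice: the one-variable errors
   are propagated to d variables one coordinate at a time. *)
Lemma grid_bound (T : R -> Prop) (L : R) : 0 <= L -> (forall k : 'I_r, T k%:R) ->
  (forall a (k : 'I_r), T a -> `|(ell R k).[a]| <= L) ->
  exists2 C : R, 0 <= C & forall (H : 'rV[R]_d -> R) (e : R), 0 <= e ->
    (forall s t, (forall i, T (s ord0 i)) ->
      `|H s - \sum_(k < r) (ell R k).[s ord0 t] * H (upd s t k%:R)| <= e) ->
    (forall j, H (node j) = 0) ->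
    forall s, (forall i, T (s ord0 i)) -> `|H s| <= C * e.
Proof.
move=> L0 Tn TL.
(* Induction on the number [n] of coordinates that may lie off the nodes; for [n = d] the extra
   condition is void. *)
suff X n : exists2 C : R, 0 <= C & forall (H : 'rV[R]_d -> R) (e : R), 0 <= e ->
    (forall s t, (forall i, T (s ord0 i)) ->
      `|H s - \sum_(k < r) (ell R k).[s ord0 t] * H (upd s t k%:R)| <= e) ->
    (forall j, H (node j) = 0) ->
    forall s, (forall i, T (s ord0 i)) ->
    (forall i : 'I_d, (n <= i)%N -> exists k : 'I_r, s ord0 i = k%:R) ->
    `|H s| <= C * e.
  have [C C0 HC] := X d; exists C => // H e e0 H1 H2 s sT; apply: HC => // i.
  by rewrite leqNgt ltn_ord.
elim: n => [|n [C C0 IH]].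
  exists 0 => // H e e0 _ H0 s _ sn; rewrite mul0r.
  have [f fE] := choice (fun i => sn i isT).
  have -> : s = node [ffun i => f i].
    by apply/rowP => i; rewrite mxE ffunE.
  by rewrite H0 normr0.
(* Freeing one more coordinate costs the error [e] and r values bounded by induction, each with a
   factor at most [L]. The last [C] covers [d <= n]. *)
exists (1 + r%:R * (L * C) + C); first by rewrite !addr_ge0 ?mulr_ge0.
move=> H e e0 H1 H0 s sT sn.
have [nd|dn] := ltnP n d; last first.
  apply: (le_trans (IH H e e0 H1 H0 s sT _)).
    by move=> i ni; have := ltn_ord i; lia.
  by rewrite ler_wpM2r// lerDr addr_ge0 ?mulr_ge0.
pose t := Ordinal nd.
rewrite -(subrK (\sum_(k < r) (ell R k).[s ord0 t] * H (upd s t k%:R)) (H s)).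
rewrite (le_trans (ler_normD _ _))//.
rewrite (le_trans (lerD (H1 s t sT) (ler_norm_sum _ _ _)))//.
apply: (@le_trans _ _ ((1 + r%:R * (L * C)) * e)); last first.
  by rewrite ler_wpM2r// lerDl.
rewrite mulrDl mul1r lerD2l.
have -> : r%:R * (L * C) * e = \sum_(k < r) L * (C * e).
  by rewrite sumr_const card_ord -[RHS]mulr_natl !mulrA.
apply: ler_sum => k _; rewrite normrM ler_pM ?TL//; apply: IH => //.
  by move=> i; rewrite mxE; case: ifP.
move=> i ni; rewrite mxE; case: eqP => [_|/eqP it]; first by exists k.
by apply: sn; rewrite ltn_neqAle ni andbT; apply: contraNneq it => E; apply/eqP/val_inj.
Qed.

Lemma tens_node v j : tens v (node j) = v j.
Proof.
rewrite /tens (bigD1 j)//= [\prod_i _]big1 ?mulr1; last first.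
  by move=> i _; rewrite mxE ell_node eqxx.
rewrite big1 ?addr0//.
move=> k kj; have [i ki] : exists i, k i != j i.
  apply/existsP; rewrite -negb_forall; apply: contraNN kj => /forallP E.
  by apply/eqP/ffunP => i; apply/eqP.
by rewrite (bigD1 i)//= mxE ell_node (negbTE ki) mul0r mulr0.
Qed.

Lemma tens_poly1 v s t : exists2 q : {poly R}, (size q <= r)%N &
  forall a, tens v (upd s t a) = q.[a].
Proof.
exists (\sum_j (v j * \prod_(i | i != t) (ell R (j i)).[s ord0 i]) *: ell R (j t)).
  apply: (leq_trans (size_sum _ _ _)); apply/bigmax_leqP => j _.
  by rewrite (leq_trans (size_scale_leq _ _))// size_ell.
move=> a; rewrite horner_sum; apply: eq_bigr => j _.
rewrite hornerZ (bigD1 t)//= mxE eqxx -mulrA [X in v j * X]mulrC; congr (_ * (_ * _)).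
by apply: eq_bigr => i /negbTE it; rewrite mxE it.
Qed.

Lemma tens_upd v s t :
  tens v s = \sum_(k < r) (ell R k).[s ord0 t] * tens v (upd s t k%:R).
Proof.
have [q sq Hq] := tens_poly1 v s t.
rewrite -{1}(upd_id s t) Hq (ell_interp _ r0 sq).
by apply: eq_bigr => k _; rewrite Hq.
Qed.

(** On an arbitrary line the degree may reach d (r - 1), so no size is claimed;
    [fdiff_horner_eq0_size] lowers it where differences vanish. *)
Lemma tens_line v s (u : 'rV[R]_d) : exists q : {poly R},
  forall t, tens v (s + t *: u) = q.[t].
Proof.
exists (\sum_j v j *: \prod_i (ell R (j i) \Po (u ord0 i *: 'X + (s ord0 i)%:P))).
move=> t; rewrite horner_sum; apply: eq_bigr => j _; rewrite hornerZ horner_prod.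
congr (_ * _); apply: eq_bigr => i _; rewrite horner_comp !hornerE !mxE.
by rewrite addrC mulrC.
Qed.

Lemma ell_bounded (M : R) : exists2 L : R, 1 <= L &
  forall (k : 'I_r) a, `|a| <= M -> `|(ell R k).[a]| <= L.
Proof.
have H (k : 'I_r) : exists C : R, 0 <= C /\ forall a, `|a| <= M -> `|(ell R k).[a]| <= C.
  by have [C C0 HC] := horner_bounded (ell R k) M; exists C.
have [C HC] := choice H.
exists (1 + \sum_k C k).
  by rewrite lerDl sumr_ge0// => k _; have [] := HC k.
move=> k a aM; have [C0 /(_ a aM)/le_trans] := HC k; apply.
rewrite (bigD1 k)//= addrCA lerDl addr_ge0// sumr_ge0// => l _.
by have [] := HC l.
Qed.

Lemma ell_lipschitz (M : R) : exists2 L : R, 0 <= L &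
  forall (k : 'I_r) a b, `|a| <= M -> `|b| <= M ->
    `|(ell R k).[a] - (ell R k).[b]| <= L * `|a - b|.
Proof.
have H (k : 'I_r) : exists C : R, 0 <= C /\ forall a b, `|a| <= M -> `|b| <= M ->
    `|(ell R k).[a] - (ell R k).[b]| <= C * `|a - b|.
  by have [C C0 HC] := horner_lipschitz (ell R k) M; exists C.
have [C HC] := choice H.
exists (\sum_k C k).
  by rewrite sumr_ge0// => k _; have [] := HC k.
move=> k a b aM bM; have [C0 /(_ a b aM bM)/le_trans] := HC k; apply.
rewrite ler_wpM2r// (bigD1 k)//= lerDl sumr_ge0// => l _.
by have [] := HC l.
Qed.

(** One factor is replaced at a time. The size bound is proved along with it because each
    replacement is multiplied by a remaining product. *)
Lemma prod_lipschitz (I : Type) (w : seq I) (a b : I -> R) (L e : R) :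
  1 <= L -> 0 <= e -> (forall i, `|a i| <= L) -> (forall i, `|b i| <= L) ->
  (forall i, `|a i - b i| <= e) ->
  `|\prod_(i <- w) a i| <= L ^+ size w /\
  `|\prod_(i <- w) a i - \prod_(i <- w) b i| <= (size w)%:R * L ^+ size w * e.
Proof.
move=> L1 e0 aL bL ab; have L0 : 0 <= L by apply: le_trans L1.
elim: w => [|i w [IH1 IH2]].
  by rewrite !big_nil normr1 subrr normr0 !mul0r.
rewrite !big_cons /= exprS; split.
  by rewrite normrM ler_pM.
set A := \prod_(i <- w) a i in IH1 IH2 *; set B := \prod_(i <- w) b i in IH2 *.
have -> : a i * A - b i * B = (a i - b i) * A + b i * (A - B) by ring.
rewrite (le_trans (ler_normD _ _))// !normrM.
have Ln : 0 <= L ^+ size w by rewrite exprn_ge0.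
apply: (@le_trans _ _ (e * L ^+ size w + L * ((size w)%:R * L ^+ size w * e))).
  by rewrite lerD// ler_pM.
rewrite -natr1 [leRHS](_ : _ =
  L * (e * L ^+ size w) + L * ((size w)%:R * L ^+ size w * e)); last by ring.
by rewrite lerD2r ler_peMl// mulr_ge0.
Qed.

Lemma tens_bounded (M : R) : exists2 C : R, 0 <= C & forall v s,
  (forall i, `|s ord0 i| <= M) -> `|tens v s| <= C * \sum_j `|v j|.
Proof.
have [L L1 HL] := ell_bounded M; have L0 : 0 <= L by apply: le_trans L1.
exists (L ^+ d); first exact: exprn_ge0.
move=> v s sM; rewrite (le_trans (ler_norm_sum _ _ _))// mulr_sumr.
apply: ler_sum => j _; rewrite normrM mulrC ler_wpM2r//.
have e0 i : `|(ell R (j i)).[s ord0 i] - (ell R (j i)).[s ord0 i]| <= 0.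
  by rewrite subrr normr0.
have [+ _] := prod_lipschitz (index_enum 'I_d) L1 (lexx 0)
  (fun i => HL (j i) _ (sM i)) (fun i => HL (j i) _ (sM i)) e0.
by rewrite {2}/index_enum -enumT size_enum_ord.
Qed.

Lemma tens_lipschitz (M : R) : exists2 C : R, 0 <= C & forall v s s' e, 0 <= e ->
  (forall i, `|s ord0 i| <= M) -> (forall i, `|s' ord0 i| <= M) ->
  (forall i, `|s ord0 i - s' ord0 i| <= e) ->
  `|tens v s - tens v s'| <= C * e * \sum_j `|v j|.
Proof.
have [L L1 HL] := ell_bounded M; have L0 : 0 <= L by apply: le_trans L1.
have [K K0 HK] := ell_lipschitz M.
exists (d%:R * L ^+ d * K); first by rewrite !mulr_ge0 ?exprn_ge0.
move=> v s s' e e0 sM s'M ss'; rewrite /tens -sumrB.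
rewrite (le_trans (ler_norm_sum _ _ _))// mulr_sumr.
apply: ler_sum => j _; rewrite -mulrBr normrM mulrC ler_wpM2r//.
have Ke i : `|(ell R (j i)).[s ord0 i] - (ell R (j i)).[s' ord0 i]| <= K * e.
  by rewrite (le_trans (HK _ _ _ (sM i) (s'M i)))// ler_wpM2l.
have [_] := prod_lipschitz (index_enum 'I_d) L1 (mulr_ge0 K0 e0)
  (fun i => HL (j i) _ (sM i)) (fun i => HL (j i) _ (s'M i)) Ke.
have -> : size (index_enum 'I_d) = d by rewrite /index_enum -enumT size_enum_ord.
by rewrite !mulrA.
Qed.

Variable B : 'M[R]_d.
Implicit Type P : 'rV[R]_d -> R.

(** For invertible [B] these are the tensor-product polynomials in the coordinates of the frame [B],
    a space of dimension r^d. *)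
Definition axpoly P := forall x (i : 'I_d), exists2 q : {poly R},
  (size q <= r)%N & forall t : R, P (x + t *: row i B) = q.[t].

Lemma upd_delta s i a : upd s i (s ord0 i + a) = s + a *: delta_mx ord0 i.
Proof.
apply/rowP => l; rewrite !mxE ord1 eqxx /=.
by have [->|_] := eqVneq l i; rewrite ?mulr1 ?mulr0 ?addr0.
Qed.

Lemma upd_mul s i a b : upd s i b *m B = upd s i a *m B + (b - a) *: row i B.
Proof.
rewrite rowE scalemxAl -mulmxDl; congr (_ *m _).
apply/rowP => l; rewrite !mxE ord1 eqxx /=.
by have [_|_] := eqVneq l i; rewrite ?mulr1 ?mulr0 ?addr0// addrC subrK.
Qed.

(** The difference of the two sides vanishes at the nodes and is reproduced by one-variable
    interpolation, so [grid_bound] applies with error 0, on an interval containing the coordinates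
    of [s]. *)
Lemma axpoly_tens P z s : axpoly P ->
  P (z + s *m B) = tens (fun j => P (z + node j *m B)) s.
Proof.
move=> tP; pose M := r%:R + \sum_i `|s ord0 i|.
have [L L1 HL] := ell_bounded M.
have M0 : 0 <= \sum_i `|s ord0 i| by apply: sumr_ge0.
have nM (k : 'I_r) : `|k%:R : R| <= M.
  by rewrite ger0_norm// ler_wpDr// ler_nat ltnW.
have [C _ HC] := @grid_bound (fun a => `|a| <= M) L (le_trans ler01 L1) nM
  (fun a k => HL k a).
set v := fun j => _.
have := HC (fun s => P (z + s *m B) - tens v s) 0 (lexx 0) _ _ s.
rewrite mulr0 normr_le0 subr_eq0 => H; apply/eqP; apply: H => [s' t _|j|i].
- rewrite normr_le0.
  have [q sq Hq] := tP (z + upd s' t 0 *m B) t.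
  have Pq a : P (z + upd s' t a *m B) = q.[a].
    by rewrite -Hq -addrA (upd_mul s' t 0) subr0.
  under eq_bigr do rewrite mulrBr.
  rewrite sumrB -tens_upd -{1}(upd_id s' t) Pq (ell_interp _ r0 sq).
  by under eq_bigr do rewrite -Pq; rewrite subrr.
- by rewrite tens_node subrr.
- rewrite /M (bigD1 i)//= addrCA lerDl addr_ge0// sumr_ge0//.
Qed.

Lemma axpoly_lin (I : Type) (w : seq I) (c : I -> R) (h : I -> 'rV[R]_d) P :
  axpoly P -> axpoly (fun x => \sum_(i <- w) c i * P (x + h i)).
Proof.
move=> tP x i; elim: w => [|k w [q sq Hq]].
  by exists 0 => [|t]; rewrite ?size_poly0// big_nil horner0.
have [p sp Hp] := tP (x + h k) i.
exists (c k *: p + q).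
  by rewrite (leq_trans (size_polyD _ _))// geq_max sq (leq_trans (size_scale_leq _ _)).
by move=> t; rewrite big_cons hornerD hornerZ -Hp -Hq addrAC.
Qed.

Lemma tens_axpoly v z : B \in unitmx -> axpoly (fun x => tens v ((x - z) *m invmx B)).
Proof.
move=> uB x i; set s := (x - z) *m invmx B.
have [q sq Hq] := tens_poly1 v s i.
exists (q \Po ('X + (s ord0 i)%:P)).
  by rewrite size_comp_poly2// size_XaddC.
move=> t; rewrite horner_comp hornerD hornerX hornerC [t + _]addrC -Hq upd_delta; congr tens.
by rewrite addrAC mulmxDl rowE scalemxAl mulmxK.
Qed.

End tensor.

(** * Lebesgue measure and Lp-type functionals on row vectors *)

Section measurable_rV.
Variables (R : realType) (d : nat).
Implicit Types (c h x : 'rV[R]_d) (A : set 'rV[R]_d).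

Lemma ball_rVE c e x : 0 < e ->
  ball c e x <-> forall i, `|c ord0 i - x ord0 i| < e.
Proof.
move=> e0; split=> [[_ H] i|H]; first exact: (H ord0 i).
by split=> // i j; rewrite (ord1 i); exact: H.
Qed.

Lemma measurable_ball_rV c e : measurable (ball c e : set 'rV[R]_d).
Proof.
have [e0|e0] := ltP 0 e; last first.
  suff -> : (ball c e : set 'rV[R]_d) = set0 by [].
  by rewrite -subset0 => x [+ _]; rewrite ltNge e0.
have -> : (ball c e : set 'rV[R]_d) =
    \bigcap_(i in [set: 'I_d]) ((fun v : 'rV[R]_d => v ord0 i) @^-1` ball (c ord0 i) e).
  apply/seteqP; split => x => [/(ball_rVE _ _ e0) H i _|H]; first exact: H.
  by apply/(ball_rVE _ _ e0) => i; exact: H.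
apply: fin_bigcap_measurable => // i _; rewrite -[X in measurable X]setTI.
by apply: (@measurable_rV_coord R d i) => //; apply: open_measurable; exact: ball_open.
Qed.

(** The sigma-algebra is generated by coordinates, not by open sets: an open set is the countable
    union of the max-norm balls inside it with rational centre and radius 1/(n + 1). *)
Lemma open_measurable_rV A : open A -> measurable A.
Proof.
move=> oA.
pose F (k : 'rV[rat]_d * nat) : set 'rV[R]_d :=
  if `[< ball (map_mx ratr k.1 : 'rV[R]_d) k.2.+1%:R^-1 `<=` A >]
  then ball (map_mx ratr k.1 : 'rV[R]_d) k.2.+1%:R^-1 else set0.
have -> : A = \bigcup_k F k.
  apply/seteqP; split => x; last first.
    by move=> [k _]; rewrite /F; case: asboolP => // H /H.
  move=> /oA /nbhs_ballP[e /= e0 xe].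
  have [n ne] : exists n : nat, n.+1%:R^-1 < e / 2.
    exists (Num.truncn (e / 2)^-1); rewrite invf_plt ?posrE ?divr_gt0//.
    exact: truncnS_gt.
  pose e' : R := n.+1%:R^-1.
  have e'0 : 0 < e' by rewrite invr_gt0.
  have /choice[q Hq] : forall i : 'I_d, exists q : rat, `|x ord0 i - ratr q| < e'.
    move=> i; have : x ord0 i - e' < x ord0 i + e' by lra.
    move=> /rat_in_itvoo[q]; rewrite in_itv/= => /andP[q1 q2].
    by exists q; rewrite ltr_norml; apply/andP; split; lra.
  have E i : (map_mx ratr (\row_i q i) : 'rV[R]_d) ord0 i = ratr (q i) by rewrite !mxE.
  exists (\row_i q i, n) => //; rewrite /F /=; case: asboolP => [_|[]].
    by apply/(ball_rVE _ _ e'0) => i; rewrite E distrC.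
  move=> y /(ball_rVE _ _ e'0) Hy; apply: xe; apply/(ball_rVE _ _ e0) => i.
  have := Hq i; have := Hy i; have := ne; rewrite E /= -/e' => H0 H1 H2.
  have -> : x ord0 i - y ord0 i = (x ord0 i - ratr (q i)) + (ratr (q i) - y ord0 i) by ring.
  by rewrite (le_lt_trans (ler_normD _ _))//; move: H0 H1 H2; set a := `|_|; set b := `|_|; lra.
apply: countable_bigcupT_measurable => [|k]; first exact: countableP.
by rewrite /F; case: ifP => // _; exact: measurable_ball_rV.
Qed.

Lemma closed_measurable_rV A : closed A -> measurable A.
Proof.
move=> cA; rewrite -[A]setCK; apply: measurableC; apply: open_measurable_rV.
by rewrite openC.
Qed.

Lemma continuous_measurable_rV (f : 'rV[R]_d -> R) : continuous f ->
  measurable_fun setT (f : _ -> measurableTypeR R).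
Proof.
move=> /continuousP cf; apply: (measurability _ (RGenOpens.measurableE R)).
move=> _ [_ [a [b ->]] <-]; rewrite setTI.
by apply: open_measurable_rV; exact/cf/interval_open.
Qed.

Lemma measurable_shift_rV h : measurable_fun setT (fun x : 'rV[R]_d => x + h).
Proof.
apply/measurable_fun_rVP => i.
apply: (eq_measurable_fun (fun v : 'rV[R]_d =>
    ((v ord0 i : measurableTypeR R) + h ord0 i : measurableTypeR R))).
  by move=> v _; rewrite mxE.
by apply: measurable_funD => //; exact: measurable_rV_coord.
Qed.

Lemma measurable_addX_rV :
  measurable_fun setT (fun x : 'rV[R]_d * 'rV[R]_d => x.1 + x.2).
Proof.
apply/measurable_fun_rVP => i.
apply: (eq_measurable_fun (fun v : 'rV[R]_d * 'rV[R]_d =>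
    ((v.1 ord0 i : measurableTypeR R) + v.2 ord0 i : measurableTypeR R))).
  by move=> v _; rewrite mxE.
apply: measurable_funD.
  exact: (measurableT_comp (measurable_rV_coord i) measurable_fst).
exact: (measurableT_comp (measurable_rV_coord i) measurable_snd).
Qed.

End measurable_rV.

(** * Volume of balls and translation invariance *)

Section lebesgue_rV_theory.
Variable R : realType.
Local Open Scope ereal_scope.

Lemma lebesgue_rVS d A : lebesgue_rV R d.+1 A =
  (@lebesgue_measure R \x lebesgue_rV R d) (@rV_cons R d @^-1` A).
Proof. by []. Qed.

Lemma lebesgue_rV_ball d (c : 'rV[R]_d) e : (0 < e)%R ->
  lebesgue_rV R d (ball c e) = ((e *+ 2) ^+ d)%:E.
Proof.
move=> e0; elim: d c => [|d IHd] c.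
  rewrite expr0 /= diracE; case: (boolP (_ \in _)) => // /negP[].
  by apply: mem_set; apply/(ball_rVE _ _ e0) => -[].
rewrite lebesgue_rVS.
have -> : @rV_cons R d @^-1` ball c e =
    ball (c ord0 ord0) e `*` ball (\row_j c ord0 (lift ord0 j)) e.
  apply/seteqP; split => -[t v] /=.
    move=> /(ball_rVE _ _ e0) H; split.
      by have := H ord0; rewrite mxE unlift_none.
    by apply/(ball_rVE _ _ e0) => j; have := H (lift ord0 j); rewrite !mxE liftK.
  move=> [H1 /(ball_rVE _ _ e0) H2]; apply/(ball_rVE _ _ e0) => i; rewrite mxE.
  have [j ->|->] := unliftP ord0 i; last exact: H1.
  by have := H2 j; rewrite mxE.
rewrite product_measure1E; last 2 first.
- by apply: open_measurable; exact: ball_open.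
- exact: measurable_ball_rV.
by rewrite [X in _ * X]IHd [X in X * _]lebesgue_measure_ball ?ltW// -EFinM exprS.
Qed.

Lemma lebesgue_measure_shift (h : R) (A : set (measurableTypeR R)) :
  measurable A -> @lebesgue_measure R ((fun x => (x + h)%R) @^-1` A) = lebesgue_measure A.
Proof.
move=> mA.
have ms : measurable_fun setT (fun x : measurableTypeR R => (x + h)%R : measurableTypeR R).
  exact: measurable_funD.
apply/esym; pose mu := measure_function_pushforward__canonical__measure_function_Measure
    (@lebesgue_measure R) ms.
apply: (@lebesgue_measure_unique R mu) => // _ [[a b] _ /= <-].
rewrite /pushforward.
have -> : ((fun x : measurableTypeR R => (x + h)%R) @^-1` [set` `]a, b]]) =
    [set` `](a - h)%R, (b - h)%R]].
  by apply/seteqP; split => x /=; rewrite !in_itv/= ltrBlDr lerBrDr.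
rewrite !lebesgue_measure_itv/= !lte_fin ltrD2r.
by case: ifP => // _; rewrite -!EFinB; congr EFin; ring.
Qed.

(** By induction on [d]: a translation acts separately on the two factors, and a product measure is
    determined by its values on rectangles. *)
Lemma lebesgue_rV_shift d (h : 'rV[R]_d) A :
  measurable A -> lebesgue_rV R d ((fun x => (x + h)%R) @^-1` A) = lebesgue_rV R d A.
Proof.
elim: d h A => [|d IHd] h A mA.
  congr (lebesgue_rV R 0 _); apply/seteqP; split => x /=;
  by have -> : (x + h)%R = x by apply/rowP => -[].
rewrite !lebesgue_rVS.
pose h' : 'rV[R]_d := \row_j h ord0 (lift ord0 j).
pose phi (p : measurableTypeR R * 'rV[R]_d) : measurableTypeR R * 'rV[R]_d :=
  ((p.1 + h ord0 ord0)%R, (p.2 + h')%R).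
have mphi : measurable_fun setT phi.
  apply: measurable_fun_pair; first exact: measurable_funD.
  exact: (measurableT_comp (measurable_shift_rV h') measurable_snd).
pose mu := measure_function_pushforward__canonical__measure_function_Measure
    (@lebesgue_measure R \x lebesgue_rV R d) mphi.
have mX : measurable (@rV_cons R d @^-1` A).
  by rewrite -[X in measurable X]setTI; exact: measurable_rV_cons.
transitivity (mu (@rV_cons R d @^-1` A)).
  rewrite /mu/= /pushforward; congr (_ _); apply/seteqP.
  have E p : (@rV_cons R d p + h)%R = rV_cons (phi p).
    apply/rowP => i; rewrite !mxE.
    by have [j ->|->] := unliftP ord0 i; rewrite ?liftK ?unlift_none// !mxE.
  by split => p /=; rewrite E.
apply/esym; apply: product_measure_unique => // B C mB mC.
rewrite /mu/= /pushforward.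
have -> : phi @^-1` (B `*` C) =
    ((fun x => (x + h ord0 ord0)%R) @^-1` B) `*` ((fun x => (x + h')%R) @^-1` C) by [].
rewrite product_measure1E ?[X in X * _]lebesgue_measure_shift// ?IHd//.
  by rewrite -[X in measurable X]setTI; exact: (@measurable_funD _ _ _ setT).
by rewrite -[X in measurable X]setTI; exact: measurable_shift_rV.
Qed.

Lemma ge0_integral_shift d (h : 'rV[R]_d) (D : set 'rV[R]_d) (f : 'rV[R]_d -> \bar R) :
  measurable D -> measurable_fun setT f -> (forall x, 0 <= f x) ->
  \int[lebesgue_rV R d]_(x in (fun x => (x + h)%R) @^-1` D) f (x + h)%R =
  \int[lebesgue_rV R d]_(x in D) f x.
Proof.
move=> mD mf f0.
have := @ge0_integral_pushforward _ _ _ _ _ _ (measurable_shift_rV h)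
  (lebesgue_rV R d) D f mD (measurable_funTS mf) (fun x _ => f0 x).
move=> <-; apply: (eq_measure_integral (lebesgue_rV R d)) => [|mh A mA _].
  exact: measurable_shift_rV.
exact: lebesgue_rV_shift.
Qed.

End lebesgue_rV_theory.

(** * The functional [Phi] and substitutes for the triangle inequality *)

Section Phi.
Variables (R : realType) (d : nat).
Implicit Types (A B : set 'rV[R]_d) (f g : 'rV[R]_d -> R) (p : \bar R).

(* The p-th power of the L^p quasi-norm for finite p, the uniform norm over A
   itself (not over its closure) for p = +oo *)
Definition Phi p A f : \bar R :=
  match p with
  | s%:E => \int[lebesgue_rV R d]_(x in A) (`|f x| `^ s)%:E
  | _ => ereal_sup (0%E |` [set `|f x|%:E | x in A])
  end.

(** Degree of homogeneity of [Phi]: a factor c in the function becomes |c| to the power [deg p]. *)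
Definition deg p : R := if p is s%:E then s else 1.

Definition pmeas p f : Prop :=
  if p is _%:E then measurable_fun setT (f : _ -> measurableTypeR R) else True.

Variable p : \bar R.
Hypothesis p0 : (0 < p)%E.

Lemma deg_gt0 : 0 < deg p.
Proof. by case: p p0 => //= s; rewrite lte_fin. Qed.

Lemma Phi_ge0 A f : (0 <= Phi p A f)%E.
Proof.
case: p => [s||] /=.
- by apply: integral_ge0 => x _; rewrite lee_fin powR_ge0.
- by apply: ereal_sup_ubound; left.
- by apply: ereal_sup_ubound; left.
Qed.

Lemma measurable_norm_powR (s : R) f :
  measurable_fun setT (f : _ -> measurableTypeR R) ->
  measurable_fun setT (fun x => (`|f x| `^ s)%:E).
Proof.
move=> mf; apply/measurable_EFinP.
apply: (measurableT_comp (measurable_powR s)).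
exact: (measurableT_comp (@normr_measurable R setT) mf).
Qed.

(** The sum of the a_i equals the sum of the n_i^-1 (n_i a_i), hence is at most the largest n_i a_i.
    A single term on the right suffices, whether s < 1 or not. *)
Lemma powR_sum_le (I : finType) (a n : I -> R) (s : R) : 0 < s ->
  (forall i, 0 <= a i) -> (forall i, 0 < n i) -> \sum_i (n i)^-1 <= 1 ->
  (\sum_i a i) `^ s <= \sum_i (n i * a i) `^ s.
Proof.
move=> s0 a0 n0 n1; have S0 : 0 <= \sum_i a i by apply: sumr_ge0.
have [E|] := eqVneq (\sum_i a i) 0.
  by rewrite E powR0 ?gt_eqF// sumr_ge0// => i _; exact: powR_ge0.
move=> Sn0; have {Sn0}Sp : 0 < \sum_i a i by rewrite lt_def Sn0.
have [i0 _|I0] := pickP (@predT I); last by move: Sp; rewrite big_pred0 ?ltxx.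
case: (@arg_maxP _ _ _ i0 predT (fun i => n i * a i)) => // i _ Hi.
rewrite [leRHS](bigD1 i)//= ler_wpDr//; first by rewrite sumr_ge0// => k _; exact: powR_ge0.
have na0 : 0 <= n i * a i by rewrite mulr_ge0 ?a0// ltW.
apply: ge0_ler_powR; rewrite ?nnegrE ?(ltW s0)//.
apply: (@le_trans _ _ (\sum_k (n k)^-1 * (n i * a i))).
  apply: ler_sum => k _; rewrite mulrC ler_pdivlMr// mulrC; exact: Hi.
by rewrite -mulr_suml ler_piMl.
Qed.

(* Replaces the triangle inequality, with the weights n_i absorbing the failure
   of subadditivity uniformly in p > 0; the weight 1/n_i of a term is free. *)
Lemma Phi_wdom (I : finType) (n c : I -> R) (g : I -> 'rV[R]_d -> R)
  (h : I -> 'rV[R]_d) (B : I -> set 'rV[R]_d) (K : I -> R) A f :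
  (forall i, 0 < n i) -> \sum_i (n i)^-1 <= 1 ->
  measurable A -> (forall i, measurable (B i)) -> pmeas p f ->
  (forall i, pmeas p (g i)) -> (forall i, 0 <= c i) ->
  (forall i, Phi p (B i) (g i) <= (K i)%:E)%E ->
  (forall i x, A x -> B i (x + h i)) ->
  (forall x, A x -> `|f x| <= \sum_i c i * `|g i (x + h i)|) ->
  (Phi p A f <= (\sum_i (n i * c i) `^ deg p * K i)%:E)%E.
Proof.
move=> n0 n1 mA mB mf mg c0 HK AB H.
have nc0 i : 0 <= n i * c i by rewrite mulr_ge0 ?c0 ?(ltW (n0 i)).
have K0 i : 0 <= K i by rewrite -lee_fin (le_trans (Phi_ge0 (B i) (g i))).
have [[s pE]|pE] : (exists s, p = s%:E) \/ p = +oo%E.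
  by case: p p0 => [s||]//; [left; exists s|right].
  have s0 : 0 < s by move: p0; rewrite pE lte_fin.
  move: mf mg HK; rewrite pE /= => mf mg HK.
  apply: (@le_trans _ _ (\int[lebesgue_rV R d]_(x in A)
      (\sum_(i : I) ((n i * c i) `^ s)%:E * (`|g i (x + h i)| `^ s)%:E)%E)%E).
    apply: ge0_le_integral => //.
    - exact: (measurable_funTS (measurable_norm_powR s mf)).
    - apply/measurable_funTS/emeasurable_sum => i.
      apply: measurable_funeM.
      exact: (measurableT_comp (measurable_norm_powR s (mg i)) (measurable_shift_rV (h i))).
    - move=> x Ax; under eq_bigr do rewrite -EFinM.
      rewrite sumEFin lee_fin.
      apply: (@le_trans _ _ ((\sum_i c i * `|g i (x + h i)|) `^ s)).
        by apply: ge0_ler_powR; rewrite ?nnegrE ?(ltW s0) ?H// sumr_ge0// => i _; rewrite mulr_ge0.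
      apply: (le_trans (powR_sum_le s0 _ n0 n1)) => [i|]; first by rewrite mulr_ge0.
      by apply: ler_sum => i _; rewrite mulrA powRM ?nc0.
  rewrite ge0_integral_sum//; last 2 first.
  - move=> i; apply: measurable_funeM; apply: measurable_funTS.
    exact: (measurableT_comp (measurable_norm_powR s (mg i)) (measurable_shift_rV (h i))).
  - by move=> i x _; rewrite -EFinM lee_fin mulr_ge0 ?powR_ge0.
  rewrite -sumEFin; apply: lee_sum => i _.
  rewrite ge0_integralZl_EFin ?powR_ge0//; last first.
    apply: measurable_funTS.
    exact: (measurableT_comp (measurable_norm_powR s (mg i)) (measurable_shift_rV (h i))).
  rewrite EFinM lee_wpmul2l ?lee_fin ?powR_ge0//; apply: le_trans (HK i).
  (* Translation invariance rewrites the bound over [B i] as an integral over its preimage under the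
     shift, which contains [A]. *)
  rewrite -(ge0_integral_shift (h i) (mB i) (measurable_norm_powR s (mg i))); last first.
    by move=> x; rewrite lee_fin powR_ge0.
  apply: ge0_subset_integral => //.
  - by rewrite -[X in measurable X]setTI; exact: measurable_shift_rV.
  - apply: measurable_funTS.
    exact: (measurableT_comp (measurable_norm_powR s (mg i)) (measurable_shift_rV (h i))).
  - by move=> x; exact: AB.
move: HK; rewrite pE /= => HK; apply: ge_ereal_sup => _ [->|[x Ax <-]].
  by rewrite lee_fin sumr_ge0// => i _; rewrite mulr_ge0 ?powR_ge0.
rewrite lee_fin (le_trans (H x Ax))//; apply: ler_sum => i _.
rewrite powRr1 ?nc0//.
have : `|g i (x + h i)| <= K i.
  rewrite -lee_fin (le_trans _ (HK i))//; apply: ereal_sup_ubound; right.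
  by exists (x + h i) => //; exact: AB.
(* Each n_i is at least 1, because the inverses sum to at most 1. *)
move=> gK; rewrite ler_pM// ler_peMl// -invf_le1// (le_trans _ n1)//.
by rewrite (bigD1 i)//= lerDl sumr_ge0// => k _; rewrite invr_ge0 ltW.
Qed.

(** Equal weights [#|I|]. If [I] is empty there are no weights, but then [f] vanishes on [A]. *)
Lemma Phi_dom (I : finType) (c : I -> R) (g : I -> 'rV[R]_d -> R)
  (h : I -> 'rV[R]_d) (B : I -> set 'rV[R]_d) (K : I -> R) A f :
  measurable A -> (forall i, measurable (B i)) -> pmeas p f ->
  (forall i, pmeas p (g i)) -> (forall i, 0 <= c i) ->
  (forall i, Phi p (B i) (g i) <= (K i)%:E)%E ->
  (forall i x, A x -> B i (x + h i)) ->
  (forall x, A x -> `|f x| <= \sum_i c i * `|g i (x + h i)|) ->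
  (Phi p A f <= (\sum_i (#|I|%:R * c i) `^ deg p * K i)%:E)%E.
Proof.
have [i0 _ mA|I0 mA mB mf _ _ _ _ H] := pickP (@predT I).
  have I0 : 0 < #|I|%:R :> R by rewrite ltr0n; apply/card_gt0P; exists i0.
  apply: Phi_wdom => //; rewrite sumr_const -[leLHS]mulr_natr mulVf ?gt_eqF//.
rewrite big_pred0//.
have f0 x : A x -> f x = 0.
  by move=> /H; rewrite big_pred0// normr_le0 => /eqP.
case: p p0 => [s||] //=; rewrite ?lte_fin => s0.
- rewrite integral0_eq// => x Ax.
  by rewrite f0// normr0 powR0 ?gt_eqF.
- by apply: ge_ereal_sup => _ [->|[x Ax <-]]; rewrite ?f0 ?normr0.
Qed.

Lemma Phi_mono A B f : measurable A -> measurable B -> pmeas p f -> A `<=` B ->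
  (Phi p A f <= Phi p B f)%E.
Proof.
move=> mA mB; case: p => [s||] //= mf AB.
- apply: ge0_subset_integral => //.
  exact: (measurable_funTS (measurable_norm_powR s mf)).
- by apply: le_ereal_sup => _ [->|[x Ax <-]]; [left|right; exists x => //; exact: AB].
- by apply: le_ereal_sup => _ [->|[x Ax <-]]; [left|right; exists x => //; exact: AB].
Qed.

(** No quasi-norm constant arises: the integral of a p-th power is subadditive over a cover, and a
    supremum over a union is below the sum. *)
Lemma Phi_cover (I : finType) A (B : I -> set 'rV[R]_d) (K : I -> R) f :
  measurable A -> (forall i, measurable (B i)) -> pmeas p f ->
  A `<=` \bigcup_i B i -> (forall i, Phi p (B i) f <= (K i)%:E)%E ->
  (Phi p A f <= (\sum_i K i)%:E)%E.
Proof.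
move=> mA mB mf AB HK.
have K0 i : 0 <= K i by rewrite -lee_fin (le_trans (Phi_ge0 (B i) f)).
have [[s pE]|pE] : (exists s, p = s%:E) \/ p = +oo%E.
  by case: p p0 => [s||]//; [left; exists s|right].
  move: mf HK; rewrite pE /= => mf HK.
  have mfs := measurable_norm_powR s mf.
  rewrite integral_mkcond.
  apply: (@le_trans _ _ (\int[lebesgue_rV R d]_x
      (\sum_(i : I) ((fun x => (`|f x| `^ s)%:E) \_ (B i)) x)%E)%E).
    apply: ge0_le_integral => //.
    - by move=> x _; rewrite patchE; case: ifP => // _; rewrite lee_fin powR_ge0.
    - by apply/(measurable_restrictT _ mA); exact: measurable_funTS.
    - apply/emeasurable_sum => i.
      by apply/(measurable_restrictT _ (mB i)); exact: measurable_funTS.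
    - move=> x _; rewrite patchE; case: ifPn => [|_].
        move=> /set_mem/AB[i _ Bix]; rewrite (bigD1 i)//= patchE (mem_set Bix).
        rewrite leeDl// sume_ge0// => k _; rewrite patchE.
        by case: ifP => // _; exact: powR_ge0.
      rewrite sume_ge0// => k _; rewrite patchE.
      by case: ifP => // _; exact: powR_ge0.
  rewrite ge0_integral_sum//; last 2 first.
  - by move=> i; apply/(measurable_restrictT _ (mB i)); exact: measurable_funTS.
  - by move=> i x _; rewrite patchE; case: ifP => // _; rewrite lee_fin powR_ge0.
  rewrite -sumEFin; apply: lee_sum => i _.
  by rewrite -integral_mkcond.
move: HK; rewrite pE /= => HK; apply: ge_ereal_sup => _ [->|[x Ax <-]].
  by rewrite lee_fin sumr_ge0.
have [i _ Bx] := AB x Ax.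
apply: (@le_trans _ _ (K i)%:E); last by rewrite lee_fin (bigD1 i)//= lerDl sumr_ge0.
by apply: le_trans (HK i); apply: ereal_sup_ubound; right; exists x.
Qed.

Lemma Phi_cst_ball z e : 0 < e -> exists2 V : R, 0 < V &
  forall c : R, 0 <= c -> Phi p (ball z e) (cst c) = (V * c `^ deg p)%:E.
Proof.
move=> e0; have [[s pE]|pE] : (exists s, p = s%:E) \/ p = +oo%E.
- by case: p p0 => [s||]//; [left; exists s|right].
- exists ((e *+ 2) ^+ d); first by rewrite exprn_gt0// mulrn_wgt0.
  move=> c c0; rewrite pE /= ger0_norm// integral_cst; last exact: measurable_ball_rV.
  by rewrite [X in (_ * X)%E]lebesgue_rV_ball// -EFinM mulrC.
- exists 1 => // c c0; rewrite pE /= powRr1// mul1r.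
  apply/eqP; rewrite eq_le; apply/andP; split.
    by apply: ge_ereal_sup => _ [->|[x _ <-]]; rewrite lee_fin// ger0_norm.
  apply: ereal_sup_ubound; right; exists z; last by rewrite ger0_norm.
  exact: ballxx.
Qed.

Lemma pmeas_continuous f : continuous f -> pmeas p f.
Proof. by move=> cf; case: p => //= _; exact: continuous_measurable_rV. Qed.

Lemma pmeas_shift f h : pmeas p f -> pmeas p (fun x => f (x + h)).
Proof.
case: p => //= _ mf; exact: (measurableT_comp mf (measurable_shift_rV h)).
Qed.

Lemma pmeas_lin (I : Type) (w : seq I) (c : I -> R) (g : I -> 'rV[R]_d -> R) :
  (forall i, pmeas p (g i)) -> pmeas p (fun x => \sum_(i <- w) c i * g i x).
Proof.
case: p => //= _ mg.
apply: (@measurable_sum _ _ _ setT _ w (fun i x => c i * g i x)) => i.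
by apply: measurable_funM => //; exact: mg.
Qed.

Lemma pmeasB f g : pmeas p f -> pmeas p g -> pmeas p (fun x => f x - g x).
Proof. by case: p => //= _ mf mg; exact: measurable_funB. Qed.

Lemma pmeas_difference r h f : pmeas p f -> pmeas p (difference r h f).
Proof.
move=> mf; rewrite /difference; apply: pmeas_lin => j; exact: pmeas_shift.
Qed.

End Phi.

(** * Propagation of bounds in a convex body *)

Section normed_rV.
Variables (R : realType) (d : nat).
Implicit Types (x y v : 'rV[R]_d).

Lemma norm_rV_ltP v e : 0 < e -> `|v| < e <-> forall i, `|v ord0 i| < e.
Proof.
move=> e0; have := ball_rVE 0 v e0; rewrite -ball_normE /= sub0r normrN => ->.
by split => H i; have := H i; rewrite mxE sub0r normrN.
Qed.

Lemma coord_le_norm v i : `|v ord0 i| <= `|v|.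
Proof.
rewrite leNgt; apply/negP => H.
have e0 : 0 < `|v ord0 i| by apply: le_lt_trans H.
by move: H => /(norm_rV_ltP _ e0)/(_ i); rewrite ltxx.
Qed.

Lemma norm_rV_leP v e : 0 <= e -> (forall i, `|v ord0 i| <= e) -> `|v| <= e.
Proof.
move=> e0 H; rewrite leNgt; apply/negP => ev.
have v0 : 0 < `|v| by apply: le_lt_trans ev.
suff : `|v| < `|v| by rewrite ltxx.
by apply/(norm_rV_ltP _ v0) => i; exact: le_lt_trans (H i) ev.
Qed.

Lemma mulmx_bounded (M : 'M[R]_d) : exists2 K : R, 0 < K &
  forall v, `|v *m M| <= K * `|v|.
Proof.
exists (1 + \sum_i \sum_j `|M i j|).
  by rewrite ltr_pwDl// sumr_ge0// => i _; rewrite sumr_ge0.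
move=> v; apply: norm_rV_leP => [|j].
  by rewrite mulr_ge0// addr_ge0// sumr_ge0// => i _; rewrite sumr_ge0.
rewrite mxE (le_trans (ler_norm_sum _ _ _))// mulrDl mul1r ler_wpDl// mulr_suml.
apply: ler_sum => i _; rewrite normrM mulrC ler_pM ?coord_le_norm//.
by rewrite (bigD1 j)//= lerDl sumr_ge0.
Qed.

Lemma interior_ballP (G : set 'rV[R]_d) x :
  interior G x <-> exists2 e : R, 0 < e & ball x e `<=` G.
Proof.
by split => [/nbhs_ballP[e e0 H]|[e e0 H]]; [exists e|apply/nbhs_ballP; exists e].
Qed.

Lemma convex_segment (G : set 'rV[R]_d) x y (t : R) :
  convex_set (G : set (convex_lmodType 'rV[R]_d)) -> G x -> G y ->
  0 <= t <= 1 -> G (x + t *: (y - x)).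
Proof.
move=> cG Gx Gy /andP[t0 t1].
have := cG y x (Itv01 t0 t1); move=> /(_ (mem_set Gy) (mem_set Gx)) /set_mem.
rewrite /conv /= /unstable.onem.
suff -> : x + t *: (y - x) = t *: y + (1 - t) *: x by [].
by apply/rowP => i; rewrite !mxE; ring.
Qed.

(** The homothety with centre [x] and ratio [t] maps a ball around [c] in [G] onto a ball around the
    new point, inside [G] by convexity. *)
Lemma convex_interior (G : set 'rV[R]_d) x c (t : R) :
  convex_set (G : set (convex_lmodType 'rV[R]_d)) -> G x -> interior G c ->
  0 < t <= 1 -> interior G (x + t *: (c - x)).
Proof.
move=> cG Gx /interior_ballP[e e0 He] /andP[t0 t1].
apply/interior_ballP; exists (t * e); first by rewrite mulr_gt0.
move=> y; rewrite -ball_normE /= => Hy.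
have tn0 : t != 0 by rewrite gt_eqF.
pose z := x + t^-1 *: (y - x).
have Gz : G z.
  apply: He; rewrite -ball_normE /=.
  have -> : c - z = t^-1 *: (x + t *: (c - x) - y).
    by apply/rowP => i; rewrite !mxE; field.
  by rewrite normrZ gtr0_norm ?invr_gt0// ltr_pdivrMl.
have -> : y = x + t *: (z - x) by apply/rowP => i; rewrite !mxE; field.
by apply: convex_segment => //; rewrite (ltW t0).
Qed.

(** Induction over the real interval: the supremum of the good initial segments is itself good by
    the second hypothesis, and by the third it cannot be below 1. *)
Lemma closed_segment_ind (A : R -> Prop) : A 0 ->
  (forall t, 0 < t <= 1 -> (forall u, 0 <= u < t -> A u) -> A t) ->
  (forall t, 0 <= t < 1 -> A t -> exists2 e : R, 0 < e & forall u, t <= u < t + e -> A u) ->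
  A 1.
Proof.
move=> A0 Acl Aop.
pose S := [set t : R | 0 <= t <= 1 /\ forall u, 0 <= u <= t -> A u].
have S0 : S 0.
  split=> [|u /andP[u0 u1]]; rewrite ?lexx ?ler01// (_ : u = 0)//.
  by apply/eqP; rewrite eq_le u0 u1.
have hS : has_sup S by split; [exists 0|exists 1 => t [/andP[]]].
set T := sup S.
have T0 : 0 <= T by apply: ub_le_sup => //; exact: (proj2 hS).
have T1 : T <= 1 by apply: ge_sup; [exists 0|move=> t [/andP[]]].
have AT u : 0 <= u < T -> A u.
  move=> /andP[u0 uT]; have Tu : 0 < T - u by rewrite subr_gt0.
  have [t [_ St] ut] := sup_adherent Tu hS.
  by apply: St; rewrite u0 ltW//; move: ut; rewrite -/T subKr.
have ATT : A T.
  have [<-//|Tn0] := eqVneq 0 T; apply: Acl => //.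
  by rewrite T1 lt_neqAle Tn0 T0.
have [<-//|Tn1] := eqVneq T 1.
have T1' : 0 <= T < 1 by rewrite T0 lt_neqAle Tn1 T1.
have [e e0 He] := Aop T T1' ATT.
pose t := Num.min (T + e / 2) 1.
suff St : S t.
  have : t <= T by apply: ub_le_sup => //; exact: (proj2 hS).
  rewrite /t ge_min => /orP[|]; last by move: T1' => /andP[_]; lra.
  lra.
have t0 : 0 <= t by rewrite le_min ler01 andbT; lra.
split; first by rewrite t0 ge_min lexx orbT.
move=> u /andP[u0 ut]; have [uT|Tu] := ltP u T; first by apply: AT; rewrite u0.
apply: He; rewrite Tu /=; move: ut; rewrite /t le_min => /andP[+ _]; lra.
Qed.

End normed_rV.

(** The term [j = 0] of the difference has coefficient 1 or -1, so it can be solved for. *)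
Lemma le_difference (R : realType) (d r : nat) (h y : 'rV[R]_d) f :
  `|f y| <= `|difference r h f y|
    + \sum_(j < r) 'C(r, j.+1)%:R * `|f (y + j.+1%:R *: h)|.
Proof.
rewrite /difference big_ord_recl /= bin0 mulr1 addn0 scale0r addr0.
set S := \sum_(i < r) _.
have -> : `|f y| = `|(-1) ^+ r * f y + S - S| by rewrite addrK normrMsign.
rewrite (le_trans (ler_normB _ _))// lerD2l (le_trans (ler_norm_sum _ _ _))//.
by apply: ler_sum => j _; rewrite -mulrA normrMsign normrM ger0_norm.
Qed.

Section propagation.
Variables (R : realType) (d r : nat) (p : \bar R) (G E : set 'rV[R]_d).
Hypotheses (r0 : (0 < r)%N) (p0 : (0 < p)%E).
Hypotheses (mG : measurable G) (cG : convex_set (G : set (convex_lmodType 'rV[R]_d))).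
Implicit Types (A B : set 'rV[R]_d) (f g : 'rV[R]_d -> R) (x y xi : 'rV[R]_d).

(* Stands for [set_modulus r E g G p <= 1]; unlike the latter it is stated on
   arbitrary measurable subsets and with suprema over sets, not closures. *)
Definition adm g : Prop := pmeas p g /\
  forall xi u A, E xi -> measurable A ->
    (forall x j, A x -> (j <= r)%N -> G (x + j%:R *: (u *: xi))) ->
    (Phi p A (difference r (u *: xi) g) <= 1)%E.

Variable A0 : set 'rV[R]_d.

(** The constant is uniform in [g], and the bound is affine in [N]: the summand 1 accounts for the
    differences. *)
Definition controlled A : Prop := exists2 C : R, 0 <= C & forall g N, adm g ->
  0 <= N -> (Phi p A0 g <= N%:E)%E -> (Phi p A g <= (C * (1 + N))%:E)%E.

Definition ctrl_at x : Prop := exists2 e : R, 0 < e & controlled (ball x e `&` G).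

Lemma measurable_ballG x e : measurable (ball x e `&` G).
Proof. by apply: measurableI => //; exact: measurable_ball_rV. Qed.

Lemma controlledS A B : measurable A -> measurable B -> A `<=` B ->
  controlled B -> controlled A.
Proof.
move=> mA mB AB [C C0 HC]; exists C => // g N ag N0 gN.
by apply: le_trans (HC g N ag N0 gN); apply: Phi_mono => //; case: ag.
Qed.

Lemma ctrl_at_ball x : ctrl_at x -> exists2 e : R, 0 < e &
  forall y, ball x e y -> ctrl_at y.
Proof.
move=> [e e0 He]; exists (e / 2); rewrite ?divr_gt0// => y xy.
exists (e / 2); rewrite ?divr_gt0//; apply: controlledS He; try exact: measurable_ballG.
apply: setSI => z yz; rewrite (splitr e); exact: ball_triangle xy yz.
Qed.

Lemma common_radius n (Q : 'I_n -> R -> Prop) :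
  (forall i, exists2 e : R, 0 < e & forall e', 0 < e' <= e -> Q i e') ->
  exists2 e : R, 0 < e & forall i, Q i e.
Proof.
move=> H; have /choice[f Hf] : forall i, exists e : R, 0 < e /\
    forall e', 0 < e' <= e -> Q i e'.
  by move=> i; have [e e0 He] := H i; exists e.
have m0 : 0 < \big[Num.min/1]_i f i by apply: lt_bigmin => // i _; case: (Hf i).
exists (\big[Num.min/1]_i f i) => // i; have [_] := Hf i; apply.
by rewrite m0 bigmin_le_cond.
Qed.

(** Near [x], [le_difference] bounds [g] by one difference and by values near the r points ahead.
    Since these are interior, translates of a small ball around [x] stay in [G] even if [x] is a
    boundary point. *)
Lemma ctrl_at_step x xi u : E xi ->
  (forall j, (0 < j <= r)%N -> interior G (x + j%:R *: (u *: xi))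
     /\ ctrl_at (x + j%:R *: (u *: xi))) -> ctrl_at x.
Proof.
move=> Exi H; pose h := u *: xi.
have [e e0 He] : exists2 e : R, 0 < e & forall j : 'I_r,
    ball (x + j.+1%:R *: h) e `<=` G /\
    controlled (ball (x + j.+1%:R *: h) e `&` G).
  apply: common_radius => j.
  have [/interior_ballP[e1 e10 H1] [e2 e20 H2]] := H j.+1 (ltn_ord j).
  exists (Num.min e1 e2); first by rewrite lt_min e10.
  move=> e /andP[e0]; rewrite le_min => /andP[ee1 ee2]; split.
    by apply: subset_trans H1; exact: le_ball.
  apply: controlledS H2; try exact: measurable_ballG.
  by apply: setSI; exact: le_ball.
exists e => //; set A := ball x e `&` G.
pose B (i : 'I_r.+1) := ball (x + (i : nat)%:R *: h) e `&` G.
(* Index 0 carries the difference, a positive index j the values of [g] around the j-th point. *)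
pose gg g (i : 'I_r.+1) := if (i : nat) is 0 then difference r h g else g.
have AB (i : 'I_r.+1) y : A y -> B i (y + (i : nat)%:R *: h).
  move=> [xy Gy].
  have Bi : ball (x + (i : nat)%:R *: h) e (y + (i : nat)%:R *: h).
    by move: xy; rewrite -!ball_normE /= opprD addrACA subrr addr0.
  split=> //; move: Bi; case: i => -[|j] jr /=; first by rewrite !scale0r !addr0.
  by have [H1 _] := He (Ordinal (jr : (j < r)%N)); exact: H1.
have /choice[C HC] : forall i : 'I_r.+1, exists C : R, 0 <= C /\ forall g N, adm g ->
    0 <= N -> (Phi p A0 g <= N%:E)%E ->
    (Phi p (B i) (gg g i) <= (C * (1 + N))%:E)%E.
  case=> -[|j] jr.
    exists 1; split=> // g N ag N0 gN; rewrite /gg /= mul1r.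
    apply: (@le_trans _ _ 1%E); last by rewrite lee_fin lerDl.
    have -> : B (Ordinal jr) = A by rewrite /B /= scale0r addr0.
    have [_] := ag; apply=> // [|y k Ay kr]; first exact: measurable_ballG.
    by have [] := AB (Ordinal (kr : (k < r.+1)%N)) y Ay.
  by have [_ [C C0 HC]] := He (Ordinal (jr : (j < r)%N)); exists C.
pose c (i : 'I_r.+1) : R := 'C(r, i)%:R.
exists (\sum_i (#|'I_r.+1|%:R * c i) `^ deg p * C i).
  by apply: sumr_ge0 => i _; rewrite mulr_ge0 ?powR_ge0//; case: (HC i).
move=> g N ag N0 gN; have [mg _] := ag.
rewrite mulr_suml; under eq_bigr do rewrite -mulrA.
apply: (@Phi_dom R d p p0 _ c (gg g) (fun i => (i : nat)%:R *: h) B) => //.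
- exact: measurable_ballG.
- by move=> i; exact: measurable_ballG.
- by move=> [[|j] jr] //; exact: pmeas_difference.
- by move=> i; case: (HC i) => _; apply.
- move=> y Ay; rewrite big_ord_recl /= /c bin0 mul1r scale0r addr0.
  exact: le_difference.
Qed.

Lemma ctrl_at_segment x xi (c : R) : E xi -> ctrl_at x ->
  (forall t, 0 <= t <= 1 -> interior G (x + (t * c) *: xi)) ->
  ctrl_at (x + c *: xi).
Proof.
move=> Exi cx H; rewrite -[c]mul1r.
apply: (@closed_segment_ind _ (fun t => ctrl_at (x + (t * c) *: xi))).
- by rewrite mul0r scale0r addr0.
- move=> t /andP[t0 t1] IH.
  (* With this step the r points ahead sit at the times t (1 - j / (r + 1)), all earlier than [t]
     and so already controlled. *)
  apply: (@ctrl_at_step _ xi (- (t * c) / r.+1%:R)) => // j /andP[j0 jr].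
  have -> : x + (t * c) *: xi + j%:R *: ((- (t * c) / r.+1%:R) *: xi) =
     x + (t * (1 - j%:R / r.+1%:R) * c) *: xi.
    rewrite -addrA scalerA -scalerDl; congr (_ + _ *: _).
    have := lt0r_neq0 (ltr0Sn R r).
    move: (r.+1%:R : R) => n n0. by field.
  have j1 : 0 < j%:R / r.+1%:R :> R by rewrite divr_gt0// ltr0n.
  have j2 : j%:R / r.+1%:R <= 1 :> R by rewrite ler_pdivrMr// mul1r ler_nat ltnW.
  have Ht : 0 <= t * (1 - j%:R / r.+1%:R) < t.
    by rewrite mulr_ge0 ?(ltW t0) ?subr_ge0//= gtr_pMr// ltrBlDr ltrDl.
  split; last exact: IH.
  by apply: H; case/andP: Ht => -> /= /ltW/le_trans; apply.
- move=> t /andP[t0 t1] /ctrl_at_ball[e e0 He].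
  exists (e / (1 + `|c *: xi|)); first by rewrite divr_gt0// ltr_pwDl.
  move=> u /andP[tu ut]; apply: He; rewrite -ball_normE /=.
  rewrite opprD addrACA subrr add0r -scalerBl -mulrBl -scalerA normrZ.
  rewrite distrC ger0_norm ?subr_ge0//.
  move: ut; rewrite -ltrBlDl ltr_pdivlMr ?ltr_pwDl// => /le_lt_trans; apply.
  by rewrite ler_wpM2l ?subr_ge0// lerDr.
Qed.

End propagation.

(** * From a small ball to the whole body *)

Section global_control.
Variables (R : realType) (d r : nat) (p : \bar R) (G E : set 'rV[R]_d).
Hypotheses (r0 : (0 < r)%N) (p0 : (0 < p)%E) (bG : convex_body G).
Variable B : 'M[R]_d.
Hypotheses (uB : B \in unitmx) (rB : forall i, E (row i B)).
Variable A0 : set 'rV[R]_d.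
Implicit Types (x y xi : 'rV[R]_d).

Local Notation ctrl_at := (@ctrl_at R d r p G E A0).

Lemma convex_body_closed : closed G.
Proof. by case: bG => cG _ _; apply: compact_closed => //; exact: norm_hausdorff. Qed.

Lemma convex_body_measurable : measurable G.
Proof. by apply: closed_measurable_rV; exact: convex_body_closed. Qed.

Let mG := convex_body_measurable.

Let cG : convex_set (G : set (convex_lmodType 'rV[R]_d)).
Proof. by case: bG. Qed.

(** Two points close to [c] are joined by d segments parallel to rows of [B], which are in [E]. This
    is where the basis enters. *)
Lemma ctrl_at_near c e : 0 < e -> ball c e `<=` G -> exists2 e' : R, 0 < e' &
  forall x y, ball c e' x -> ball c e' y -> ctrl_at x -> ctrl_at y.
Proof.
move=> e0 He; have [K K0 HK] := mulmx_bounded B.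
have [K' K'0 HK'] := mulmx_bounded (invmx B).
(* The path starts within e' of [c] and moves by at most K |s|, where |s| is at most 2 K' e'. The
   total is M e' = e. *)
pose M := 1 + 2 * (K * K'); have M1 : 1 <= M by rewrite lerDl !mulr_ge0 ?ltW.
have M0 : 0 < M by lra.
exists (e / M); first by rewrite divr_gt0.
move=> x y; rewrite -ball_normE /= => cx cy Hx.
set e' := e / M in cx cy; have e'0 : 0 < e' by rewrite divr_gt0.
pose s := (y - x) *m invmx B.
have ss : `|s| <= 2 * K' * e'.
  rewrite (le_trans (HK' _))// mulrAC mulrC ler_wpM2r ?(ltW K'0)//.
  have -> : y - x = (y - c) + (c - x) by rewrite addrA subrK.
  by rewrite (le_trans (ler_normD _ _))// distrC; lra.
have inG (v : 'rV[R]_d) : (forall i, `|v ord0 i| <= `|s ord0 i|) -> interior G (x + v *m B).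
  move=> vs; have : ball c e (x + v *m B).
    rewrite -ball_normE /= opprD addrA (le_lt_trans (ler_normB _ _))//.
    have H : `|v *m B| <= 2 * (K * K') * e'.
      rewrite (le_trans (HK _))// [leRHS](_ : _ = K * (2 * K' * e')); last by ring.
      rewrite ler_wpM2l ?(ltW K0)//; apply: le_trans ss.
      by apply: norm_rV_leP => // i; rewrite (le_trans (vs i))// coord_le_norm.
    have -> : e = e' + 2 * (K * K') * e'.
      by rewrite -[X in X + _]mul1r -mulrDl mulrC divfK// gt_eqF.
    exact: ltr_leD.
  have bo : open (ball c e) by exact: ball_open.
  by move: bo; rewrite openE => bo /bo /interior_ballP[e1 e10 H1];
    apply/interior_ballP; exists e1 => //; exact: subset_trans H1 He.
pose part k : 'rV[R]_d := \row_i (if (i < k)%N then s ord0 i else 0).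
have Hk k : (k <= d)%N -> ctrl_at (x + part k *m B).
  elim: k => [_|k IH kd].
    have -> : part 0%N = 0 by apply/rowP => i; rewrite !mxE.
    by rewrite mul0mx addr0.
  pose i := Ordinal kd.
  have E1 (t : R) : x + part k *m B + (t * s ord0 i) *: row i B =
      x + (part k + (t * s ord0 i) *: delta_mx ord0 i) *m B.
    by rewrite mulmxDl rowE scalemxAl addrA.
  have -> : part k.+1 = part k + (1 * s ord0 i) *: delta_mx ord0 i.
    apply/rowP => l; rewrite !mxE eqxx /= mul1r.
    have [->|li] := eqVneq l i; first by rewrite /= ltnn ltnSn mulr1 add0r.
    rewrite mulr0 addr0 ltnS leq_eqVlt; case: eqP => // lk.
    by move: li; rewrite -(inj_eq val_inj) /= lk eqxx.
  rewrite -E1 mul1r.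
  apply: (ctrl_at_segment p0 mG (rB i) (IH (ltnW kd))).
  move=> t /andP[t0 t1]; rewrite E1; apply: inG => l; rewrite !mxE eqxx /=.
  have [->|li] := eqVneq l i.
    by rewrite /= ltnn mulr1 add0r normrM ger0_norm// ler_piMl.
  by rewrite mulr0 addr0; case: ifP => //; rewrite normr0.
have := Hk d (leqnn d); suff -> : x + part d *m B = y by [].
have -> : part d = s by apply/rowP => l; rewrite mxE ltn_ord.
by rewrite /s mulmxKV// addrC subrK.
Qed.

(** The segment from [x0] to [y] is interior by convexity, but its direction need not be in [E];
    [ctrl_at_near] carries control along it locally. *)
Lemma ctrl_at_interior x0 y : interior G x0 -> ctrl_at x0 -> interior G y -> ctrl_at y.
Proof.
move=> G0 c0 Gy.
have Gt t : 0 <= t <= 1 -> interior G (x0 + t *: (y - x0)).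
  move=> /andP[t0 t1]; have [->|tn0] := eqVneq t 0; first by rewrite scale0r addr0.
  by apply: convex_interior => //; [exact: interior_subset|rewrite lt_def tn0 t0].
have -> : y = x0 + 1 *: (y - x0) by rewrite scale1r addrC subrK.
apply: (@closed_segment_ind _ (fun t => ctrl_at (x0 + t *: (y - x0)))).
- by rewrite scale0r addr0.
- move=> t /andP[t0 t1] IH.
  have /interior_ballP[e e0 /(ctrl_at_near e0)[e' e'0 He']] : interior G (x0 + t *: (y - x0)).
    by apply: Gt; rewrite ltW.
  pose q := Num.max 0 (t - e' / (1 + `|y - x0|)).
  have ep : 0 < e' / (1 + `|y - x0|) by rewrite divr_gt0// ltr_pwDl.
  have qt : q < t by rewrite gt_max t0 gtrBl.
  have q0 : 0 <= q by rewrite le_max lexx.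
  apply: (He' (x0 + q *: (y - x0))); last by apply: IH; rewrite q0.
    rewrite -ball_normE /= opprD addrACA subrr add0r -scalerBl normrZ.
    rewrite ger0_norm ?subr_ge0 ?(ltW qt)//.
    apply: (@le_lt_trans _ _ (e' / (1 + `|y - x0|) * `|y - x0|)).
      by rewrite ler_wpM2r// lerBlDr -lerBlDl le_max lexx orbT.
    by rewrite -mulrA gtr_pMr// mulrC ltr_pdivrMr ?mul1r ?ltrDr// ltr_pwDl.
  exact: ballxx.
- move=> t _ /(ctrl_at_ball mG)[e e0 He].
  exists (e / (1 + `|y - x0|)); first by rewrite divr_gt0// ltr_pwDl.
  move=> u /andP[tu ut]; apply: He; rewrite -ball_normE /=.
  rewrite opprD addrACA subrr add0r -scalerBl normrZ.
  rewrite distrC ger0_norm ?subr_ge0//.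
  move: ut; rewrite -ltrBlDl ltr_pdivlMr ?ltr_pwDl// => /le_lt_trans; apply.
  by rewrite ler_wpM2l ?subr_ge0// lerDr.
Qed.

Lemma ctrl_at_Xrayed x0 y : Xrayed G E -> interior G x0 -> ctrl_at x0 -> G y -> ctrl_at y.
Proof.
move=> XG G0 c0 Gy.
have [iy|niy] := pselect (interior G y); first exact: ctrl_at_interior c0 iy.
have [e Ee [t t0 Ht]] : exists2 e, (E `|` [set - e | e in E]) e & illuminated_in G y e.
  by apply: XG; split => //; exact: subset_closure.
have [xi [c [Exi Hc]]] : exists xi c, E xi /\ t *: e = c *: xi.
  case: Ee => [Ee|[xi Exi <-]]; first by exists e, t.
  by exists xi, (- t); rewrite scalerN scaleNr.
rewrite Hc in Ht.
(* The r-th point is the illuminated one, and by convexity those before it are interior too. A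
   direction -xi is used through a negative [c]. *)
apply: (ctrl_at_step p0 mG (u := c / r%:R) Exi) => j /andP[j0 jr].
suff iG : interior G (y + j%:R *: ((c / r%:R) *: xi)).
  exact (conj iG (ctrl_at_interior G0 c0 iG)).
have -> : y + j%:R *: ((c / r%:R) *: xi) = y + (j%:R / r%:R) *: (y + c *: xi - y).
  by rewrite [y + c *: xi]addrC addrK !scalerA mulrAC mulrA.
apply: convex_interior => //; rewrite divr_gt0 ?ltr0n//=.
by rewrite ler_pdivrMr ?ltr0n// mul1r ler_nat.
Qed.

Lemma controlled_body x0 : Xrayed G E -> interior G x0 -> ctrl_at x0 ->
  controlled r p G E A0 G.
Proof.
move=> XG G0 c0.
have /choice[e He] : forall x, exists e : R, G x -> 0 < e /\
    controlled r p G E A0 (ball x e `&` G).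
  move=> x; have [Gx|nGx] := pselect (G x); last by exists 0.
  by have [e e0 H] := ctrl_at_Xrayed XG G0 c0 Gx; exists e.
have : cover_compact G by rewrite -compact_cover; case: bG.
move=> /(_ _ G (fun x => ball x (e x)))[].
- by move=> x Gx; apply: ball_open; case: (He x Gx).
- by move=> x Gx; exists x => //; apply: ballxx; case: (He x Gx).
move=> D DG GD.
have /choice[C HC] : forall i : D, exists C : R, 0 <= C /\ forall g N, adm r p G E g ->
    0 <= N -> (Phi p A0 g <= N%:E)%E ->
    (Phi p (ball (val i) (e (val i)) `&` G) g <= (C * (1 + N))%:E)%E.
  move=> i; have Gi : G (val i) by apply: set_mem; exact: (DG _ (valP i)).
  by have [_ [C C0 HC]] := He _ Gi; exists C.
exists (\sum_i C i).
  by apply: sumr_ge0 => i _; case: (HC i).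
move=> g N ag N0 gN; rewrite mulr_suml.
apply: (@Phi_cover R d p p0 _ G (fun i : D => ball (val i) (e (val i)) `&` G)) => //.
- by move=> i; exact: measurable_ballG.
- by case: ag.
- move=> x Gx; have [i /= iD xi] := GD x Gx.
  by exists (FSetSub iD).
- by move=> i; case: (HC i) => _; apply.
Qed.

End global_control.

(** * The contraction estimate *)

Section smoothness.
Variables (R : realType) (d r : nat) (p : \bar R) (G E : set 'rV[R]_d).
Hypotheses (r0 : (0 < r)%N) (p0 : (0 < p)%E) (mG : measurable G).
Variable b : 'M[R]_d.
Hypothesis rowb : forall i, exists xi u, E xi /\ row i b = u *: xi.
Implicit Types (x y xi s : 'rV[R]_d) (Y : set 'rV[R]_d) (f : 'rV[R]_d -> R).

Lemma fdiff_difference h f y i :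
  fdiff r (fun k => f (y + k%:R *: h)) i = difference r h f (y + i%:R *: h).
Proof.
by apply: eq_bigr => j _; rewrite natrD scalerDl addrA.
Qed.

Lemma adm_row f i (t : R) Y : adm r p G E f -> measurable Y ->
  (forall y j, Y y -> (j <= r)%N -> G (y + j%:R *: (t *: row i b))) ->
  (Phi p Y (difference r (t *: row i b)%R f) <= 1)%E.
Proof.
move=> [_ Hf] mY; have [xi [u [Exi ->]]] := rowb i; rewrite scalerA => H.
exact: Hf.
Qed.

(** Room is measured in frame coordinates, where lattice points and difference steps have explicit
    bounds. *)
Definition roomy Y (M : R) := forall y s, Y y -> (forall i, `|s ord0 i| <= M) ->
  G (y + s *m b).

Lemma scale_row i (t : R) : t *: row i b = (t *: delta_mx ord0 i) *m b.
Proof. by rewrite rowE scalemxAl. Qed.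

Lemma roomy_row Y M y i t : roomy Y M -> Y y -> `|t| <= M -> G (y + t *: row i b).
Proof.
move=> H Yy tM; rewrite scale_row; apply: H => // k; rewrite !mxE eqxx /=.
by case: eqP => _; rewrite ?mulr1// mulr0 normr0 (le_trans _ tM).
Qed.

Lemma measurable_preshift h Y : measurable Y -> measurable ((fun x => x + h) @^-1` Y).
Proof. by move=> mY; rewrite -[X in measurable X]setTI; exact: measurable_shift_rV. Qed.

(** With v the i-th row, f(y + t v) and f(y) are, up to differences, values at 1/m and 0 of one
    discrete interpolant through y + j m t v. Their gap is of order 1/m by the Lipschitz bound, so
    [C1] is independent of [m] while [C2] is not. *)
Lemma smooth_row : exists2 C1 : R, 0 <= C1 & forall m, (0 < m)%N ->
  exists2 C2 : R, 0 <= C2 & forall i (t : R) Y f (N : R), `|t| <= m%:R^-1 ->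
    measurable Y -> roomy Y (2 * r%:R + 1) -> adm r p G E f -> 0 <= N ->
    (Phi p G f <= N%:E)%E ->
    (Phi p Y (fun y => f (y + t *: row i b) - f y)%R
      <= (C1 * m%:R^-1 `^ deg p * N + C2)%:E)%E.
Proof.
have [L L0 HL] := ell_lipschitz r (1 : R).
have r0' : 0 < r%:R :> R by rewrite ltr0n.
exists (r%:R * (2 * r%:R * L) `^ deg p); first by rewrite mulr_ge0 ?powR_ge0.
move=> m m0; have m0' : 0 < m%:R :> R by rewrite ltr0n.
have [D D0 HD] := @ell_discrete R r m 1 r0 m0.
pose n' := (1 + r * m)%N.
exists (n'%:R * (2 * n'%:R * (2 * D)) `^ deg p); first by rewrite mulr_ge0 ?powR_ge0.
move=> i t Y f N tm mY rY af N0 fN.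
set v := row i b; pose w := t *: v.
have [mf _] := af.
(* Half of the total weight goes to the r interpolation terms and half to the n' difference terms;
   the number n', which grows with [m], thus stays out of the factor of [N]. *)
pose n (o : 'I_r + 'I_n') : R := if o is inl _ then 2 * r%:R else 2 * n'%:R.
pose c (o : 'I_r + 'I_n') : R := if o is inl _ then L * m%:R^-1 else 2 * D.
pose g (o : 'I_r + 'I_n') := if o is inl _ then f else difference r w f.
pose h (o : 'I_r + 'I_n') := match o with
  | inl j => ((j : nat) * m)%N%:R *: w | inr k => (k : nat)%:R *: w end.
pose B (o : 'I_r + 'I_n') := if o is inr _ then (fun x => x + (- h o)) @^-1` Y else G.
pose K (o : 'I_r + 'I_n') : R := if o is inr _ then 1 else N.
have n'0 : 0 < n'%:R :> R by rewrite ltr0n.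
have sum_cst k (x : R) : \sum_(j < k) x = k%:R * x by rewrite sumr_const card_ord mulr_natl.
have -> : r%:R * (2 * r%:R * L) `^ deg p * m%:R^-1 `^ deg p * N +
   n'%:R * (2 * n'%:R * (2 * D)) `^ deg p = \sum_o (n o * c o) `^ deg p * K o.
  rewrite big_sumType /= !sum_cst mulr1.
  have -> : 2 * r%:R * (L / m%:R) = (2 * r%:R * L) / m%:R by ring.
  rewrite (@powRM _ (2 * r%:R * L)) ?mulr_ge0 ?invr_ge0 ?(ltW r0') ?(ltW m0')//; ring.
have tk (k : nat) (M : R) : k%:R * m%:R^-1 <= M -> `|k%:R * t| <= M.
  move=> kM; rewrite normrM normr_nat (le_trans _ kM)// ler_wpM2l//.
apply: (@Phi_wdom R d p p0 _ n c g h B) => //.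
- by case=> j; rewrite /n mulr_gt0.
- rewrite big_sumType /= !sum_cst !invfM.
  rewrite mulrCA divff ?gt_eqF// mulrCA divff ?gt_eqF//; lra.
- by case=> j //=; exact: measurable_preshift.
- by apply: pmeasB => //; exact: pmeas_shift.
- by case=> j //; exact: pmeas_difference.
- by case=> j; rewrite /c mulr_ge0// invr_ge0 ltW.
- case=> j //=; apply: adm_row => // [|y k Yy kr]; first exact: measurable_preshift.
  have -> : y + k%:R *: (t *: v) = (y - h (inr j)) + ((j + k)%N%:R * t) *: v.
    by rewrite /h /w natrD mulrDl scalerDl -!scalerA addrA subrK.
  apply: roomy_row rY Yy _; apply: tk.
  rewrite ler_pdivrMr// mulrDl mul1r -!natrM -natrD ler_nat.
  by have := ltn_ord j; rewrite /n'; nia.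
- case=> j y Yy /=; last by rewrite addrK.
  rewrite /w scalerA; apply: roomy_row rY Yy _; apply: tk.
  rewrite natrM mulfK ?gt_eqF// (le_trans (_ : _ <= r%:R))// ?ler_nat ?(ltnW (ltn_ord j))//.
  lra.
move=> y Yy; rewrite big_sumType /=.
pose F k := f (y + k%:R *: w).
have -> : f (y + t *: v) - f y = F 1%N - F 0%N by rewrite /F scale1r scale0r addr0.
have H0 := HD F 0%N isT; have H1 := HD F 1%N isT.
set S0 := \sum_(j < r) _ in H0; set S1 := \sum_(j < r) _ in H1.
set S := \sum_(i < _) _ in H0 H1.
have -> : F 1%N - F 0%N = (S1 - S0) + ((F 1%N - S1) - (F 0%N - S0)) by ring.
rewrite (le_trans (ler_normD _ _))// lerD//.
  rewrite /S1 /S0 -sumrB (le_trans (ler_norm_sum _ _ _))//; apply: ler_sum => j _.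
  rewrite -mulrBl normrM ler_wpM2r//.
  have m1 : (0 : R) <= m%:R^-1 by rewrite invr_ge0 ltW.
  have m2 : m%:R^-1 <= (1 : R) by rewrite -[leRHS]invr1 lef_pV2 ?posrE// ler1n.
  have e1 : 1%:R / m%:R = m%:R^-1 :> R by rewrite mul1r.
  have e0 : 0%:R / m%:R = 0 :> R by rewrite mul0r.
  rewrite e1 e0 (le_trans (HL j _ _ _ _))// ?normr0// ?subr0 ger0_norm//.
rewrite -mulr_sumr -mulrA (le_trans (ler_normB _ _))//.
have -> : \sum_(i < n') `|difference r w f (y + h (inr i))| = S.
  by apply: eq_bigr => k _; rewrite /F fdiff_difference.
by rewrite mulr_natl mulr2n lerD.
Qed.

(** The frame coordinates are changed one at a time; the partial shift, at most 1/m in each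
    coordinate, takes the extra unit of room. *)
Lemma smooth : exists2 C1 : R, 0 <= C1 & forall m, (0 < m)%N ->
  exists2 C2 : R, 0 <= C2 & forall (t : 'rV[R]_d) Y f (N : R),
    (forall i, `|t ord0 i| <= m%:R^-1) ->
    measurable Y -> roomy Y (2 * r%:R + 2) -> adm r p G E f -> 0 <= N ->
    (Phi p G f <= N%:E)%E ->
    (Phi p Y (fun y => f (y + t *m b) - f y)%R
      <= (C1 * m%:R^-1 `^ deg p * N + C2)%:E)%E.
Proof.
have [C1 C10 H1] := smooth_row.
pose Q : R := \sum_(i < d) (#|'I_d|%:R * 1) `^ deg p.
have Q0 : 0 <= Q by apply: sumr_ge0 => i _; exact: powR_ge0.
exists (Q * C1); first exact: mulr_ge0.
move=> m m0; have [C2 C20 H2] := H1 m m0.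
exists (Q * C2); first exact: mulr_ge0.
move=> t Y f N tm mY rY af N0 fN; have [mf _] := af.
pose part k : 'rV[R]_d := \row_i (if (i < k)%N then t ord0 i else 0).
pose g (i : 'I_d) := fun y => f (y + t ord0 i *: row i b) - f y.
pose B (i : 'I_d) := (fun x => x + (- (part i *m b))) @^-1` Y.
have -> : Q * C1 * m%:R^-1 `^ deg p * N + Q * C2 =
    \sum_(i < d) (#|'I_d|%:R * 1) `^ deg p * (C1 * m%:R^-1 `^ deg p * N + C2).
  by rewrite -mulr_suml -/Q; ring.
have m1 : m%:R^-1 <= (1 : R) by rewrite -[leRHS]invr1 lef_pV2 ?posrE ?ltr0n// ler1n.
apply: (@Phi_dom R d p p0 'I_d (fun=> 1) g (fun i => part i *m b) B) => //.
- by move=> i; exact: measurable_preshift.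
- by apply: pmeasB => //; exact: pmeas_shift.
- by move=> i; apply: pmeasB => //; exact: pmeas_shift.
- move=> i; apply: H2 => //; first exact: measurable_preshift.
  move=> y s Yy sM.
  have -> : y + s *m b = (y - part i *m b) + (part i + s) *m b.
    by rewrite mulmxDl addrA subrK.
  apply: rY => // k; rewrite !mxE (le_trans (ler_normD _ _))//.
  have := sM k; have := tm k; case: ifP => _; rewrite ?normr0; lra.
- by move=> i y Yy; rewrite /B /= addrK.
move=> y Yy.
have -> : f (y + t *m b) - f y =
    \sum_(0 <= k < d) (f (y + part k.+1 *m b) - f (y + part k *m b)).
  rewrite telescope_sumr//.
  have -> : part d = t by apply/rowP => i; rewrite mxE ltn_ord.
  have -> : part 0%N = 0 by apply/rowP => i; rewrite !mxE.
  by rewrite mul0mx addr0.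
rewrite big_mkord (le_trans (ler_norm_sum _ _ _))//; apply: ler_sum => i _.
rewrite mul1r /g -addrA scale_row -mulmxDl.
suff -> : part i.+1 = part i + t ord0 i *: delta_mx ord0 i by [].
apply/rowP => l; rewrite !mxE eqxx /=.
have [->|li] := eqVneq l i; first by rewrite /= ltnn ltnSn mulr1 add0r.
rewrite mulr0 addr0 ltnS leq_eqVlt; case: eqP => // lk.
by move: li; rewrite -(inj_eq val_inj) /= lk eqxx.
Qed.

End smoothness.

Lemma ler_term_sum (R : numDomainType) (I : finType) (F : I -> R) (i : I) :
  (forall i, 0 <= F i) -> F i <= \sum_i F i.
Proof. by move=> F0; rewrite (bigD1 i)//= lerDl sumr_ge0. Qed.

Lemma continuous_tens (R : realType) (d r : nat) (z : 'rV[R]_d) (M : 'M[R]_d) v :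
  continuous (fun x : 'rV[R]_d => @tens R d r v ((x - z) *m M)).
Proof.
move=> x; have [K K0 HK] := mulmx_bounded M.
pose L := K * (`|x - z| + 1).
have [C C0 HC] := tens_lipschitz d r L.
pose S (v : {ffun 'I_d -> 'I_r} -> R) := \sum_j `|v j|; have S0 : 0 <= S v by exact: sumr_ge0.
apply/(cvgrPdist_lt (FF := nbhs_filter x)) => e e0; apply/nbhs_ballP.
have D0 : 0 < C * K * S v + 1 by rewrite ltr_wpDl// !mulr_ge0// ltW.
exists (Num.min 1 (e / (C * K * S v + 1))).
  by rewrite /= lt_min ltr01 divr_gt0.
move=> y; rewrite -ball_normE /= lt_min => /andP[xy1 xye].
have sx i : `|((x - z) *m M) ord0 i| <= L.
  rewrite (le_trans (coord_le_norm _ _))// (le_trans (HK _))// ler_wpM2l ?(ltW K0)//.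
  by rewrite lerDl.
have sy i : `|((y - z) *m M) ord0 i| <= L.
  rewrite (le_trans (coord_le_norm _ _))// (le_trans (HK _))// ler_wpM2l ?(ltW K0)//.
  have -> : y - z = (x - z) - (x - y) by apply/rowP => k; rewrite !mxE; ring.
  by rewrite (le_trans (ler_normB _ _))// lerD2l ltW.
have sxy i : `|((x - z) *m M) ord0 i - ((y - z) *m M) ord0 i| <= K * `|x - y|.
  have -> : ((x - z) *m M) ord0 i - ((y - z) *m M) ord0 i = ((x - y) *m M) ord0 i.
    have -> : (x - y) *m M = (x - z) *m M - (y - z) *m M.
      by rewrite -mulmxBl opprB addrA subrK.
    by rewrite [RHS]mxE; congr (_ + _); rewrite [RHS]mxE.
  by rewrite (le_trans (coord_le_norm _ _)).
have Kxy : 0 <= K * `|x - y| by rewrite mulr_ge0// ltW.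
rewrite (le_lt_trans (HC v _ _ _ Kxy sx sy sxy))//.
move: xye; rewrite ltr_pdivlMr// mulrDr mulr1 => /(le_lt_trans _); apply.
rewrite -/(S v) [leLHS](_ : _ = `|x - y| * (C * K * S v)); last by ring.
by rewrite lerDl.
Qed.

(** * Interpolation on a fine lattice *)

Section lattice.
Variables (R : realType) (d r : nat).
Hypothesis r0 : (0 < r)%N.
Variable b : 'M[R]_d.
Implicit Types (x y z s : 'rV[R]_d) (f : 'rV[R]_d -> R).

Definition lat (m n : nat) (k : {ffun 'I_d -> 'I_n}) : 'rV[R]_d :=
  \row_i ((k i : nat)%:R / m%:R).

Definition interp f z (s : 'rV[R]_d) : R :=
  tens (fun j : {ffun 'I_d -> 'I_r} => f (z + node R j *m b)) s.

(** All differences with steps b_i / m that the lattice argument meets. The index range is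
    [K + r * m] from [ell_discrete], with K = r m. *)
Definition lat_sum m f z : R :=
  \sum_(q : {ffun 'I_d -> 'I_(r * m + r * m).+1} * 'I_d)
    `|difference r (m%:R^-1 *: row q.2 b) f (z + lat m q.1 *m b)|.

Lemma lat_sum_ge0 m f z : 0 <= lat_sum m f z.
Proof. exact: sumr_ge0. Qed.

Lemma interp_lat m : (0 < m)%N -> exists2 C : R, 0 <= C &
  forall f z (k : {ffun 'I_d -> 'I_m.+1}),
    `|f (z + lat m k *m b) - interp f z (lat m k)| <= C * lat_sum m f z.
Proof.
move=> m0; have m0' : 0 < m%:R :> R by rewrite ltr0n.
pose T (a : R) := exists2 k : nat, (k <= r * m)%N & a = k%:R / m%:R.
have [L L1 HL] := ell_bounded r (r%:R : R).
have Tn (k : 'I_r) : T k%:R.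
  exists (k * m)%N; first by rewrite leq_mul2r ltnW ?orbT.
  by rewrite natrM mulfK ?gt_eqF.
have TL a (k : 'I_r) : T a -> `|(ell R k).[a]| <= L.
  move=> [l lr ->]; apply: HL.
  by rewrite ger0_norm ?divr_ge0// ler_pdivrMr// -natrM ler_nat.
have [C C0 HC] := grid_bound d r0 (le_trans ler01 L1) Tn TL.
have [D D0 HD] := @ell_discrete R r m (r * m) r0 m0.
exists (C * (D * (r * m + r * m)%:R)); first by rewrite !mulr_ge0.
move=> f z k; rewrite -mulrA; set S := lat_sum m f z.
have S0 : 0 <= S by exact: lat_sum_ge0.
apply: (HC (fun s => f (z + s *m b) - interp f z s)).
- by rewrite !mulr_ge0.
- move=> s t sT.
  under eq_bigr do rewrite mulrBr.
  rewrite sumrB /interp -tens_upd// opprB addrA subrK.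
  have /choice[ks Hks] : forall i, exists k : nat, (k <= r * m)%N /\ s ord0 i = k%:R / m%:R.
    by move=> i; have [l lr ->] := sT i; exists l.
  pose w := m%:R^-1 *: row t b.
  pose F (i : nat) := f (z + upd s t 0 *m b + i%:R *: w).
  have FE (i : nat) : F i = f (z + upd s t (i%:R / m%:R) *m b).
    by rewrite /F -addrA (upd_mul b s t 0 (i%:R / m%:R)) subr0 /w scalerA.
  have [kt Hkt] := Hks t.
  have := HD F (ks t) kt; rewrite FE -Hkt upd_id.
  under eq_bigr => j _ do rewrite FE natrM mulfK ?gt_eqF//.
  move=> /le_trans; apply; rewrite -mulrA ler_wpM2l//.
  have -> : (r * m + r * m)%:R * S = \sum_(i < r * m + r * m) S.
    by rewrite sumr_const card_ord mulr_natl.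
  apply: ler_sum => i _; rewrite fdiff_difference.
  (* The coordinate [t] of this index runs along the line and the others are those of [s], so the
     difference on the line is one term of [lat_sum]. *)
  pose q : {ffun 'I_d -> 'I_(r * m + r * m).+1} :=
    [ffun l => inord (if l == t then i : nat else ks l)].
  have -> : z + upd s t 0 *m b + i%:R *: w = z + lat m q *m b.
    rewrite -addrA; congr (_ + _); rewrite /w scalerA.
    have := upd_mul b s t 0 (i%:R / m%:R); rewrite subr0 => <-; congr (_ *m _).
    apply/rowP => l; rewrite !mxE ffunE; case: eqP => [_|_].
      by rewrite inordK// ltnS ltnW.
    by have [kl ->] := Hks l; rewrite inordK// ltnS (leq_trans kl)// leq_addr.
  pose F' (q : {ffun 'I_d -> 'I_(r * m + r * m).+1} * 'I_d) :=
    `|difference r (m%:R^-1 *: row q.2 b) f (z + lat m q.1 *m b)|.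
  by apply: (@ler_term_sum _ _ F' (q, t)) => i'; exact: normr_ge0.
- by move=> j; rewrite /interp tens_node subrr.
- move=> i; rewrite mxE; exists (k i : nat) => //.
  by rewrite (leq_trans _ (leq_pmull m r0))// -ltnS ltn_ord.
Qed.

End lattice.

Section lattice_estimate.
Variables (R : realType) (d r : nat) (p : \bar R) (G E : set 'rV[R]_d).
Hypotheses (r0 : (0 < r)%N) (p0 : (0 < p)%E) (mG : measurable G).
Variable b : 'M[R]_d.
Hypotheses (ub : b \in unitmx).
Hypothesis rowb : forall i, exists xi u, E xi /\ row i b = u *: xi.
Variables (x0 z0 : 'rV[R]_d) (a : R).
Hypotheses (a0 : 0 < a) (Hroom : roomy G b (ball z0 a) (3 * r%:R + 3)).
Hypothesis Hx : forall z x, ball z0 a z -> ball x0 a x ->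
  forall i, 0 <= ((x - z) *m invmx b) ord0 i <= 1.
Implicit Types (x y z s : 'rV[R]_d) (f : 'rV[R]_d -> R).

Definition interp_at f z x : R := interp r b f z ((x - z) *m invmx b).

Definition node_sum f z : R := \sum_(j : {ffun 'I_d -> 'I_r}) `|f (z + node R j *m b)|.

(** [x] is compared with a nearby lattice point. The translation stays in the bound, the error on
    the lattice is [interp_lat], and moving the interpolant back costs 1/m times nodal values by
    [tens_lipschitz]. What is chosen before [m] is independent of it. *)
Lemma lattice_estimate : exists rho (C : R) (q : nat),
  [/\ 0 < rho, 0 <= C & (0 < q)%N] /\
  forall m, (0 < m)%N -> exists2 C' : R, 0 <= C' &
  [/\ (forall z x, ball z0 a z -> ball x0 a x ->
     exists k : {ffun 'I_d -> 'I_(q * m).+1},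
       ball (z + lat R (q * m) k *m b) (rho / m%:R) x),
  (forall w, ball (0 : 'rV[R]_d) (rho / m%:R) w ->
     forall i, `|(w *m invmx b) ord0 i| <= m%:R^-1) &
  (forall f z x (k : {ffun 'I_d -> 'I_(q * m).+1}), ball z0 a z -> ball x0 a x ->
     ball (z + lat R (q * m) k *m b) (rho / m%:R) x ->
     `|f x - interp_at f z x| <= `|f x - f (z + lat R (q * m) k *m b)|
        + C' * lat_sum r b (q * m) f z + C * m%:R^-1 * node_sum f z)].
Proof.
have [K K0 HK] := mulmx_bounded b.
have [K' K'0 HK'] := mulmx_bounded (invmx b).
have [C C0 HC] := tens_lipschitz d r (1 : R).
(* Displacements below rho / m have frame coordinates at most 1/m. Refining the mesh by [q] lets the
   lattice points cover within that radius. *)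
pose rho := K'^-1; have rho0 : 0 < rho by rewrite invr_gt0.
pose q := (Num.truncn (K * K')).+1.
have q0' : 0 < q%:R :> R by rewrite ltr0n.
have Kq : K / q%:R < rho.
  by rewrite ltr_pdivrMr// mulrC ltr_pdivlMr//; exact: truncnS_gt.
exists rho, C, q; split => // m m0.
have m0' : 0 < m%:R :> R by rewrite ltr0n.
have qm0 : (0 < q * m)%N by rewrite muln_gt0.
have qm0' : 0 < (q * m)%:R :> R by rewrite ltr0n.
have [C' C'0 HC'] := interp_lat r0 b qm0.
have small (w : 'rV[R]_d) : `|w| < rho / m%:R -> `|w *m invmx b| <= m%:R^-1.
  move=> wr; rewrite (le_trans (HK' _))//.
  apply: (@le_trans _ _ (K' * (rho / m%:R))); first by rewrite ler_wpM2l ?(ltW K'0)// ltW.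
  by rewrite mulrA divff ?gt_eqF// mul1r.
exists C' => //; split; last 2 first.
- move=> w; rewrite -ball_normE /= sub0r normrN => /small H i.
  exact: le_trans (coord_le_norm _ _) H.
- move=> f z x k zz xx; set zk := z + _; rewrite -ball_normE /= => xk.
have xzk : `|(x - zk) *m invmx b| <= m%:R^-1 by apply: small; rewrite distrC.
have sE : (x - zk) *m invmx b = (x - z) *m invmx b - lat R (q * m) k.
  by rewrite /zk opprD addrA mulmxBl mulmxK.
rewrite -addrA; have -> : f x - interp_at f z x = (f x - f zk) +
    ((f zk - interp r b f z (lat R (q * m) k)) +
     (interp r b f z (lat R (q * m) k) - interp_at f z x)) by ring.
rewrite (le_trans (ler_normD _ _))// lerD2l (le_trans (ler_normD _ _))// lerD//.
  exact: HC'.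
have lat1 i : `|(lat R (q * m) k) ord0 i| <= 1.
  rewrite mxE ger0_norm ?divr_ge0// ler_pdivrMr// mul1r ler_nat -ltnS; exact: ltn_ord.
apply: (HC (fun j => f (z + node R j *m b))) => //.
- by move=> i; have /andP[s0 s1] := Hx zz xx i; rewrite ger0_norm.
- move=> i; have -> : (lat R (q * m) k) ord0 i - ((x - z) *m invmx b) ord0 i =
      - (((x - zk) *m invmx b) ord0 i) by rewrite sE !mxE; ring.
  by rewrite normrN (le_trans (coord_le_norm _ _)).
- move=> z x zz xx; have := Hx zz xx.
  have : (x - z) *m invmx b *m b = x - z by rewrite mulmxKV.
  move: ((x - z) *m invmx b) => s sb s01.
  pose k : {ffun 'I_d -> 'I_(q * m).+1} :=
    [ffun i => inord (Num.truncn ((q * m)%:R * s ord0 i))].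
  exists k.
  have kE i : (k i : nat) = Num.truncn ((q * m)%:R * s ord0 i).
    have /andP[si0 si1] := s01 i.
    rewrite ffunE inordK// ltnS -(ler_nat R) (@le_trans _ _ ((q * m)%:R * s ord0 i))//.
      by rewrite truncn_le mulr_ge0.
    by rewrite ler_piMr.
  have sk : `|s - lat R (q * m) k| <= (q * m)%:R^-1.
    apply: norm_rV_leP => [|i]; first by rewrite invr_ge0 ltW.
    have /andP[si0 si1] := s01 i.
    have qs0 : 0 <= (q * m)%:R * s ord0 i by rewrite mulr_ge0.
    have := truncnS_gt ((q * m)%:R * s ord0 i); have := truncn_le ((q * m)%:R * s ord0 i).
    rewrite qs0 !mxE kE.
    set n := Num.truncn _ => n1 n2.
    have -> : s ord0 i - n%:R / (q * m)%:R = ((q * m)%:R * s ord0 i - n%:R) / (q * m)%:R.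
      by rewrite mulrBl (mulrAC _ (s ord0 i)) divff ?mul1r// gt_eqF.
    rewrite normrM [X in _ * X]ger0_norm ?invr_ge0 ?(ltW qm0')// ler_piMl ?invr_ge0 ?(ltW qm0')//.
    by rewrite ger0_norm ?subr_ge0// lerBlDl natr1 ltW.
  rewrite -ball_normE /=.
  have -> : z + lat R (q * m) k *m b - x = - ((s - lat R (q * m) k) *m b).
    by rewrite mulmxBl sb opprB opprB addrCA addrA.
  rewrite normrN (le_lt_trans (HK _))//.
  apply: (@le_lt_trans _ _ (K * (q * m)%:R^-1)); first by rewrite ler_wpM2l ?(ltW K0).
  by rewrite natrM invfM mulrA ltr_pM2r ?invr_gt0.
Qed.

End lattice_estimate.

Lemma sumrD_cst2 (R : pzRingType) (I : finType) (u : I -> R) (x y : R) :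
  \sum_k (u k + x + y) = \sum_k u k + (#|I|%:R * x + #|I|%:R * y).
Proof. by rewrite !big_split /= !sumr_const !mulr_natl addrA. Qed.

Section tonelli.
Variables (R : realType) (d : nat).
Local Open Scope ereal_scope.
Implicit Types (Z W : set 'rV[R]_d).

Lemma tonelli_on Z W (F : 'rV[R]_d * 'rV[R]_d -> \bar R) :
  measurable Z -> measurable W -> measurable_fun setT F -> (forall u, 0 <= F u) ->
  measurable_fun Z (fun z => \int[lebesgue_rV R d]_(w in W) F (z, w)) /\
  \int[lebesgue_rV R d]_(z in Z) \int[lebesgue_rV R d]_(w in W) F (z, w) =
  \int[lebesgue_rV R d]_(w in W) \int[lebesgue_rV R d]_(z in Z) F (z, w).
Proof.
move=> mZ mW mF F0; pose F' := F \_ (Z `*` W).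
have mF' : measurable_fun setT F'.
  have mZW : measurable (Z `*` W) by exact: measurableX.
  by apply/(measurable_restrictT _ mZW); exact: measurable_funTS.
have F'0 u : 0 <= F' u by rewrite /F' patchE; case: ifP.
have E z w : F' (z, w) = if z \in Z then if w \in W then F (z, w) else 0 else 0.
  by rewrite /F' patchE in_setX; case: (z \in Z); case: (w \in W).
have E1 : (fun z => \int[lebesgue_rV R d]_w F' (z, w)) =
    (fun z => \int[lebesgue_rV R d]_(w in W) F (z, w)) \_ Z.
  apply/funext => z; rewrite patchE; case: ifPn => zZ.
    rewrite [RHS]integral_mkcond; apply: eq_integral => w _.
    by rewrite E zZ patchE.
  by apply: integral0_eq => w _; rewrite E (negbTE zZ).
have E2 : (fun w => \int[lebesgue_rV R d]_z F' (z, w)) =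
    (fun w => \int[lebesgue_rV R d]_(z in Z) F (z, w)) \_ W.
  apply/funext => w; rewrite patchE; case: ifPn => wW.
    rewrite [RHS]integral_mkcond; apply: eq_integral => z _.
    by rewrite E wW patchE.
  by apply: integral0_eq => z _; rewrite E (negbTE wW); case: ifP.
split.
  apply/(measurable_restrictT _ mZ); rewrite -E1.
  exact: (@measurable_fun_fubini_tonelli_F _ _ _ _ _ (lebesgue_rV R d) F').
rewrite integral_mkcond -E1 [RHS]integral_mkcond -E2.
exact: (@fubini_tonelli _ _ _ _ _ (lebesgue_rV R d) (lebesgue_rV R d) F').
Qed.

(** A function cannot exceed its mean everywhere; the 1 added to [T] makes the contradiction
    strict. *)
Lemma integral_select (z0 : 'rV[R]_d) (a : R) (h : 'rV[R]_d -> \bar R) (T : R) : (0 < a)%R ->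
  measurable_fun (ball z0 a) h -> (forall z, 0 <= h z) ->
  \int[lebesgue_rV R d]_(z in ball z0 a) h z <= T%:E ->
  exists2 z, ball z0 a z & h z <= ((T + 1) / (a *+ 2) ^+ d)%:E.
Proof.
move=> a0 mh h0 hT; have V0 : (0 < (a *+ 2) ^+ d)%R by rewrite exprn_gt0// mulrn_wgt0.
apply: contrapT => H; set c := ((T + 1) / _)%R in H.
have T0 : (0 <= T)%R.
  by rewrite -lee_fin (le_trans _ hT)// integral_ge0.
have c0 : (0 <= c)%R by rewrite divr_ge0 ?(ltW V0) ?addr_ge0.
have : \int[lebesgue_rV R d]_(z in ball z0 a) c%:E <= T%:E.
  apply: le_trans hT; apply: ge0_le_integral => //; first exact: measurable_ball_rV.
  move=> z Zz; rewrite leNgt; apply/negP => hc; apply: H; exists z => //; exact: ltW.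
rewrite integral_cst; last exact: measurable_ball_rV.
rewrite [X in _ * X]lebesgue_rV_ball// -EFinM lee_fin /c divfK ?gt_eqF//; lra.
Qed.

End tonelli.

(** * Approximation by the interpolant on a small ball *)

Section contraction.
Variables (R : realType) (d r : nat) (p : \bar R) (G E : set 'rV[R]_d).
Hypotheses (r0 : (0 < r)%N) (p0 : (0 < p)%E) (mG : measurable G).
Variable b : 'M[R]_d.
Hypotheses (ub : b \in unitmx).
Hypothesis rowb : forall i, exists xi u, E xi /\ row i b = u *: xi.
Variables (x0 z0 : 'rV[R]_d) (a : R).
Hypotheses (a0 : 0 < a) (Hroom : roomy G b (ball z0 a) (3 * r%:R + 3)).
Hypothesis Hx : forall z x, ball z0 a z -> ball x0 a x ->
  forall i, 0 <= ((x - z) *m invmx b) ord0 i <= 1.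
Implicit Types (x y z s : 'rV[R]_d) (f : 'rV[R]_d -> R).

Let Z : set 'rV[R]_d := ball z0 a.

Lemma pmeas_norm f : pmeas p f -> pmeas p (fun x => `|f x|).
Proof.
case: p => //= _ mf; exact: (measurableT_comp (@normr_measurable R setT) mf).
Qed.

Lemma pmeas_sum (I : Type) (w : seq I) (g : I -> 'rV[R]_d -> R) :
  (forall i, pmeas p (g i)) -> pmeas p (fun x => \sum_(i <- w) g i x).
Proof.
move=> mg; have := @pmeas_lin R d p I w (fun=> 1) g mg.
by congr pmeas; apply/funext => x; apply: eq_bigr => i _; rewrite mul1r.
Qed.

Lemma Phi_lat_sum m : (0 < m)%N -> exists2 C : R, 0 <= C &
  forall f, adm r p G E f ->
    pmeas p (lat_sum r b m f) /\ (Phi p Z (lat_sum r b m f) <= C%:E)%E.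
Proof.
move=> m0; have m0' : 0 < m%:R :> R by rewrite ltr0n.
pose I : finType := ({ffun 'I_d -> 'I_(r * m + r * m).+1} * 'I_d)%type.
exists (\sum_(i : I) (#|I|%:R * 1) `^ deg p * 1).
  by apply: sumr_ge0 => i _; rewrite mulr1 powR_ge0.
move=> f af; have [mf _] := af.
pose g (q : I) := difference r (m%:R^-1 *: row q.2 b) f.
pose h (q : I) : 'rV[R]_d := lat R m q.1 *m b.
have mg q : pmeas p (g q) by exact: pmeas_difference.
have ms : pmeas p (lat_sum r b m f).
  apply: (@pmeas_sum I _ (fun q z => `|g q (z + h q)|)) => q.
  by apply: pmeas_norm; exact: pmeas_shift.
split=> //.
apply: (@Phi_dom R d p p0 I (fun=> 1) g h (fun q => (fun x => x + - h q) @^-1` Z)) => //.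
- exact: measurable_ball_rV.
- by move=> q; apply: measurable_preshift; exact: measurable_ball_rV.
- move=> q; apply: (adm_row rowb af).
    by apply: measurable_preshift; exact: measurable_ball_rV.
  move=> y j Zy jr.
  have -> : y + j%:R *: (m%:R^-1 *: row q.2 b) = (y - h q) +
      (lat R m q.1 + (j%:R / m%:R) *: delta_mx ord0 q.2) *m b.
    by rewrite mulmxDl scalerA scale_row addrA subrK.
  (* Lattice coordinates reach 2 r and a difference adds at most r. *)
  apply: Hroom => // k; rewrite !mxE (le_trans (ler_normD _ _))//.
  apply: (@le_trans _ _ (2 * r%:R + r%:R)); last lra.
  apply: lerD.
    rewrite ger0_norm ?divr_ge0// ler_pdivrMr// -!natrM ler_nat.
    by rewrite (leq_trans (leq_ord (q.1 k)))// addnn -mul2n mulnA.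
  rewrite normrM ger0_norm ?divr_ge0//.
  apply: (@le_trans _ _ (j%:R / m%:R)).
    by rewrite ler_piMr ?divr_ge0//; case: (_ && _); rewrite ?normr1 ?normr0.
  rewrite ler_pdivrMr// -natrM ler_nat; nia.
- by move=> q y Zy; rewrite /= addrK.
move=> y Zy; rewrite ger0_norm ?lat_sum_ge0// /lat_sum.
by apply: ler_sum => q _; rewrite mul1r.
Qed.

Lemma Phi_node_sum : exists2 C : R, 0 <= C & forall f N, adm r p G E f -> 0 <= N ->
  (Phi p G f <= N%:E)%E ->
  pmeas p (@node_sum R d r b f) /\ (Phi p Z (@node_sum R d r b f) <= (C * N)%:E)%E.
Proof.
pose I : finType := {ffun 'I_d -> 'I_r}.
exists (\sum_(i : I) (#|I|%:R * 1) `^ deg p).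
  by apply: sumr_ge0 => i _; rewrite powR_ge0.
move=> f N af N0 fN; have [mf _] := af.
have ms : pmeas p (@node_sum R d r b f).
  apply: (@pmeas_sum I _ (fun j z => `|f (z + node R j *m b)|)) => q.
  by apply: pmeas_norm; exact: pmeas_shift.
split=> //; rewrite mulr_suml.
apply: (@Phi_dom R d p p0 I (fun=> 1) (fun=> f) (fun j => node R j *m b) (fun=> G)) => //.
- exact: measurable_ball_rV.
- move=> j y Zy; apply: Hroom => // k; rewrite mxE ger0_norm//.
  apply: (@le_trans _ _ r%:R); first by rewrite ler_nat ltnW.
  have : 0 <= r%:R :> R by []; lra.
move=> y Zy; rewrite ger0_norm ?sumr_ge0//.
by apply: ler_sum => j _; rewrite mul1r.
Qed.

(** [C2] is uniform in the lattice point and in the translation, so the estimate can be summed over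
    one and integrated over the other. *)
Lemma Phi_lat_smooth : exists2 C1 : R, 0 <= C1 & forall m, (0 < m)%N ->
  exists2 C2 : R, 0 <= C2 & forall n (k : {ffun 'I_d -> 'I_n.+1}) (t : 'rV[R]_d) f N,
    (forall i, `|t ord0 i| <= m%:R^-1) ->
    adm r p G E f -> 0 <= N -> (Phi p G f <= N%:E)%E ->
    (Phi p ((fun x => x + - (lat R n k *m b)) @^-1` Z)%R
      (fun y => f (y + t *m b) - f y)%R <= (C1 * m%:R^-1 `^ deg p * N + C2)%:E)%E.
Proof.
have [C1 C10 H1] := smooth r0 p0 mG rowb.
exists C1 => // m m0; have [C2 C20 H2] := H1 m m0; exists C2 => // n k t f N tm af N0 fN.
apply: H2 => //; first by apply: measurable_preshift; exact: measurable_ball_rV.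
move=> y s Zy sM.
have -> : y + s *m b = (y - lat R n k *m b) + (lat R n k + s) *m b.
  by rewrite mulmxDl addrA subrK.
apply: Hroom => // i; rewrite mxE (le_trans (ler_normD _ _))//.
have : `|lat R n k ord0 i| <= 1.
  rewrite mxE ger0_norm ?divr_ge0//.
  have := leq_ord (k i); move: (k i : nat) => l ln.
  have [->|n0] := eqVneq n 0%N; first by rewrite invr0 mulr0.
  by rewrite ler_pdivrMr ?ltr0n ?lt0n// mul1r ler_nat.
have := sM i; have : 0 <= r%:R :> R by []; lra.
Qed.

Lemma Phi_shift_le A B g h (K : R) : measurable A -> measurable B -> pmeas p g ->
  (forall x, A x -> B (x + h)) -> (Phi p B g <= K%:E)%E ->
  (Phi p A (fun x => g (x + h)%R) <= K%:E)%E.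
Proof.
move=> mA mB mg AB gK.
have -> : K = \sum_(i < 1) (#|'I_1|%:R * 1) `^ deg p * K.
  by rewrite big_ord1 card_ord mulr1 powR1 mul1r.
apply: (@Phi_dom R d p p0 'I_1 (fun=> 1) (fun=> g) (fun=> h) (fun=> B)) => //.
- exact: pmeas_shift.
- by move=> x _; rewrite big_ord1 mul1r.
Qed.

Lemma Phi_infty_le A g y (K : R) : p = +oo%E -> (Phi p A g <= K%:E)%E -> A y ->
  `|g y| <= K.
Proof.
move=> -> /= H Ay; rewrite -lee_fin (le_trans _ H)//.
by apply: ereal_sup_ubound; right; exists y.
Qed.

Lemma ball_sub0 z e x : ball z e x -> ball (0 : 'rV[R]_d) e (x - z).
Proof. by rewrite -!ball_normE /= sub0r opprB. Qed.

(** For the uniform norm point values are controlled, so [z0] itself serves as base point. *)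
Lemma contraction_infty : p = +oo%E -> exists2 C : R, 0 <= C & forall m, (0 < m)%N ->
  exists2 C' : R, 0 <= C' & forall f N, adm r p G E f -> 0 <= N ->
    (Phi p G f <= N%:E)%E -> exists2 z, ball z0 a z &
    (Phi p (ball x0 a) (fun x => f x - interp_at r b f z x)%R
      <= (C * m%:R^-1 `^ deg p * N + C')%:E)%E.
Proof.
move=> pE.
have [C1 C10 H1] := Phi_lat_smooth.
have [C3 C30 H3] := Phi_node_sum.
have [rho [Cc [q [[rho0 Cc0 q0] HL]]]] := lattice_estimate r0 ub Hx.
exists (C1 + Cc * C3); first by rewrite addr_ge0 ?mulr_ge0.
move=> m m0; have [C2 C20 H2] := H1 m m0.
have [C' C'0 [Hcov Hsm Hest]] := HL m m0.
have qm0 : (0 < q * m)%N by rewrite muln_gt0 q0.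
have [CL CL0 HCL] := Phi_lat_sum qm0.
exists (C2 + C' * CL); first by rewrite addr_ge0 ?mulr_ge0.
move=> f N af N0 fN; exists z0; first exact: ballxx.
have Zz : Z z0 by exact: ballxx.
have dE : deg p = 1 by rewrite pE.
have m0' : 0 <= m%:R^-1 :> R by rewrite invr_ge0.
set M := _ + _; have M0 : 0 <= M by rewrite /M !(addr_ge0, mulr_ge0) ?powR_ge0.
rewrite {1}pE /=; apply: ge_ereal_sup => _ [->|[x xx <-]]; first by rewrite lee_fin.
have [k xk] := Hcov z0 x Zz xx.
have := Hest f z0 x k Zz xx xk; set zk := z0 + _ in xk *; set t := (x - zk) *m invmx b.
rewrite lee_fin => /le_trans; apply.
have tm : forall i, `|t ord0 i| <= m%:R^-1 by apply: Hsm; exact: ball_sub0.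
have e1 : `|f x - f zk| <= C1 * m%:R^-1 * N + C2.
  have := H2 _ k t f N tm af N0 fN; rewrite dE powRr1// => /(Phi_infty_le pE).
  have -> : f x - f zk = f (zk + t *m b) - f zk by rewrite /t mulmxKV// [zk + _]addrC subrK.
  by apply; rewrite /= /zk addrK.
have e2 : lat_sum r b (q * m) f z0 <= CL.
  have [_ /(Phi_infty_le pE)] := HCL f af; move=> /(_ z0 Zz); apply: le_trans.
  exact: ler_norm.
have e3 : node_sum r b f z0 <= C3 * N.
  have [_ /(Phi_infty_le pE)] := H3 f N af N0 fN; move=> /(_ z0 Zz); apply: le_trans.
  exact: ler_norm.
rewrite /M dE powRr1//.
apply: (@le_trans _ _ (C1 * m%:R^-1 * N + C2 + C' * CL + Cc * m%:R^-1 * (C3 * N))).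
  by rewrite lerD// ?lerD// ler_wpM2l// mulr_ge0.
by rewrite le_eqVlt; apply/orP; left; apply/eqP; ring.
Qed.

(** The number of lattice points grows like m^d and the volume of a ball decays like m^-d. The bound
    free of [m] keeps the sum over the lattice from spoiling the gain in 1/m. *)
Lemma lattice_volume (rho : R) (q m : nat) : 0 < rho -> (0 < q)%N -> (0 < m)%N ->
  #|{ffun 'I_d -> 'I_(q * m).+1}|%:R * ((rho / m%:R) *+ 2) ^+ d <= (4 * q%:R * rho) ^+ d.
Proof.
move=> rho0 q0 m0; have m0' : 0 < m%:R :> R by rewrite ltr0n.
have q0' : 0 < q%:R :> R by rewrite ltr0n.
rewrite card_ffun !card_ord natrX -exprMn.
have l0 : 0 <= rho / m%:R *+ 2 by rewrite mulrn_wge0// divr_ge0// ltW.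
apply: lerXn2r; rewrite ?nnegrE ?mulr_ge0 ?(ltW rho0) ?(ltW q0')//.
have -> : 4 * q%:R * rho = (2 * (q * m)%:R) * (rho / m%:R *+ 2).
  by rewrite natrM -mulr_natr; field; exact: lt0r_neq0.
rewrite ler_wpM2r// -natrM ler_nat mulSn mul1n -addn1 leq_add2l muln_gt0 q0//.
Qed.

(** An Lp bound does not control values at lattice points, so the base point varies. [h z] collects
    all that [lattice_estimate] needs at z; Tonelli bounds its integral over [Z], and
    [integral_select] picks z. *)
Lemma contraction_fin (s : R) : p = s%:E -> exists2 C : R, 0 <= C & forall m, (0 < m)%N ->
  exists2 C' : R, 0 <= C' & forall f N, adm r p G E f -> 0 <= N ->
    (Phi p G f <= N%:E)%E -> exists2 z, ball z0 a z &
    (Phi p (ball x0 a) (fun x => f x - interp_at r b f z x)%R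
      <= (C * m%:R^-1 `^ deg p * N + C')%:E)%E.
Proof.
move=> pE.
have [C1 C10 H1] := Phi_lat_smooth.
have [C3 C30 H3] := Phi_node_sum.
have [rho [Cc [q [[rho0 Cc0 q0] HL]]]] := lattice_estimate r0 ub Hx.
have dE : deg p = s by rewrite pE.
have s0 : 0 < s by rewrite -dE; exact: deg_gt0.
pose VZ := (a *+ 2) ^+ d; have VZ0 : 0 < VZ by rewrite exprn_gt0// mulrn_wgt0.
pose V0 := (4 * q%:R * rho) ^+ d.
have V00 : 0 <= V0 by rewrite exprn_ge0// !mulr_ge0// ltW.
exists (3 `^ s * (V0 * (C1 + Cc `^ s * C3)) / VZ).
  by rewrite divr_ge0 ?(ltW VZ0)// !(mulr_ge0, addr_ge0, powR_ge0).
move=> m m0; have [C2 C20 H2] := H1 m m0.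
have m0' : 0 < m%:R :> R by rewrite ltr0n.
have [C' C'0 [Hcov Hsm Hest]] := HL m m0.
have qm0 : (0 < q * m)%N by rewrite muln_gt0 q0.
have [CL CL0 HCL] := Phi_lat_sum qm0.
exists (3 `^ s * (V0 * C2 + V0 * C' `^ s * CL + 1) / VZ).
  by rewrite divr_ge0 ?(ltW VZ0)// !(mulr_ge0, addr_ge0, powR_ge0).
move=> f N af N0 fN; have [mf _] := af.
set e := m%:R^-1 `^ s.
pose rm := rho / m%:R; have rm0 : 0 < rm by rewrite divr_gt0.
pose V := (rm *+ 2) ^+ d.
have V_ge0 : 0 <= V by rewrite exprn_ge0// mulrn_wge0// ltW.
pose I : finType := {ffun 'I_d -> 'I_(q * m).+1}.
pose l (k : I) := lat R (q * m) k *m b.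
pose F (k : I) (u : 'rV[R]_d * 'rV[R]_d) : \bar R :=
  (`|f (u.1 + l k + u.2) - f (u.1 + l k)| `^ s)%:E.
have mf' : measurable_fun setT (f : _ -> measurableTypeR R) by move: mf; rewrite pE.
have mF k : measurable_fun setT (F k).
  apply/measurable_EFinP; apply: (measurableT_comp (measurable_powR s)).
  apply: (measurableT_comp (@normr_measurable R setT)).
  have m1 : measurable_fun setT (fun u : 'rV[R]_d * 'rV[R]_d => u.1 + l k).
    exact: (measurableT_comp (measurable_shift_rV (l k)) measurable_fst).
  have m2 : measurable_fun setT (fun u : 'rV[R]_d * 'rV[R]_d => (u.1 + l k, u.2)).
    by apply: measurable_fun_pair => //; exact: measurable_snd.
  have m3 := measurableT_comp (@measurable_addX_rV R d) m2.
  by apply: measurable_funB; [exact: (measurableT_comp mf' m3)|exact: (measurableT_comp mf' m1)].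
have F0 k u : (0 <= F k u)%E by rewrite lee_fin powR_ge0.
pose W : set 'rV[R]_d := ball 0 rm.
have mZ : measurable Z by exact: measurable_ball_rV.
have mW : measurable W by exact: measurable_ball_rV.
pose U k z := (\int[lebesgue_rV R d]_(w in W) F k (z, w))%E.
have U0 k z : (0 <= U k z)%E by apply: integral_ge0.
have mU k : measurable_fun Z (U k) by case: (tonelli_on mZ mW (mF k) (F0 k)).
have VW : lebesgue_rV R d W = V%:E by rewrite /W lebesgue_rV_ball.
have IU k : (\int[lebesgue_rV R d]_(z in Z) U k z <= ((C1 * e * N + C2) * V)%:E)%E.
  (* For a fixed offset [w] the integral over z is a translation estimate, uniform in [w]. *)
  have [_ ->] := tonelli_on mZ mW (mF k) (F0 k).
  rewrite EFinM -VW -integral_cst//.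
  apply: ge0_le_integral => //.
  - by move=> w _; apply: integral_ge0.
  - pose F' (u : 'rV[R]_d * 'rV[R]_d) := F k (u.2, u.1).
    have mF' : measurable_fun setT F'.
      apply: (measurableT_comp (mF k)); exact: measurable_fun_pair measurable_snd measurable_fst.
    by case: (tonelli_on mW mZ mF' (fun u => F0 k _)).
  - move=> w Ww; set t := w *m invmx b.
    have tm : forall i, `|t ord0 i| <= m%:R^-1 by apply: Hsm.
    have := H2 _ k t f N tm af N0 fN; rewrite dE -/e => H.
    have : (Phi p Z (fun z => (f (z + l k + t *m b) - f (z + l k))%R) <=
        (C1 * e * N + C2)%:E)%E.
      apply: (@Phi_shift_le _ _ (fun y => f (y + t *m b) - f y) _ _ mZ _ _ _ H).
      - exact: measurable_preshift.
      - by apply: pmeasB => //; exact: pmeas_shift.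
      - by move=> x Zx /=; rewrite addrK.
    by rewrite {1}pE /= /F /t mulmxKV.
have [mS HS] := HCL f af; have [mN HN] := H3 f N af N0 fN.
set S := lat_sum r b (q * m) f in mS HS; set T := node_sum r b f in mN HN.
have {}mS : measurable_fun setT (S : _ -> measurableTypeR R) by move: mS; rewrite pE.
have {}mN : measurable_fun setT (T : _ -> measurableTypeR R) by move: mN; rewrite pE.
rewrite {1}pE /= in HS; rewrite {1}pE /= in HN.
pose c1 := V0 * C' `^ s; pose c2 := V0 * (Cc * m%:R^-1) `^ s.
have c10 : 0 <= c1 by rewrite mulr_ge0 ?powR_ge0.
have c20 : 0 <= c2 by rewrite mulr_ge0 ?powR_ge0.
pose h2 z : \bar R := (c1%:E * (`|S z| `^ s)%:E + c2%:E * (`|T z| `^ s)%:E)%E.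
pose h z : \bar R := (\sum_(k : I) U k z + h2 z)%E.
have mSs := measurable_norm_powR s mS; have mTs := measurable_norm_powR s mN.
have mh2 : measurable_fun Z h2.
  by apply: emeasurable_funD; apply: measurable_funeM; exact: measurable_funTS.
have h20 z : (0 <= h2 z)%E.
  by rewrite adde_ge0// mule_ge0// lee_fin// powR_ge0.
have mh : measurable_fun Z h by apply: emeasurable_funD => //; exact: emeasurable_sum.
have h0 z : (0 <= h z)%E by rewrite adde_ge0// sume_ge0.
pose K := V0 * (C1 * e * N + C2) + (c1 * CL + c2 * (C3 * N)).
have HI : (\int[lebesgue_rV R d]_(z in Z) h z <= K%:E)%E.
  have CN0 : 0 <= C1 * e * N + C2 by rewrite addr_ge0 ?mulr_ge0 ?powR_ge0.
  rewrite ge0_integralD//; last 2 first.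
  - by move=> z _; rewrite sume_ge0.
  - exact: emeasurable_sum.
  rewrite /K EFinD leeD//.
    rewrite ge0_integral_sum//.
    apply: (@le_trans _ _ (\sum_(k : I) ((C1 * e * N + C2) * V)%:E)%E).
      by apply: lee_sum => k _; exact: IU.
    rewrite sumEFin lee_fin sumr_const -[_ *+ _]mulr_natl mulrCA mulrC ler_wpM2r//.
    exact: lattice_volume.
  rewrite ge0_integralD//; last 4 first.
  - by move=> z _; rewrite mule_ge0// lee_fin// powR_ge0.
  - by apply: measurable_funeM; exact: measurable_funTS.
  - by move=> z _; rewrite mule_ge0// lee_fin// powR_ge0.
  - by apply: measurable_funeM; exact: measurable_funTS.
  rewrite EFinD leeD//.
    rewrite ge0_integralZl_EFin//; last exact: measurable_funTS.
    by rewrite (EFinM c1) lee_wpmul2l// lee_fin.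
  rewrite ge0_integralZl_EFin//; last exact: measurable_funTS.
  by rewrite (EFinM c2) lee_wpmul2l// lee_fin.
have [z Zz hz] := integral_select a0 mh h0 HI.
exists z => //; rewrite dE -/e.
set P := interp_at r b f z.
have mP : pmeas p P by apply: pmeas_continuous; exact: continuous_tens.
pose u k := fine (U k z).
have uE k : U k z = (u k)%:E.
  rewrite /u fineK// ge0_fin_numE//; apply: le_lt_trans (ltry _); apply: le_trans hz.
  rewrite /h (bigD1 k)//= -addeA leeDl// adde_ge0// sume_ge0//.
have u0 k : 0 <= u k by rewrite fine_ge0.
pose A2 := V * (C' * `|S z|) `^ s; pose A3 := V * (Cc * m%:R^-1 * `|T z|) `^ s.
have A20 : 0 <= A2 by rewrite mulr_ge0 ?powR_ge0.
have A30 : 0 <= A3 by rewrite mulr_ge0 ?powR_ge0.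
(* On one small ball the last two terms of the lattice estimate do not depend on [x], so they enter
   as multiples of the function 1. The 3 is the number of terms. *)
have HB k : (Phi p (ball x0 a `&` ball (z + l k)%R rm) (fun x => f x - P x)%R
    <= (3 `^ s * (u k + A2 + A3))%:E)%E.
  set zk := z + l k.
  pose c (i : 'I_3) := nth 0 [:: 1; C' * `|S z|; Cc * m%:R^-1 * `|T z|] i.
  pose g (i : 'I_3) := if (i : nat) == 0%N then (fun x => f x - f zk) else cst 1.
  pose Kg (i : 'I_3) := if (i : nat) == 0%N then u k else V.
  have -> : 3 `^ s * (u k + A2 + A3) = \sum_(i < 3) (#|'I_3|%:R * c i) `^ s * Kg i.
    rewrite card_ord !big_ord_recl big_ord0 /c /Kg /= mulr1.
    by rewrite !(@powRM _ 3) ?mulr_ge0// ?invr_ge0//; rewrite /A2 /A3; ring.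
  rewrite -dE.
  apply: (@Phi_dom R d p p0 'I_3 c g (fun=> 0) (fun=> ball zk rm)) => //.
  - by apply: measurableI; exact: measurable_ball_rV.
  - by move=> i; exact: measurable_ball_rV.
  - exact: pmeasB.
  - move=> i; rewrite /g; case: ifP => _; last by apply: pmeas_continuous; exact: cst_continuous.
    by apply: pmeasB => //; apply: pmeas_continuous; exact: cst_continuous.
  - by case=> -[|[|[|]]] // i; rewrite /c /= ?mulr_ge0// ?invr_ge0// ltW.
  - move=> i; rewrite /g /Kg; case: ifP => _; rewrite pE /=.
      have mg : measurable_fun setT (fun x => (`|f x - f zk| `^ s)%:E).
        by apply: measurable_norm_powR; exact: measurable_funB.
      rewrite -uE /U -(ge0_integral_shift zk (measurable_ball_rV zk rm) mg); last first.
        by move=> x; rewrite lee_fin powR_ge0.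
      have -> : (fun x => x + zk) @^-1` ball zk rm = W.
        by apply/seteqP; split => w; rewrite /W /= -!ball_normE /= sub0r opprD addrCA subrr addr0.
      rewrite (eq_integral (fun w => F k (z, w)))// => w _.
      by rewrite /F /= [w + _]addrC.
    under eq_integral do rewrite normr1 powR1.
    by rewrite integral_cst ?mul1e; [rewrite [leLHS]lebesgue_rV_ball|exact: measurable_ball_rV].
  - by move=> i x [_]; rewrite addr0.
  move=> x [xx xk]; rewrite !big_ord_recl big_ord0 /c /g /= addr0 !addr0 normr1 !mulr1 mul1r.
  rewrite (le_trans (Hest f z x k Zz xx xk))// -/zk addrA lerD//.
    by rewrite lerD// ler_wpM2l// ler_norm.
  by rewrite ler_wpM2l ?ler_norm// mulr_ge0// invr_ge0 ltW.
have mB k : measurable (ball x0 a `&` ball (z + l k) rm).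
  by apply: measurableI; exact: measurable_ball_rV.
have AB : ball x0 a `<=` \bigcup_k (ball x0 a `&` ball (z + l k) rm).
  by move=> x xx; have [k xk] := Hcov z x Zz xx; exists k.
apply: (le_trans (Phi_cover p0 (measurable_ball_rV _ _) mB (pmeasB mf mP) AB HB)).
have {}hz : \sum_k u k + (c1 * `|S z| `^ s + c2 * `|T z| `^ s) <= (K + 1) / VZ.
  by move: hz; rewrite /h; under eq_bigr do rewrite uE; rewrite sumEFin -EFinD lee_fin.
have vol := lattice_volume rho0 q0 m0.
have hA2 : #|I|%:R * A2 <= c1 * `|S z| `^ s.
  by rewrite /A2 /c1 powRM// mulrA -[leRHS]mulrA ler_wpM2r// mulr_ge0 ?powR_ge0.
have hA3 : #|I|%:R * A3 <= c2 * `|T z| `^ s.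
  rewrite /A3 /c2 (@powRM _ (Cc * m%:R^-1))//; last by rewrite mulr_ge0// invr_ge0 ltW.
  by rewrite mulrA -[leRHS]mulrA ler_wpM2r// mulr_ge0 ?powR_ge0.
rewrite lee_fin; apply: (@le_trans _ _ (3 `^ s * ((K + 1) / VZ))).
  rewrite -mulr_sumr ler_wpM2l ?powR_ge0//; apply: le_trans hz.
  by rewrite sumrD_cst2 lerD2l lerD.
have c2E : c2 = V0 * (Cc `^ s * e) by rewrite /c2 powRM// invr_ge0 ltW.
rewrite /K c2E /c1 le_eqVlt; apply/orP; left; apply/eqP; field.
exact: lt0r_neq0.
Qed.

Lemma contraction : exists2 C : R, 0 <= C & forall m, (0 < m)%N ->
  exists2 C' : R, 0 <= C' & forall f N, adm r p G E f -> 0 <= N ->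
    (Phi p G f <= N%:E)%E -> exists2 z, ball z0 a z &
    (Phi p (ball x0 a) (fun x => f x - interp_at r b f z x)%R
      <= (C * m%:R^-1 `^ deg p * N + C')%:E)%E.
Proof.
have [[s pE]|pE] : (exists s : R, p = s%:E) \/ p = +oo%E.
- by case: p p0 => [s||]//; [left; exists s|right].
- exact: contraction_fin pE.
- exact: contraction_infty.
Qed.

End contraction.

(** * Projection onto directional polynomials *)

(** With a pseudoinverse N of the matrix A, the vector w = v A N has the same image as v and depends
    linearly on that image alone. So v - w is in the kernel and w is small when the image is. *)
Lemma pinv_bound (R : realFieldType) (J K : finType) (A : J -> K -> R) :
  exists2 C : R, 0 <= C & forall v : J -> R, exists w : J -> R,
    (forall k, \sum_j w j * A j k = \sum_j v j * A j k) /\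
    forall j, `|w j| <= C * \sum_k `|\sum_j v j * A j k|.
Proof.
pose M : 'M[R]_(#|J|, #|K|) := \matrix_(i, k) A (enum_val i) (enum_val k).
pose N := pinvmx M.
exists (\sum_k \sum_j `|N k j|).
  by apply: sumr_ge0 => k _; exact: sumr_ge0.
have sumE (I : finType) (F : I -> R) : \sum_j F j = \sum_(i < #|I|) F (enum_val i).
  by rewrite (reindex (@enum_val I predT))//; apply: onW_bij; exact: enum_val_bij.
pose V (u : J -> R) : 'rV[R]_#|J| := \row_i u (enum_val i).
have VM u (k : 'I_#|K|) : (V u *m M) ord0 k = \sum_j u j * A j (enum_val k).
  by rewrite mxE [RHS]sumE; apply: eq_bigr => i _; rewrite !mxE.
move=> v; pose W := V v *m M *m N; pose w j := W ord0 (enum_rank j).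
have WE : V w = W by apply/rowP => i; rewrite mxE /w enum_valK.
exists w; split=> [k|j].
  rewrite -[k]enum_rankK -!VM WE /W /N mulmxKpV//.
  exact: submxMl.
rewrite /w /W mxE mulr_sumr [leRHS]sumE (le_trans (ler_norm_sum _ _ _))//.
apply: ler_sum => k _; rewrite normrM -VM mulrC ler_wpM2r//.
rewrite (bigD1 k)//= (bigD1 (enum_rank j))//= -addrA lerDl.
by rewrite addr_ge0 ?sumr_ge0// => i _; rewrite sumr_ge0.
Qed.

Section projection.
Variables (R : realType) (d r : nat) (p : \bar R) (E : set 'rV[R]_d).
Hypotheses (r0 : (0 < r)%N) (p0 : (0 < p)%E).
Variables (I : finType) (ev : I -> 'rV[R]_d).
Hypotheses (evE : forall i, E (ev i)) (Eev : forall xi, E xi -> exists i, xi = ev i).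

Lemma axpoly_scale (B : 'M[R]_d) (t : R) (P : 'rV[R]_d -> R) :
  t != 0 -> axpoly r B P -> axpoly r (t *: B) P.
Proof.
move=> t0 Pb x i; have [q sq Hq] := Pb x i.
exists (q \Po (t *: 'X)).
  by rewrite size_comp_poly2// size_scale ?size_polyX.
move=> u; have -> : row i (t *: B) = t *: row i B by apply/rowP => j; rewrite !mxE.
by rewrite scalerA Hq horner_comp hornerZ hornerX mulrC.
Qed.

Variable b : 'M[R]_d.
Hypotheses (ub : b \in unitmx).
Implicit Types (x y z s : 'rV[R]_d) (P Q : 'rV[R]_d -> R).

Local Notation J := {ffun 'I_d -> 'I_r}.

Lemma difference_comb (h : 'rV[R]_d) (v : J -> R) (beta : J -> 'rV[R]_d -> R) x :
  difference r h (fun y => \sum_j v j * beta j y) x =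
  \sum_j v j * difference r h (beta j) x.
Proof.
rewrite /difference; under eq_bigr do rewrite mulr_sumr.
rewrite exchange_big; apply: eq_bigr => j _; rewrite mulr_sumr.
by apply: eq_bigr => i _; ring.
Qed.

Lemma axpoly_difference (B : 'M[R]_d) (h : 'rV[R]_d) P :
  axpoly r B P -> axpoly r B (difference r h P).
Proof. by move=> PB; exact: axpoly_lin. Qed.

Lemma axpoly_tensE (B : 'M[R]_d) z P x : B \in unitmx -> axpoly r B P ->
  P x = tens (fun j : J => P (z + node R j *m B)) ((x - z) *m invmx B).
Proof.
move=> uB PB; rewrite -(axpoly_tens r0 _ _ PB) mulmxKV//.
by rewrite addrC subrK.
Qed.

Lemma axpoly_continuous P : axpoly r b P -> continuous P.
Proof.
move=> Pb; have -> : P = fun x => tens (fun j : J => P (0 + node R j *m b)) ((x - 0) *m invmx b).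
  by apply/funext => x; exact: axpoly_tensE.
exact: continuous_tens.
Qed.

(** A single nonzero step length suffices because [P] is already a polynomial on every line, by
    [tens_line]. *)
Lemma dir_poly_difference_eq0 P (u : R) : u != 0 -> axpoly r b P ->
  (forall xi x, E xi -> difference r (u *: xi) P x = 0) -> dir_poly r E P.
Proof.
move=> u0 Pb H; split; first exact: axpoly_continuous.
move=> x xi Exi.
have [q Hq] := tens_line (fun j : J => P (0 + node R j *m b)) (x *m invmx b) (xi *m invmx b).
have {}Hq t : P (x + t *: xi) = q.[t].
  by rewrite (axpoly_tensE 0 _ ub Pb) subr0 mulmxDl -scalemxAl Hq.
exists q; split => //; apply: (fdiff_horner_eq0_size u0) => t.
have := H xi (x + t *: xi) Exi; rewrite /difference => <-.
by apply: eq_bigr => j _; rewrite -Hq scalerA -addrA -scalerDl.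
Qed.

Variables (x0 : 'rV[R]_d) (a u : R).
Hypotheses (a0 : 0 < a) (u0 : u != 0).

(* For p < oo the nodal values of the differences of P are not controlled by
   their Lp norm; they are recovered by averaging over the position z of the
   interpolation nodes. *)
Lemma project_dir_poly : exists2 C : R, 0 <= C & forall P (K : R), axpoly r b P -> 0 <= K ->
  (forall xi, E xi -> (Phi p (ball x0 (a / 2)) (difference r (u *: xi) P) <= K%:E)%E) ->
  exists2 Q, dir_poly r E Q &
    (Phi p (ball x0 a) (fun x => P x - Q x)%R <= (C * K)%:E)%E.
Proof.
have [Kb Kb0 HKb] := mulmx_bounded b.
(* The frame is shrunk so that nodes based within a/4 of [x0] stay within a/2, where the differences
   are bounded. *)
pose t := a / 4 / (Kb * r%:R + 1).
have D0 : 0 < Kb * r%:R + 1 by rewrite ltr_wpDl// mulr_ge0// ltW.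
have t0 : 0 < t by rewrite !divr_gt0.
pose B := t *: b.
have uB : B \in unitmx by rewrite unitmxZ// unitfE gt_eqF.
have tn0 : t != 0 by rewrite gt_eqF.
have Hnode z (j : J) : ball x0 (a / 4) z -> ball x0 (a / 2) (z + node R j *m B).
  rewrite -!ball_normE /= opprD addrA => xz.
  have : `|node R j *m B| <= a / 4.
    rewrite -scalemxAr normrZ gtr0_norm//.
    apply: (@le_trans _ _ (t * (Kb * r%:R + 1))); last by rewrite /t divfK ?gt_eqF.
    rewrite ler_wpM2l ?(ltW t0)// (le_trans (HKb _))// ler_wpDr// ler_wpM2l ?(ltW Kb0)//.
    by apply: norm_rV_leP => // i; rewrite mxE ger0_norm// ler_nat ltnW.
  move=> nB; rewrite (le_lt_trans (ler_normB _ _))//; move: xz nB.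
  by set X := `|_|; set Y := `|_|; lra.
have [Ki Ki0 HKi] := mulmx_bounded (invmx B).
pose M := Ki * a + r%:R.
have [C1 C10 HC1] := tens_bounded d r M.
pose beta (j : J) x := \prod_i (ell R (j i)).[((x - x0) *m invmx B) ord0 i].
(* The linear map from nodal values of a polynomial to nodal values of its E-differences; a
   polynomial in its kernel lies in Pi(E). *)
pose A (j : J) (k : I * J) := difference r (u *: ev k.1) (beta j) (x0 + node R k.2 *m B).
have [C2 C20 HC2] := pinv_bound A.
have a4 : 0 < a / 4 by rewrite divr_gt0.
have [V1 V10 HV1] := Phi_cst_ball p0 x0 a4.
have [V2 V20 HV2] := Phi_cst_ball p0 x0 a0.
pose C3 := C1 * #|{: I * J}|%:R.
have C30 : 0 <= C3 by rewrite mulr_ge0.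
pose IJ : finType := (I * J * J)%type.
pose C5 := (\sum_(q : IJ) (#|IJ|%:R * C1) `^ deg p) / V1.
have C50 : 0 <= C5.
  by rewrite divr_ge0 ?(ltW V10)// sumr_ge0// => q _; exact: powR_ge0.
pose C6 := (C1 * (#|J|%:R * C2)) `^ deg p * V2.
have C60 : 0 <= C6 by rewrite mulr_ge0 ?powR_ge0// ltW.
exists (C6 * C5); first exact: mulr_ge0.
move=> P K Pb K0 HK.
have PB : axpoly r B P by exact: axpoly_scale.
pose v (j : J) := P (x0 + node R j *m B).
have PE x : P x = \sum_j v j * beta j x by rewrite (axpoly_tensE x0 x uB PB).
(* [w] has the same differences as [P], so they cancel in Q = P - Pw, and P - Q = Pw is bounded by
   them. *)
have [w [Aw Hw]] := HC2 v.
pose Pw x := tens w ((x - x0) *m invmx B).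
have PwB : axpoly r B Pw by exact: tens_axpoly.
have Pwb : axpoly r b Pw.
  have : axpoly r (t^-1 *: B) Pw by apply: axpoly_scale => //; rewrite invr_eq0.
  by rewrite /B scalerA mulVf// scale1r.
pose Q x := P x - Pw x.
have Qb : axpoly r b Q.
  move=> x i; have [q1 s1 H1] := Pb x i; have [q2 s2 H2] := Pwb x i.
  exists (q1 - q2); first by rewrite (leq_trans (size_polyD _ _))// geq_max s1 size_polyN.
  by move=> c; rewrite /Q H1 H2 hornerD hornerN.
have QB : axpoly r B Q by exact: axpoly_scale.
have QE x : Q x = \sum_j (v j - w j) * beta j x.
  by rewrite /Q PE /Pw /tens -sumrB; apply: eq_bigr => j _; rewrite mulrBl.
have TE i j' : difference r (u *: ev i) P (x0 + node R j' *m B) = \sum_j v j * A j (i, j').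
  by rewrite -(difference_comb _ v); congr difference; apply/funext => x; exact: PE.
exists Q.
  apply: (dir_poly_difference_eq0 u0 Qb) => xi x /Eev[i ->].
  rewrite (axpoly_tensE x0 x uB (axpoly_difference _ QB)) /tens big1// => j _.
  have -> : difference r (u *: ev i) Q (x0 + node R j *m B) =
      \sum_j' (v j' - w j') * A j' (i, j).
    rewrite -(difference_comb _ (fun j => v j - w j)); congr difference.
    by apply/funext => y; exact: QE.
  have -> : \sum_j' (v j' - w j') * A j' (i, j) = 0.
    by under eq_bigr do rewrite mulrBl; rewrite sumrB Aw subrr.
  by rewrite mul0r.
pose X := \sum_k `|\sum_j v j * A j k|.
have X0 : 0 <= X by exact: sumr_ge0.
have cP : continuous P by exact: axpoly_continuous Pb.
(* The differences are again tensor-product polynomials, so their values at the nodes based at [x0]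
   are bounded by those at the nodes based at a nearby z. *)
have TX z : ball x0 (a / 4) z ->
    X <= \sum_(q : IJ) C1 * `|difference r (u *: ev q.1.1) P (z + node R q.2 *m B)|.
  move=> xz.
  rewrite -(pair_big predT predT (fun (k : I * J) (j : J) =>
    C1 * `|difference r (u *: ev k.1) P (z + node R j *m B)|))/=.
  apply: ler_sum => -[i j'] _; rewrite -TE -mulr_sumr /=.
  rewrite (axpoly_tensE z _ uB (axpoly_difference _ PB)); apply: HC1 => k.
  have -> : x0 + node R j' *m B - z = node R j' *m B + (x0 - z) by rewrite addrAC addrC.
  rewrite mulmxDl mulmxK// mxE (le_trans (ler_normD _ _))// addrC lerD//.
    rewrite (le_trans (coord_le_norm _ _))// (le_trans (HKi _))// ler_wpM2l ?(ltW Ki0)//.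
    move: xz; rewrite -ball_normE /= => /ltW/le_trans; apply; lra.
  by rewrite mxE ger0_norm// ler_nat ltnW.
have XK : X `^ deg p <= C5 * K.
  have : (Phi p (ball x0 (a / 4)) (cst X) <=
      (\sum_(q : IJ) (#|IJ|%:R * C1) `^ deg p * K)%:E)%E.
    apply: (@Phi_dom R d p p0 IJ (fun=> C1)
      (fun q => difference r (u *: ev q.1.1) P) (fun q => node R q.2 *m B)
      (fun=> ball x0 (a / 2))) => //.
    - exact: measurable_ball_rV.
    - by move=> q; exact: measurable_ball_rV.
    - by apply: pmeas_continuous; exact: cst_continuous.
    - by move=> q; apply: pmeas_difference; exact: pmeas_continuous.
    - by move=> q; exact: HK.
    - by move=> q z xz; exact: Hnode.
    - by move=> z xz; rewrite ger0_norm//; exact: TX.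
  rewrite HV1// lee_fin -mulr_suml => H.
  by rewrite /C5 mulrAC ler_pdivlMr// mulrC.
apply: (@le_trans _ _ (\sum_(i < 1) (#|'I_1|%:R * (C1 * (#|J|%:R * C2))) `^ deg p *
    (V2 * X `^ deg p))%:E%E).
  apply: (@Phi_dom R d p p0 'I_1 (fun=> C1 * (#|J|%:R * C2)) (fun=> cst X) (fun=> 0)
    (fun=> ball x0 a)) => //.
  - exact: measurable_ball_rV.
  - by move=> i; exact: measurable_ball_rV.
  - apply: pmeasB; apply: pmeas_continuous => //.
    by apply: axpoly_continuous; exact: Qb.
  - by move=> _; apply: pmeas_continuous; exact: cst_continuous.
  - by move=> _; rewrite !mulr_ge0.
  - by move=> _; rewrite HV2.
  - by move=> _ x; rewrite addr0.
  move=> x xx; rewrite big_ord1 /= (ger0_norm X0) /Q subKr.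
  apply: (le_trans (HC1 _ _ _)).
    move=> i; rewrite (le_trans (coord_le_norm _ _))// (le_trans (HKi _))// /M.
    rewrite ler_wpDr// ler_wpM2l ?(ltW Ki0)//.
    by move: xx; rewrite -ball_normE /= distrC => /ltW.
  rewrite -!mulrA ler_wpM2l//.
  have -> : #|J|%:R * (C2 * X) = \sum_(j : J) C2 * X by rewrite sumr_const mulr_natl.
  by apply: ler_sum => j _; exact: Hw.
rewrite big_ord1 card_ord mul1r lee_fin mulrA -/C6 -mulrA ler_wpM2l//.
Qed.

End projection.

Section dir_poly.
Variables (R : realType) (d r : nat) (p : \bar R) (G E : set 'rV[R]_d).
Hypotheses (r0 : (0 < r)%N) (p0 : (0 < p)%E).
Implicit Types (f Q : 'rV[R]_d -> R).

Lemma difference_dir_poly Q xi (u : R) x : dir_poly r E Q -> E xi ->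
  difference r (u *: xi) Q x = 0.
Proof.
move=> [_ HQ] Exi; have [q [sq Hq]] := HQ x xi Exi.
rewrite -(fdiff_horner_eq0 u 0 0 r0 sq); apply: eq_bigr => j _.
by rewrite scalerA Hq !add0r.
Qed.

Lemma differenceB h f g x :
  difference r h (fun x => f x - g x) x = difference r h f x - difference r h g x.
Proof. by rewrite /difference -sumrB; apply: eq_bigr => j _; rewrite mulrBr. Qed.

(** r-th differences along [E] annihilate [Q]; this is what permits the iteration. *)
Lemma adm_sub_dir_poly f Q : adm r p G E f -> dir_poly r E Q ->
  adm r p G E (fun x => f x - Q x).
Proof.
move=> [mf Hf] HQ; have [cQ _] := HQ; split.
  by apply: pmeasB => //; exact: pmeas_continuous.
move=> xi u A Exi mA HA.
have -> : difference r (u *: xi) (fun x => f x - Q x) = difference r (u *: xi) f.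
  by apply/funext => x; rewrite differenceB (difference_dir_poly _ _ HQ Exi) subr0.
exact: Hf.
Qed.

Lemma dir_polyD Q1 Q2 : dir_poly r E Q1 -> dir_poly r E Q2 ->
  dir_poly r E (fun x => Q1 x + Q2 x).
Proof.
move=> [c1 H1] [c2 H2]; split=> [x|].
  by apply: (cvgD (FF := nbhs_filter x)); [exact: c1|exact: c2].
move=> x xi Exi; have [q1 [s1 E1]] := H1 x xi Exi; have [q2 [s2 E2]] := H2 x xi Exi.
exists (q1 + q2); split; first by rewrite (leq_trans (size_polyD _ _))// geq_max s1.
by move=> t; rewrite E1 E2 hornerD.
Qed.

Lemma dir_poly0 : dir_poly r E (fun=> 0).
Proof.
split; first exact: cst_continuous.
by move=> x xi _; exists 0; rewrite size_poly0; split => // t; rewrite horner0.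
Qed.

End dir_poly.

Section enorm.
Variables (R : realType) (d : nat).
Implicit Types (x y xi : 'rV[R]_d).

Lemma enormZ (u : R) xi : enorm (u *: xi) = `|u| * enorm xi.
Proof.
rewrite /enorm; under eq_bigr do rewrite mxE exprMn.
by rewrite -mulr_sumr sqrtrM ?sqr_ge0// sqrtr_sqr.
Qed.

Lemma coord_le_enorm xi i : `|xi ord0 i| <= enorm xi.
Proof.
rewrite -sqrtr_sqr /enorm ler_wsqrtr// (bigD1 i)//= lerDl.
by apply: sumr_ge0 => k _; exact: sqr_ge0.
Qed.

Lemma norm_le_enorm xi : `|xi| <= enorm xi.
Proof. by apply: norm_rV_leP => [|i]; [exact: sqrtr_ge0|exact: coord_le_enorm]. Qed.

Lemma enorm_le_norm xi : enorm xi <= Num.sqrt d%:R * `|xi|.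
Proof.
have -> : Num.sqrt d%:R * `|xi| = Num.sqrt (d%:R * `|xi| ^+ 2).
  by rewrite sqrtrM// sqrtr_sqr normr_id.
rewrite /enorm ler_wsqrtr//.
have -> : d%:R * `|xi| ^+ 2 = \sum_(i < d) `|xi| ^+ 2.
  by rewrite sumr_const card_ord mulr_natl.
apply: ler_sum => i _; rewrite -real_normK ?num_real//.
by apply: lerXn2r; rewrite ?nnegrE// coord_le_norm.
Qed.

Lemma le_diam (G : set 'rV[R]_d) x y : bounded_set G -> G x -> G y ->
  enorm (x - y) <= diam G.
Proof.
move=> [M [_ HM]] Gx Gy; apply: ub_le_sup; last by exists x => //; exists y.
exists (Num.sqrt d%:R * (2 * (M + 1))) => _ [x' Gx'] [y' Gy'] <-.
rewrite (le_trans (enorm_le_norm _))// ler_wpM2l ?sqrtr_ge0//.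
have H z : G z -> `|z| <= M + 1 by apply: HM; rewrite ltrDl.
have := H _ Gx'; have := H _ Gy'; have := ler_normB x' y'; lra.
Qed.

End enorm.

Lemma Phi_fin_Lp (R : realType) d (p : \bar R) (A : set 'rV[R]_d) f : (0 < p)%E ->
  (Lp_norm p A f < +oo)%E -> closed A -> exists2 N : R, 0 <= N & (Phi p A f <= N%:E)%E.
Proof.
move=> p0 fp cA.
have : (Phi p A f < +oo)%E.
  case: p p0 fp => [s||] //=; rewrite -?(closure_id _).1//.
  rewrite lte_fin => s0; apply: lty_poweRy.
  by rewrite invr_eq0 gt_eqF.
move=> H; have F : Phi p A f \is a fin_num by rewrite ge0_fin_numE// Phi_ge0.
exists (fine (Phi p A f)); first by rewrite fine_ge0// Phi_ge0.
by rewrite fineK.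
Qed.

Section of_Lp.
Variables (R : realType) (d r : nat) (p : \bar R) (G E : set 'rV[R]_d).
Hypotheses (r0 : (0 < r)%N) (p0 : (0 < p)%E) (kG : compact G) (ES : E `<=` sphere).

Let clG : closed G.
Proof. by apply: compact_closed => //; exact: norm_hausdorff. Qed.

Let mG : measurable G.
Proof. exact: closed_measurable_rV. Qed.

Lemma Lp_bound f : in_Lp p G f -> exists2 N : R, 0 <= N & (Phi p G f <= N%:E)%E.
Proof.
move=> fp; apply: Phi_fin_Lp => //; case: p p0 fp => [s||] //=; first by move=> _ [].
move=> _ cf; have : compact (f @` closure G).
  apply: continuous_compact => //; rewrite -(closure_id _).1//.
move=> /compact_bounded[M [_ HM]].
apply: (@le_lt_trans _ _ `|M + 1|%:E); last exact: ltry.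
apply: ge_ereal_sup => _ [->|[x Gx <-]]; rewrite lee_fin//.
apply: le_trans (ler_norm _); apply: (HM (M + 1)); first by rewrite ltrDl.
by exists x.
Qed.

Lemma adm_of_Lp f : in_Lp p G f -> (set_modulus r E f G p <= 1)%E ->
  adm r p G E (f \_ G).
Proof.
move=> fp f1; have mf : pmeas p (f \_ G).
  case: p p0 fp => [s||] //= _ [mf _].
  by apply/(measurable_restrictT _ mG).
split=> // xi u A Exi mA HA.
have [A0|/set0P[x Ax]] := eqVneq A set0.
  rewrite A0; case: p p0 => [s||] //= _; first by rewrite integral_set0.
  by apply: ge_ereal_sup => _ [->|[y []]].
have x0 : G x by have := HA x 0%N Ax isT; rewrite scale0r addr0.
have x1 : G (x + u *: xi) by have := HA x 1%N Ax r0; rewrite scale1r.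
(* The points for j = 0 and j = 1 differ by [u] times a unit vector, so the step lies in the range
   of [set_modulus]. *)
have u1 : `|u| <= diam G.
  have := le_diam (compact_bounded kG) x1 x0.
  by rewrite addrAC subrr add0r enormZ (ES Exi) mulr1.
pose D := difference_domain G r (u *: xi).
have AD : A `<=` D by move=> y Ay j jr; exact: HA.
have E0 y : D y -> difference r (u *: xi) (f \_ G) y = difference r (u *: xi) f y.
  move=> Dy; apply: eq_bigr => j _; congr (_ * _); rewrite patchE ifT//.
  by apply/mem_set/Dy; rewrite -ltnS.
have : (Lp_norm p D (difference r (u *: xi) f) <= 1)%E.
  apply: le_trans f1; apply: (@le_trans _ _ (dir_modulus r xi f (diam G) p G)).
    by apply: ereal_sup_ubound; exists u.
  by apply: ereal_sup_ubound; exists xi.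
have mD : measurable D.
  have -> : D = \bigcap_(j in `I_r.+1) ((fun x => x + j%:R *: (u *: xi)) @^-1` G).
    by apply/seteqP; split => y Dy j jr; apply: Dy.
  apply: fin_bigcap_measurable => [|j _]; first exact: finite_II.
  exact: measurable_preshift.
move=> H; apply: (@le_trans _ _ (Phi p D (difference r (u *: xi) (f \_ G)))).
  by apply: Phi_mono => //; exact: pmeas_difference.
case: p p0 H => [s||] //=.
  rewrite lte_fin => s0 H.
  rewrite (eq_integral (fun x => (`|difference r (u *: xi) f x| `^ s)%:E)); last first.
    by move=> y /set_mem Dy; rewrite E0.
  set J := (\int[_]_(x in D) _)%E in H *.
  have J0 : (0 <= J)%E by apply: integral_ge0.
  have -> : J = ((J `^ s^-1) `^ s)%E by rewrite -poweRrM mulVf ?gt_eqF// poweRe1.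
  rewrite -(poweR1r s); apply: gt0_ler_poweR => //; first exact: ltW.
  - by rewrite in_itv /= leey andbT poweR_ge0.
  - by rewrite in_itv /= leey andbT.
move=> _; apply: le_trans; apply: ge_ereal_sup => _ [->|[y Dy <-]].
  by apply: ereal_sup_ubound; left.
apply: ereal_sup_ubound; right; exists y; first exact: subset_closure.
by rewrite E0.
Qed.

End of_Lp.

(** * X-raying sets of directions and the Whitney constant *)

Section spanning.
Variables (R : realType) (d : nat) (G E : set 'rV[R]_d).
Hypothesis bG : convex_body G.

(* A point of G where the functional x |-> <x, v> is maximal is not illuminated
   in any direction orthogonal to v. *)
Lemma Xrayed_no_normal (v : 'rV[R]_d) : Xrayed G E ->
  (forall e, E e -> e *m v^T = 0) -> v = 0.
Proof.
move=> XG Ev; apply: contrapT => /eqP v0; have [kG _ [c ic]] := bG.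
pose f (x : 'rV[R]_d) := \sum_k x ord0 k * v ord0 k.
have fE x : f x = (x *m v^T) ord0 ord0.
  by rewrite mxE; apply: eq_bigr => k _; rewrite mxE.
have fD x y : f (x + y) = f x + f y by rewrite !fE mulmxDl mxE.
have fZ t x : f (t *: x) = t * f x by rewrite !fE -scalemxAl mxE.
have fe e : (E `|` [set - e | e in E]) e -> f e = 0.
  move=> [/Ev|[e' /Ev H <-]]; rewrite fE ?mulNmx; first by move=> ->; rewrite mxE.
  by rewrite H oppr0 mxE.
have fv : 0 < f v.
  have [k vk] : exists k, v ord0 k != 0.
    apply: contrapT => H; move/eqP: v0; apply; apply/rowP => k; rewrite mxE.
    by apply/eqP/negPn/negP => vk; apply: H; exists k.
  rewrite /f (bigD1 k)//= ltr_pwDl//.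
    by rewrite lt_def mulf_neq0//= -expr2 sqr_ge0.
  by apply: sumr_ge0 => i _; rewrite -expr2 sqr_ge0.
have cf : continuous f.
  move=> x; apply/(cvgrPdist_lt (FF := nbhs_filter x)) => e e0; apply/nbhs_ballP.
  have S0 : 0 <= \sum_k `|v ord0 k| by exact: sumr_ge0.
  exists (e / (1 + \sum_k `|v ord0 k|)); first by rewrite /= divr_gt0// ltr_pwDl.
  move=> y; rewrite -ball_normE /= ltr_pdivlMr ?ltr_pwDl// mulrDr mulr1 => /(le_lt_trans _); apply.
  rewrite /f -sumrB (le_trans (ler_norm_sum _ _ _))// ler_wpDl// mulr_sumr.
  apply: ler_sum => k _; rewrite -mulrBl normrM ler_wpM2r//.
  by have := coord_le_norm (x - y) k; rewrite !mxE.
have G0 : G !=set0 by exists c; exact: interior_subset.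
have [x] := EVT_max_rV G0 kG (continuous_subspaceT cf).
move=> /set_mem Gx Hx.
have Hx' y : interior G y -> f y < f x.
  move=> /interior_ballP[e e0 He].
  have e1 : 0 < e / (1 + `|v|) by rewrite divr_gt0// ltr_pwDl.
  apply: (@lt_le_trans _ _ (f (y + (e / (1 + `|v|)) *: v))).
    by rewrite fD fZ ltrDl mulr_gt0.
  apply: Hx; apply: mem_set; apply: He.
  rewrite -ball_normE /= opprD addrA subrr add0r normrN normrZ.
  by rewrite gtr0_norm// mulrAC ltr_pdivrMr ?ltr_pwDl// ltr_pM2l// ltrDr.
have bx : boundary G x.
  by split; [exact: subset_closure|move=> /Hx'; rewrite ltxx].
have [e /fe e0 [t t0 /Hx']] := XG x bx.
by rewrite fD fZ e0 mulr0 addr0 ltxx.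
Qed.

(** By [Xrayed_no_normal] no nonzero vector is orthogonal to [E], so the finite matrix of its
    vectors has full rank and d independent rows. *)
Lemma Xrayed_basis : finite_set E -> Xrayed G E ->
  exists2 B : 'M[R]_d, B \in unitmx & forall i, E (row i B).
Proof.
move=> /finite_fsetP[X EX] XG.
pose T : finType := X.
pose M : 'M[R]_(#|T|, d) := \matrix_i (val (enum_val i : T)).
have rM : row_full M.
  rewrite /row_full -mxrank_tr -/(row_free _) -kermx_eq0.
  apply/negPn/negP => /rowV0Pn[v /sub_kermxP vM]; apply/negP/negPn.
  apply/eqP/(Xrayed_no_normal XG) => e; rewrite EX /= => eX.
  have -> : e = row (enum_rank (FSetSub eX : T)) M.
    by apply/rowP => k; rewrite !mxE enum_rankK.
  by rewrite -row_mul -[M]trmxK -trmx_mul vM trmx0 row0.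
exists (rowsub (fullrankfun rM) M); first exact: fullrowsub_unit.
move=> i; rewrite EX /= row_rowsub.
have -> : row (fullrankfun rM i) M = val (enum_val (fullrankfun rM i)).
  by apply/rowP => k; rewrite !mxE.
exact: valP.
Qed.

Lemma unitmx_spans (B : 'M[R]_d) : B \in unitmx -> (forall i, E (row i B)) -> spans_rV E.
Proof.
move=> uB rB v; exists [seq row i B | i <- enum 'I_d]; split.
  by move=> e /mapP[i _ ->].
have -> : v = \sum_(i < d) (v *m invmx B) ord0 i *: row i B.
  by rewrite -mulmx_sum_row mulmxKV.
apply: memv_suml => i _; apply: memvZ; apply: memv_span.
by apply/mapP; exists i; rewrite ?mem_enum.
Qed.

End spanning.

(** [c] is put at the centre of the unit cell based at [z0], with all frame coordinates 1/2; moving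
    within the two balls changes them by at most 1/2. *)
Lemma frame (R : realType) d (G : set 'rV[R]_d) c (B : 'M[R]_d) (M : R) :
  interior G c -> B \in unitmx -> 1 <= M -> exists t z0 a, [/\ 0 < t, 0 < a,
    ball c a `<=` G, roomy G (t *: B) (ball z0 a) M &
    forall z x, ball z0 a z -> ball c a x ->
      forall i, 0 <= ((x - z) *m invmx (t *: B)) ord0 i <= 1].
Proof.
move=> /interior_ballP[R0 R00 HR] uB M1.
have [K K0 HK] := mulmx_bounded B.
have KM : 0 < 2 * K * (M + 1) by rewrite !mulr_gt0//; lra.
(* Coordinates up to M, shifted by 1/2, displace a point by at most t K (M + 1) = R0 / 2. *)
pose t := R0 / (2 * K * (M + 1)); have t0 : 0 < t by rewrite divr_gt0.
pose b := t *: B.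
have ub : b \in unitmx by rewrite unitmxZ// unitfE gt_eqF.
have [K' K'0 HK'] := mulmx_bounded (invmx b).
pose h : 'rV[R]_d := const_mx 2^-1.
pose a := Num.min (R0 / 4) (4 * K')^-1.
have a0 : 0 < a by rewrite lt_min divr_gt0//= invr_gt0 mulr_gt0.
have aR : a <= R0 / 4 by rewrite ge_min lexx.
have aK : a * (4 * K') <= 1.
  by rewrite -ler_pdivlMr ?mulr_gt0// mul1r ge_min lexx orbT.
exists t, (c - h *m b), a; split=> //.
- by apply: subset_trans HR; apply: le_ball; lra.
- move=> y s + sM; rewrite -ball_normE /= => Hy; apply: HR; rewrite -ball_normE /=.
  have -> : c - (y + s *m b) = (c - h *m b - y) - (s - h) *m b.
    by rewrite mulmxBl; apply/rowP => i; rewrite !mxE; ring.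
  rewrite (le_lt_trans (ler_normB _ _))//.
  have : `|(s - h) *m b| <= R0 / 2.
    rewrite -scalemxAr normrZ gtr0_norm//.
    apply: (@le_trans _ _ (t * (K * (M + 1)))).
      rewrite ler_wpM2l ?(ltW t0)// (le_trans (HK _))// ler_wpM2l ?(ltW K0)//.
      apply: norm_rV_leP => [|i]; first lra.
      rewrite !mxE (le_trans (ler_normB _ _))//; have := sM i.
      rewrite (@ger0_norm _ 2^-1)//; lra.
    have -> : K * (M + 1) = 2 * K * (M + 1) / 2 by field.
    by rewrite /t mulrA divfK ?gt_eqF.
  move: Hy; set X := `|_|; set Y := `|_|; lra.
move=> z x; rewrite -!ball_normE /= => Hz Hx i.
have -> : x - z = h *m b + ((x - c) + (c - h *m b - z)).
  by apply/rowP => k; rewrite !mxE; ring.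
rewrite mulmxDl mulmxK// mxE [h _ _]mxE.
set w := (_ *m invmx _).
have : `|w ord0 i| <= 2^-1.
  rewrite (le_trans (coord_le_norm _ _))// (le_trans (HK' _))//.
  apply: (@le_trans _ _ (K' * (a + a))); last lra.
  rewrite ler_wpM2l ?(ltW K'0)// (le_trans (ler_normD _ _))// distrC.
  by rewrite lerD// ltW.
by rewrite ler_norml => /andP[w1 w2]; apply/andP; split; lra.
Qed.

Lemma powR_inv_small (R : realType) (X e : R) : 0 <= X -> 0 < e ->
  exists2 m : nat, (0 < m)%N & X * m%:R^-1 `^ e <= 2^-1.
Proof.
move=> X0 e0; pose Y := (2 * X + 1) `^ e^-1.
have XX : 0 < 2 * X + 1 by lra.
pose m := (Num.truncn Y).+1; exists m => //.
have m0 : 0 < m%:R :> R by rewrite ltr0n.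
have H : 2 * X + 1 <= m%:R `^ e.
  have -> : 2 * X + 1 = Y `^ e by rewrite -powRrM mulVf ?gt_eqF// powRr1// ltW.
  apply: ge0_ler_powR; rewrite ?nnegrE ?powR_ge0// ?(ltW e0)// ltW//.
  exact: truncnS_gt.
have me : m%:R^-1 `^ e = (m%:R `^ e)^-1.
  by rewrite -powR_inv1// -powRrM mulN1r powRN.
rewrite me ler_pdivrMr; last by rewrite powR_gt0.
lra.
Qed.

Lemma Phi_triangle (R : realType) d (p : \bar R) (A : set 'rV[R]_d) f g h (K1 K2 : R) :
  (0 < p)%E -> measurable A -> pmeas p f -> pmeas p g -> pmeas p h ->
  (Phi p A (fun x => f x - g x)%R <= K1%:E)%E ->
  (Phi p A (fun x => g x - h x)%R <= K2%:E)%E ->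
  (Phi p A (fun x => f x - h x)%R <= (2 `^ deg p * (K1 + K2))%:E)%E.
Proof.
move=> p0 mA mf mg mh H1 H2.
pose F (i : 'I_2) x := if (i : nat) == 0%N then f x - g x else g x - h x.
pose K (i : 'I_2) := if (i : nat) == 0%N then K1 else K2.
have -> : 2 `^ deg p * (K1 + K2) = \sum_(i < 2) (#|'I_2|%:R * 1) `^ deg p * K i.
  by rewrite card_ord mulr1 !big_ord_recl big_ord0 /K /= addr0 mulrDr.
apply: (@Phi_dom R d p p0 'I_2 (fun=> 1) F (fun=> 0) (fun=> A)) => //.
- exact: pmeasB.
- by case=> -[|i] ?; rewrite /F /=; exact: pmeasB.
- by case=> -[|i] ?; rewrite /F /K.
- by move=> i x; rewrite addr0.
move=> x Ax; rewrite !big_ord_recl big_ord0 /F /= !addr0 !mul1r.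
have -> : f x - h x = (f x - g x) + (g x - h x) by ring.
exact: ler_normD.
Qed.

(** * Iteration and the bound for the Whitney constant *)

Section whitney.
Variables (R : realType) (d r : nat) (p : \bar R) (G E : set 'rV[R]_d).
Hypotheses (r0 : (0 < r)%N) (p0 : (0 < p)%E) (bG : convex_body G).
Hypotheses (fE : finite_set E) (ES : E `<=` sphere) (XG : Xrayed G E).
Implicit Types (f g P Q : 'rV[R]_d -> R).

Let mG : measurable G.
Proof. exact: convex_body_measurable. Qed.

(** Differences of an approximant [P] are those of [g] minus those of g - P. So the interpolant
    inherits bounded differences and can be projected. *)
Lemma Phi_difference_sub c a (u : R) : 0 < a -> ball c a `<=` G ->
  (forall xi x j, E xi -> ball c (a / 2) x -> (j <= r)%N -> ball c a (x + j%:R *: (u *: xi))) ->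
  exists D1 D2 : R, [/\ 0 <= D1, 0 <= D2 & forall g P (K : R), adm r p G E g -> pmeas p P ->
    (Phi p (ball c a) (fun x => g x - P x)%R <= K%:E)%E ->
    forall xi, E xi ->
    (Phi p (ball c (a / 2)) (difference r (u *: xi) P) <= (D1 + D2 * K)%:E)%E].
Proof.
move=> a0 aG aE; pose I : finType := ('I_1 + 'I_r.+1)%type.
pose C (o : I) : R := if o is inr j then 'C(r, j)%:R else 1.
pose n : R := #|I|%:R.
exists ((n * 1) `^ deg p), (\sum_(j < r.+1) (n * 'C(r, j)%:R) `^ deg p).
split; rewrite ?powR_ge0//.
  by apply: sumr_ge0 => j _; exact: powR_ge0.
move=> g P K ag mP H xi Exi; have [mg Hg] := ag.
have -> : (n * 1) `^ deg p + (\sum_(j < r.+1) (n * 'C(r, j)%:R) `^ deg p) * K =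
    \sum_(o : I) (#|I|%:R * C o) `^ deg p * (if o is inr _ then K else 1).
  by rewrite big_sumType /= big_ord1 !mulr1 mulr_suml.
apply: (@Phi_dom R d p p0 I C
  (fun o => if o is inr _ then (fun x => g x - P x) else difference r (u *: xi) g)
  (fun o => if o is inr j then (j : nat)%:R *: (u *: xi) else 0)
  (fun o => if o is inr _ then ball c a else ball c (a / 2))) => //.
- exact: measurable_ball_rV.
- by case=> j; exact: measurable_ball_rV.
- exact: pmeas_difference.
- by case=> j; [exact: pmeas_difference|exact: pmeasB].
- by case=> j.
- case=> j //; apply: Hg => // [|x k xx kr]; first exact: measurable_ball_rV.
  by apply: aG; exact: aE.
- case=> j x xx; first by rewrite addr0.
  by apply: aE => //; rewrite -ltnS.
move=> x xx; rewrite big_sumType /= big_ord1 mul1r addr0.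
have -> : difference r (u *: xi) P x = difference r (u *: xi) g x -
    difference r (u *: xi) (fun x => g x - P x) x by rewrite differenceB subKr.
rewrite (le_trans (ler_normB _ _))// lerD2l (le_trans (ler_norm_sum _ _ _))//.
by apply: ler_sum => j _; rewrite -mulrA normrMsign normrM ger0_norm.
Qed.

Lemma whitney_adm : exists2 C : R, 0 <= C & forall f N, adm r p G E f -> 0 <= N ->
  (Phi p G f <= N%:E)%E -> exists2 Q, dir_poly r E Q &
  (Phi p G (fun x => f x - Q x)%R <= C%:E)%E.
Proof.
have [kG cG [c ic]] := bG.
have [B uB rB] := Xrayed_basis bG fE XG.
have M1 : 1 <= 3 * r%:R + 3 :> R by have := ler0n R r; lra.
have [t [z0 [a [t0 a0 aG Hroom Hx]]]] := frame ic uB M1.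
have ub : t *: B \in unitmx by rewrite unitmxZ// unitfE gt_eqF.
have rowb i : exists xi u, E xi /\ row i (t *: B) = u *: xi.
  by exists (row i B), t; split => //; apply/rowP => j; rewrite !mxE.
set A0 := ball c a.
have mA0 : measurable A0 by exact: measurable_ball_rV.
have cc : ctrl_at r p G E A0 c.
  exists a => //; exists 1 => // g N [mg _] N0 gN.
  rewrite mul1r; apply: (@le_trans _ _ N%:E); last by rewrite lee_fin lerDr.
  apply: le_trans gN; apply: Phi_mono => //; first exact: measurable_ballG.
have [Ct Ct0 HT] := controlled_body r0 p0 bG uB rB XG ic cc.
have [Cc Cc0 HC] := contraction r0 p0 mG ub rowb a0 Hroom Hx.
have r0' : 0 < r%:R :> R by rewrite ltr0n.
(* r steps of this length move a point by at most a/4, so they lead from the ball of radius a/2 into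
   that of radius [a]. *)
pose u : R := a / (4 * r%:R).
have u0 : 0 < u by rewrite divr_gt0// mulr_gt0.
have aE xi x j : E xi -> ball c (a / 2) x -> (j <= r)%N -> ball c a (x + j%:R *: (u *: xi)).
  move=> Exi; rewrite -!ball_normE /= opprD addrA => xx jr.
  have : `|j%:R *: (u *: xi)| <= a / 4.
    have ju : 0 <= j%:R * u by exact: (mulr_ge0 _ (ltW u0)).
    rewrite scalerA normrZ ger0_norm//.
    have xi1 : `|xi| <= 1 by rewrite (le_trans (norm_le_enorm xi))// (ES Exi).
    apply: (@le_trans _ _ (r%:R * u)).
      rewrite -[leRHS]mulr1; apply: ler_pM => //.
      by rewrite ler_wpM2r ?(ltW u0)// ler_nat.
    have -> : r%:R * u = a / 4 by rewrite /u; field; exact: lt0r_neq0.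
    by [].
  move=> H; rewrite (le_lt_trans (ler_normB _ _))//; move: xx H.
  by set X := `|_|; set Y := `|_|; lra.
have [D1 [D2 [D10 D20 HD]]] := Phi_difference_sub a0 aG aE.
have /finite_fsetP[X EX] := fE.
have evE (i : X) : E (val i) by rewrite EX /=; exact: valP.
have Eev xi : E xi -> exists i : X, xi = val i.
  by rewrite EX /= => xX; exists (FSetSub xX).
have un0 : u != 0 by rewrite gt_eqF.
have [Cp Cp0 HP] := project_dir_poly r0 p0 evE Eev ub c a0 un0.
pose w := 2 `^ deg p * (1 + Cp * D2).
have w0 : 0 <= w by rewrite mulr_ge0 ?powR_ge0// addr_ge0 ?mulr_ge0.
(* [m] is fixed only here: the whole factor in front of 1 + N becomes at most 1/2. *)
have [m m0 Hm] := powR_inv_small (mulr_ge0 (mulr_ge0 w0 Cc0) Ct0) (deg_gt0 p0).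
have [C' C'0 HC'] := HC m m0.
(* All that is not multiplied by [N]; the 2^-1 is half of the 1 in 1 + N. *)
pose beta := 2^-1 + w * C' + 2 `^ deg p * (Cp * D1).
have c0 : 0 <= 2 `^ deg p :> R by exact: powR_ge0.
have beta0 : 0 <= beta.
  by rewrite addr_ge0 ?addr_ge0 ?(mulr_ge0 w0 C'0) ?(mulr_ge0 c0 (mulr_ge0 Cp0 D10)).
have step g N : adm r p G E g -> 0 <= N -> (Phi p A0 g <= N%:E)%E ->
    exists2 Q, dir_poly r E Q &
    (Phi p A0 (fun x => g x - Q x)%R <= (N / 2 + beta)%:E)%E.
  move=> ag N0 gN; have [mg _] := ag.
  have N1 : 0 <= Ct * (1 + N) by rewrite mulr_ge0// addr_ge0.
  have [z zz Hz] := HC' g _ ag N1 (HT g N ag N0 gN).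
  set P := interp_at r (t *: B) g z in Hz.
  set eta := _ + C' in Hz.
  have eta0 : 0 <= eta.
    by rewrite addr_ge0 ?(mulr_ge0 (mulr_ge0 Cc0 (powR_ge0 _ _)) N1).
  have aP : axpoly r (t *: B) P by exact: tens_axpoly.
  have mP : pmeas p P by apply: pmeas_continuous; exact: continuous_tens.
  have K0 : 0 <= D1 + D2 * eta by rewrite addr_ge0 ?mulr_ge0.
  have [Q HQ HPQ] := HP P _ aP K0 (HD g P eta ag mP Hz).
  exists Q => //; have [cQ _] := HQ.
  have H := Phi_triangle p0 mA0 mg mP (pmeas_continuous p cQ) Hz HPQ.
  apply: (le_trans H).
  rewrite lee_fin.
  have -> : 2 `^ deg p * (eta + Cp * (D1 + D2 * eta)) = w * eta + 2 `^ deg p * (Cp * D1).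
    by rewrite /w; ring.
  have N2 : 0 <= 1 + N by rewrite addr_ge0.
  have := ler_wpM2r N2 Hm.
  have -> : w * Cc * Ct * m%:R^-1 `^ deg p * (1 + N) =
      w * (Cc * m%:R^-1 `^ deg p * (Ct * (1 + N))) by ring.
  rewrite /beta /eta [w * (_ + C')]mulrDr.
  set Y := w * (_ * _); set Z := w * C'; set V := _ * (Cp * D1); lra.
(* 2 beta is the fixed point of the map N / 2 + beta. Iterating until N / 2^k is at most 1 leaves 1
   + 2 beta on [A0]. *)
exists (Ct * (1 + (1 + 2 * beta))); first by rewrite mulr_ge0// !addr_ge0// mulr_ge0.
move=> f N af N0 fN.
have it k : exists2 Q, dir_poly r E Q &
    (Phi p A0 (fun x => f x - Q x)%R <= (N / 2 ^+ k + 2 * beta)%:E)%E.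
  elim: k => [|k [Q HQ HfQ]].
    exists (fun=> 0); first exact: dir_poly0.
    have -> : (fun x => f x - 0) = f by apply/funext => x; rewrite subr0.
    have [mf _] := af.
    apply: (@le_trans _ _ N%:E).
      by apply: le_trans fN; exact: Phi_mono.
    by rewrite lee_fin expr0 divr1 lerDl mulr_ge0.
  have N1 : 0 <= N / 2 ^+ k + 2 * beta by rewrite addr_ge0 ?mulr_ge0// divr_ge0 ?exprn_ge0.
  have [Q' HQ' H] := step _ _ (adm_sub_dir_poly r0 af HQ) N1 HfQ.
  exists (fun x => Q x + Q' x); first exact: dir_polyD.
  have -> : (fun x => f x - (Q x + Q' x)) = (fun x => f x - Q x - Q' x).
    by apply/funext => x; rewrite opprD addrA.
  apply: (le_trans H); rewrite lee_fin exprS invfM.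
  set e := (2 ^+ k)^-1; lra.
have [k Hk] : exists k : nat, N / 2 ^+ k <= 1.
  exists (Num.truncn N).+1; rewrite ler_pdivrMr ?exprn_gt0// mul1r.
  apply: (@le_trans _ _ (Num.truncn N).+1%:R); first exact/ltW/truncnS_gt.
  by rewrite -natrX ler_nat ltnW// ltn_expl.
have [Q HQ HfQ] := it k; exists Q => //.
apply: HT; first exact: adm_sub_dir_poly.
  by rewrite addr_ge0// mulr_ge0.
by apply: (le_trans HfQ); rewrite lee_fin lerD2r.
Qed.

Lemma whitney_finite : exists C : R, (whitney_constant r G E p <= C%:E)%E.
Proof.
have [C C0 HC] := whitney_adm; have [kG _ _] := bG.
exists (C `^ (deg p)^-1); apply: ge_ereal_sup => _ [f [fp f1] <-].
have [N N0 fN] := Lp_bound p0 kG fp.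
have E0 x : G x -> (f \_ G) x = f x by move=> Gx; rewrite patchE ifT//; exact: mem_set.
have fN' : (Phi p G (f \_ G) <= N%:E)%E.
  apply: le_trans fN; rewrite le_eqVlt; apply/orP; left; apply/eqP.
  case: p => [s||] /=.
  - by apply: eq_integral => x /set_mem Gx; rewrite E0.
  - by congr (ereal_sup (_ `|` _)); apply/seteqP; split => _ [x Gx <-]; exists x => //; rewrite E0.
  - by congr (ereal_sup (_ `|` _)); apply/seteqP; split => _ [x Gx <-]; exists x => //; rewrite E0.
have [Q HQ HfQ] := HC _ N (adm_of_Lp r0 p0 kG ES fp f1) N0 fN'.
apply: (@le_trans _ _ (Lp_norm p G (f \- Q)%R)).
  by apply: ereal_inf_lbound; exists Q.
have clG : closure G = G by rewrite -(closure_id _).1//; exact: convex_body_closed.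
move: HfQ; case: p p0 => [s||] //=.
  rewrite lte_fin => s0 HfQ; rewrite -poweR_EFin.
  rewrite (eq_integral (fun x => (`|(f \_ G) x - Q x| `^ s)%:E)); last first.
    by move=> x /set_mem Gx; rewrite E0.
  apply: gt0_ler_poweR => //; first by rewrite invr_ge0 ltW.
  - by rewrite in_itv /= leey andbT integral_ge0.
  - by rewrite in_itv /= leey andbT lee_fin.
rewrite clG invr1 powRr1// => _ HfQ; apply: le_trans HfQ.
apply: ge_ereal_sup => _ [->|[x Gx <-]]; first by apply: ereal_sup_ubound; left.
by apply: ereal_sup_ubound; right; exists x => //; rewrite E0.
Qed.

End whitney.

(** If [G] contains the ball of radius [e] around [c], adding c - x carries every point within [e]
    of [x] into it; compactness leaves finitely many x. The direction of [w] keeps the set nonempty,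
    since X-ray numbers are positive. *)
Lemma Xrayed_exists (R : realType) d (G : set 'rV[R]_d) : (0 < d)%N -> convex_body G ->
  exists E : set 'rV[R]_d, [/\ finite_set E, E !=set0, E `<=` sphere & Xrayed G E].
Proof.
move=> d0 [kG _ [c /interior_ballP[e e0 He]]].
pose nrm (v : 'rV[R]_d) := (enorm v)^-1 *: v.
have en0 v : v != 0 -> 0 < enorm v.
  by rewrite -normr_gt0 => v0; rewrite (lt_le_trans v0)// norm_le_enorm.
have nrm1 v : v != 0 -> sphere (nrm v).
  move=> /en0 v0; rewrite /sphere /= enormZ gtr0_norm ?invr_gt0// mulVf//.
  by rewrite gt_eqF.
pose w : 'rV[R]_d := delta_mx ord0 (Ordinal d0).
have w0 : w != 0.
  apply/eqP => /rowP/(_ (Ordinal d0)); rewrite !mxE !eqxx /= => /eqP.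
  by rewrite oner_eq0.
(* The default for x = c never has to illuminate: the ball around [c] contains no boundary point. *)
pose dir x := if c - x == 0 then nrm w else nrm (c - x).
have ball_int : ball c e `<=` interior G.
  by rewrite -open_subsetE//; exact: ball_open.
have : cover_compact G by rewrite -compact_cover.
move=> /(_ _ G (fun x => ball x e))[].
- by move=> x Gx; exact: ball_open.
- by move=> x Gx; exists x => //; exact: ballxx.
move=> D DG GD.
exists (nrm w |` [set dir x | x in [set` D]]); split.
- rewrite finite_setU; split; first exact: finite_set1.
  by apply: finite_image; exact: finite_fset.
- by exists (nrm w); left.
- move=> _ [->|[x _ <-]]; first exact: nrm1 w0.
  by rewrite /dir; case: ifPn => [_|cx]; [exact: nrm1 w0|exact: nrm1 cx].
have cG : closed G by apply: compact_closed => //; exact: norm_hausdorff.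
move=> y [/cG Gy nGy].
have [x Dx xy] := GD y Gy.
have cx : c - x != 0.
  apply: contra_notN nGy; rewrite subr_eq0 => /eqP cx.
  by apply: ball_int; rewrite cx.
exists (dir x); first by left; right; exists x.
exists (enorm (c - x)); first exact/ltW/en0.
apply: ball_int; move: xy; rewrite /dir (negbTE cx) -!ball_normE /= => xy.
rewrite /nrm scalerA divff ?scale1r ?gt_eqF ?en0//.
by have -> : c - (y + (c - x)) = x - y by apply/rowP => i; rewrite !mxE; ring.
Qed.

Lemma smallest_pos_exists (P : nat -> Prop) : (exists2 n, (0 < n)%N & P n) ->
  exists n, is_smallest_pos P n.
Proof.
move=> [n n0 Pn].
have ex : exists n, (0 < n)%N && `[< P n >] by exists n; rewrite n0; exact/asboolP.
case: (ex_minnP ex) => m /andP[m0 /asboolP Pm] Hm; exists m; split=> // k k0 Pk.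
by apply: Hm; rewrite k0; exact/asboolP.
Qed.

Lemma card_pos T (A : set T) n : A !=set0 -> (A #= `I_n)%card -> (0 < n)%N.
Proof.
move=> /set0P A0 An; rewrite lt0n; apply: contraNN A0 => /eqP n0.
by move: An; rewrite n0 II0 card_eq0.
Qed.

Theorem theorem6p3 (R : realType) (d : nat) (hd : (3 <= d)%N) :
  (forall (G : set 'rV[R]_d) (E : set 'rV[R]_d),
     convex_body G -> finite_set E -> E `<=` sphere -> Xrayed G E ->
     forall (r : nat) (p : \bar R), (0 < r)%N -> (0 < p)%E ->
       exists C : R, (whitney_constant r G E p <= C%:E)%E) /\
  (forall G : set 'rV[R]_d, convex_body G ->
     exists N X : nat,
       [/\ is_direction_number G N, is_Xray_number G X & (N <= X)%N]).
Proof.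
split=> [G E bG fE ES XG r p r0 p0|G bG]; first exact: whitney_finite.
have [X HX] : exists X, is_Xray_number G X.
  apply: smallest_pos_exists.
  have [E [/finite_setP[n En] E0 ES XE]] := Xrayed_exists (ltnW (ltnW hd)) bG.
  by exists n; [exact: card_pos E0 En|exists E].
have [X0 [E [ES EX XG]] _] := HX.
have fE : finite_set E by apply/finite_setP; exists X.
pose P n := exists E : set 'rV[R]_d, [/\ E `<=` sphere, (E #= `I_n)%card, spans_rV E
  & forall r p, (0 < r)%N -> (0 < p)%E -> (whitney_constant r G E p < +oo)%E].
(* A set attaining the X-ray number also competes for the direction number. *)
have PX : P X.
  exists E; split => //.
    by have [B uB rB] := Xrayed_basis bG fE XG; exact: unitmx_spans uB rB.
  move=> r p r0 p0; have [C HC] := whitney_finite r0 p0 bG fE ES XG.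
  exact: le_lt_trans HC (ltry _).
have [|N HN] := @smallest_pos_exists P; first by exists X.
by exists N, X; split => //; case: HN => _ _; exact.
Qed.
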